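(* Let $\alpha\in(0,1)$, $\delta>0$ and $\tau\ge1$. Suppose that for all sufficiently large $n$ one has $\operatorname{rank}(X_n)=p$, and that for every $M\in\mathcal{I}$ $$\max_{i=1,\dots,n}X_{i,n}[M]\left(X_n[M]'X_n[M]\right)^{-1}X_{i,n}[M]'\to0\quad(n\to\infty).$$ Let $\hat{\mathbb{M}}_n$ be a (measurable) model selection procedure, i.e., a measurable map from $\mathbb{R}^n$ to $\mathsf{M}_n$. Then $$\liminf_{n\to\infty}\ \inf_{\mathbb{P}_n\in\mathbf{P}_n^{(\mathrm{lm})}(\delta,\tau)}\mathbb{P}_n\left(\beta^{*(j)}_{\hat{\mathbb{M}}_n,n}\in\mathrm{CI}^{(j),\mathrm{lm}}_{1-\alpha,\hat{\mathbb{M}}_n}\text{ for all }j=1,\dots,m(\hat{\mathbb{M}}_n)\right)\ge1-\alpha .$$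
   Context: Data distributions. For $\delta>0,\tau\ge1$, $\mathbf{P}_n^{(\mathrm{lm})}(\delta,\tau)$ is the set of all distributions $\mathbb{P}_n$ on $\mathbb{R}^n$ of random vectors $Y_n=(Y_{1,n},\dots,Y_{n,n})'$ with independent coordinates, all having the same variance $\sigma_n^2\in(0,\infty)$, and satisfying $\max_{i\le n}\mathbb{E}(|Y_{i,n}-\mathbb{E}(Y_{i,n})|^{2+\delta})^{2/(2+\delta)}\le\tau\sigma_n^2$. The mean vector $\mu_n=\mathbb{E}(Y_n)\in\mathbb{R}^n$ is unrestricted. Candidate models. $X_n\in\mathbb{R}^{n\times p}$ is a nonrandom design matrix, $p$ not depending on $n$, with $i$-th row $X_{i,n}$. $\mathcal{I}=\{M_1,\dots,M_d\}$ is a fixed nonempty set (not depending on $n$) of nonempty subsets of $\{1,\dots,p\}$. $X_n[M]$ (resp. $X_{i,n}[M]$) is obtained from $X_n$ (resp. $X_{i,n}$) by deleting the columns with index not in $M$. $\mathbb{M}_{j,n}$ is the set of distributions of random vectors $z\in\mathbb{R}^n$ for which there is $\beta\in\mathbb{R}^{|M_j|}$ such that $z-X_n[M_j]\beta$ has independent mean-zero coordinates with a common variance; $\mathsf{M}_n=\{\mathbb{M}_{1,n},\dots,\mathbb{M}_{d,n}\}$. A model $\mathbb{M}\in\mathsf{M}_n$ is identified with its index set $M\in\mathcal{I}$, and $m(\mathbb{M})=|M|$. No model is assumed to be correct. Target and estimators (defined for all large $n$). $\beta^*_{\mathbb{M},n}=(X_n[M]'X_n[M])^{-1}X_n[M]'\mu_n$;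 for $y\in\mathbb{R}^n$, $\hat\beta_{\mathbb{M},n}(y)=(X_n[M]'X_n[M])^{-1}X_n[M]'y$ and $\hat\sigma^2_{\mathbb{M},n}(y)=\frac{1}{n-m(\mathbb{M})}\sum_{i=1}^n(y_i-X_{i,n}[M]\hat\beta_{\mathbb{M},n}(y))^2$. Confidence intervals. $\mathrm{CI}^{(j),\mathrm{lm}}_{1-\alpha,\mathbb{M}}=\hat\beta^{(j)}_{\mathbb{M},n}\pm\sqrt{\hat\sigma^2_{\mathbb{M},n}[(X_n[M]'X_n[M])^{-1}]_j}\;K_{1-\alpha}(\operatorname{corr}(\Gamma_n))$, where $\Gamma_n$ is the block matrix with $(s,t)$-th block ($s,t=1,\dots,d$) $\sigma_n^2(X_n[M_s]'X_n[M_s])^{-1}X_n[M_s]'X_n[M_t](X_n[M_t]'X_n[M_t])^{-1}$ ($\operatorname{corr}(\Gamma_n)$ does not depend on $\sigma_n^2$). Notation. Superscript $(j)$: $j$-th coordinate; $[A]_j$: $j$-th diagonal entry; $a\pm b=[a-b,a+b]$; $\operatorname{corr}(\Sigma)$: correlation matrix corresponding to the covariance matrix $\Sigma$; $K_{1-\alpha}(\Gamma)$: the $(1-\alpha)$-quantile of $\|Z\|_\infty$ with $Z\sim N(0,\Gamma)$. *)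

(* Defs.v *)
From HB Require Import structures.
From mathcomp Require Import all_boot all_order all_algebra.
From mathcomp Require Import all_classical all_reals all_analysis.
From mathcomp Require Import measurable_realfun.

Set Implicit Arguments.
Unset Strict Implicit.
Unset Printing Implicit Defensive.

Import Order.TTheory GRing.Theory Num.Theory numFieldNormedType.Exports.

Local Open Scope classical_set_scope.
Local Open Scope ring_scope.

(* Points of R^n carrying the product (= Borel) sigma-algebra are tuples
   [n.-tuple R]; linear algebra is done on column vectors ['cV[R]_n]. *)

Section Tuples.
Context {R : Type} {n : nat}.

Definition tcol (y : n.-tuple R) : 'cV[R]_n := \col_i tnth y i.

Definition coltup (v : 'cV[R]_n) : n.-tuple R := [tuple v i ord0 | i < n].

Definition tproj (i : 'I_n) (y : n.-tuple R) : R := tnth y i.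

End Tuples.

Section Independence.
Context d (T : measurableType d) (R : realType) (P : probability T R).

Definition mutually_independent (n : nat) (Y : 'I_n -> T -> R) : Prop :=
  forall (J : {set 'I_n}) (B : 'I_n -> set R),
    (forall i, measurable (B i)) ->
    P (\bigcap_(i in [set` J]) Y i @^-1` B i) =
    (\prod_(i in J) P (Y i @^-1` B i))%E.

Definition quantile (X : T -> R) (a : R) : R :=
  inf [set x | (a%:E <= P [set t | X t <= x]%R)%E].

End Independence.

Section DataDistributions.
Context {R : realType} {n : nat}.
Implicit Type P : probability (n.-tuple R) R.

Definition mean P : 'cV[R]_n := \col_i fine 'E_P[tproj i].

(* In [lm_class] the mean is finite: a finite variance forces square
   integrability of the coordinates. *)
Definition lm_class (delta tau : R) : set (probability (n.-tuple R) R) :=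
  [set P | mutually_independent P (@tproj R n) /\
    exists sigma2 : R, [/\ 0 < sigma2,
      forall i, 'V_P[tproj i] = sigma2%:E :> \bar R &
      forall i,
        ('E_P[(fun y => `|tproj i y - mean P i ord0| `^ (2 + delta))%R]
           `^ (2 / (2 + delta)) <= (tau * sigma2)%:E)%E ] ].

End DataDistributions.

Section Gaussian.
Context {R : realType}.

Definition std_normal m (S : probability (m.-tuple R) R) : Prop :=
  mutually_independent S tproj /\
  forall (i : 'I_m) (B : set R), measurable B ->
    S (tproj i @^-1` B) = normal_prob 0 1 B.

(* The laws N(0, G): laws of A g, where g is a vector of iid standard normal
   variables and A A' = G. The covariance G may be singular. The law does not
   depend on the choice of A. *)
Definition centered_normal k (G : 'M[R]_k) : set (probability (k.-tuple R) R) :=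
  [set Q | exists m (A : 'M[R]_(k, m)) (S : probability (m.-tuple R) R),
    [/\ A *m A^T = G, std_normal S &
        forall B, measurable B ->
          Q B = S ((fun g => coltup (A *m tcol g)) @^-1` B)] ].

Definition corr k (G : 'M[R]_k) : 'M[R]_k :=
  \matrix_(i, j) (G i j / (Num.sqrt (G i i) * Num.sqrt (G j j))).

(* The (1 - alpha)-quantile of the sup norm of Z ~ N(0, G) is
   [normal_quantile (1 - alpha) G]; the norm of a matrix is its largest entry
   in absolute value. The set [centered_normal G] is nonempty when G is a Gram
   matrix, see [centered_normal_gram] and [centered_normal_ls_cov]. *)
Definition normal_quantile (a : R) k (G : 'M[R]_k) : R :=
  quantile (get (centered_normal G)) (fun z => `|tcol z|) a.

End Gaussian.

Lemma measurable_tproj (R : realType) n (i : 'I_n) :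
  measurable_fun [set: n.-tuple R] (@tproj R n i).
Proof. exact: measurable_tnth. Qed.

Lemma std_normal_exists (R : realType) m :
  exists S : probability (m.-tuple R) R, std_normal S.
Proof.
elim: m => [|m [S [indS normS]]].
  exists (dirac [tuple]); split=> [J B mB|[]//].
  rewrite (_ : \bigcap_(i in _) _ = setT); last by apply/seteqP; split=> // x _ [].
  by rewrite probability_setT big1// => -[].
pose N : probability (measurableTypeR R) R := normal_prob 0 1.
pose f (x : measurableTypeR R * m.-tuple R) : m.+1.-tuple R :=
  [tuple of x.1 :: x.2].
have mf : measurable_fun setT f by apply: measurable_cons.
pose fm : {mfun _ >-> _} := HB.pack f (isMeasurableFun.Build _ _ _ _ f mf).
pose Q : probability _ R := (N \x S)%E.
exists (distribution Q fm).
have QE A B : measurable A -> measurable B -> Q (A `*` B) = (N A * S B)%E.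
  by move=> mA mB; exact: product_measure1E.
have f0 B : (tproj ord0 \o f) @^-1` B = B `*` setT.
  by apply/seteqP; split => -[x y] //= [].
have fS (i : 'I_m) B : (tproj (lift ord0 i) \o f) @^-1` B = setT `*` (tproj i @^-1` B).
  by apply/seteqP; split => -[x y]; rewrite /= /tproj tnthS//= => -[].
have mS (i : 'I_m) (B : set R) : measurable B -> measurable (@tproj R m i @^-1` B).
  by move=> mB; rewrite -[X in measurable X]setTI; exact: measurable_tproj.
have m0 B : measurable B -> distribution Q fm (tproj ord0 @^-1` B) = N B.
  move=> mB; rewrite /distribution /pushforward -comp_preimage f0.
  by rewrite QE// [X in (_ * X)%E]probability_setT mule1.
have mSS (i : 'I_m) B : measurable B ->
    distribution Q fm (tproj (lift ord0 i) @^-1` B) = S (tproj i @^-1` B).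
  move=> mB; rewrite /distribution /pushforward -comp_preimage fS.
  by rewrite QE// ?[X in (X * _)%E]probability_setT ?mul1e//; exact: mS.
split=> [J B mB|i B mB]; last first.
  by case: (unliftP ord0 i) => [j|] ->; [rewrite [LHS]mSS// normS|exact: m0].
rewrite big_mkcond big_ord_recl/=.
under eq_bigr => i _ do rewrite [X in if _ then X else _](mSS i _ (mB _)).
rewrite [X in (if _ then X else _)](m0 _ (mB _)).
pose J' := [set i : 'I_m | lift ord0 i \in J]%SET.
transitivity (Q ((if ord0 \in J then B ord0 else setT) `*`
   (\bigcap_(i in [set` J']) tproj i @^-1` B (lift ord0 i)))).
  rewrite /distribution /pushforward; congr (Q _).
  apply/seteqP; split=> -[x y] /=.
    move=> h; split.
      by case: ifPn => // h0; have := h ord0 h0.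
    move=> i /= ; rewrite inE => h0; have := h _ h0.
    by rewrite /= /tproj tnthS.
  move=> [hx hy] i /= iJ; case: (unliftP ord0 i) => [j|] ij; rewrite ij in iJ *.
    rewrite /tproj tnthS; apply: (hy j); by rewrite /= inE.
  by move: hx; rewrite iJ.
have mB0 : measurable (if ord0 \in J then B ord0 else setT) by case: ifP.
rewrite QE//; last first.
  apply: fin_bigcap_measurable; first exact: finite_finset.
  by move=> i _; exact: mS.
congr (_ * _)%E.
  by case: ifP => // _; exact: probability_setT.
rewrite indS// big_mkcond/=; apply: eq_bigr => i _.
by rewrite inE.
Qed.

Lemma centered_normal_gram (R : realType) k m (A : 'M[R]_(k, m)) :
  centered_normal (A *m A^T) !=set0.
Proof.
have [S stdS] := std_normal_exists R m.
pose f (g : m.-tuple R) := coltup (A *m tcol g).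
have mf : measurable_fun setT f.
  apply/measurable_fun_tnthP => i.
  rewrite (_ : _ \o _ = fun g => \sum_(j < m) A i j * tproj j g); last first.
    apply/funext => g; rewrite /= /f tnth_mktuple mxE.
    by apply: eq_bigr => j _; rewrite mxE.
  apply: measurable_sum => j; apply: measurable_funM => //; exact: measurable_tproj.
pose fm : {mfun _ >-> _} := HB.pack f (isMeasurableFun.Build _ _ _ _ f mf).
by exists (distribution S fm); exists m, A, S.
Qed.

Section LeastSquares.
Context {R : realType} {n p : nat}.
Implicit Types (X : 'M[R]_(n, p)) (M : {set 'I_p}) (y : n.-tuple R).

Definition submodel X M : 'M[R]_(n, #|M|) :=
  colsub (fun j : 'I_#|M| => enum_val j) X.

Definition gram_inv X M : 'M[R]_#|M| :=
  invmx ((submodel X M)^T *m submodel X M).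

(* The leverages are nonnegative as soon as X[M] has full column rank, so that
   starting the maximum at 0 is harmless. *)
Definition max_leverage X M : R :=
  \big[Num.max/0]_(i < n)
    (row i (submodel X M) *m gram_inv X M *m (row i (submodel X M))^T)
      ord0 ord0.

Definition ls_coef X M (v : 'cV[R]_n) : 'cV[R]_#|M| :=
  gram_inv X M *m (submodel X M)^T *m v.

Definition beta_star X M (P : probability (n.-tuple R) R) : 'cV[R]_#|M| :=
  ls_coef X M (mean P).

Definition beta_hat X M y : 'cV[R]_#|M| := ls_coef X M (tcol y).

Definition sigma2_hat X M y : R :=
  (n%:R - #|M|%:R)^-1 *
  \sum_(i < n)
    (tnth y i - (row i (submodel X M) *m beta_hat X M y) ord0 ord0) ^+ 2.

Context {d : nat}.
Implicit Type Ms : 'I_d -> {set 'I_p}.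

Definition ls_cov (sigma2 : R) X Ms : 'M[R]_(\sum_(s < d) #|Ms s|) :=
  \mxblock_(s < d, t < d)
    (sigma2 *: (gram_inv X (Ms s) *m (submodel X (Ms s))^T *m
                submodel X (Ms t) *m gram_inv X (Ms t))).

(* The interval must not depend on the unknown variance sigma2; by
   [corr_ls_cov] any positive value can be used in [ls_cov]. *)
Lemma corr_ls_cov (sigma2 : R) X Ms :
  0 < sigma2 -> corr (ls_cov sigma2 X Ms) = corr (ls_cov 1 X Ms).
Proof.
move=> s0; have sq0 : Num.sqrt sigma2 != 0 by rewrite gt_eqF ?sqrtr_gt0.
have -> : ls_cov sigma2 X Ms = sigma2 *: ls_cov 1 X Ms.
  by apply/matrixP => i j; rewrite !mxE mul1r.
move: (ls_cov 1 X Ms) => G; apply/matrixP => i j.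
rewrite !mxE !sqrtrM ?(ltW s0)// mulrACA -expr2 sqr_sqrtr ?(ltW s0)//.
by rewrite -mulf_div divff ?mul1r// gt_eqF.
Qed.

Definition conf_int X Ms (alpha : R) (s : 'I_d) y (j : 'I_#|Ms s|) : set R :=
  let h := Num.sqrt (sigma2_hat X (Ms s) y * gram_inv X (Ms s) j j) *
           normal_quantile (1 - alpha) (corr (ls_cov 1 X Ms)) in
  let b := beta_hat X (Ms s) y j ord0 in
  [set` `[b - h, b + h] ].

End LeastSquares.

Lemma centered_normal_ls_cov (R : realType) n p d (X : 'M[R]_(n, p))
    (Ms : 'I_d -> {set 'I_p}) :
  centered_normal (corr (ls_cov 1 X Ms)) !=set0.
Proof.
pose B := \mxcol_(s < d) (gram_inv X (Ms s) *m (submodel X (Ms s))^T).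
have covE : ls_cov 1 X Ms = B *m B^T.
  rewrite tr_mxcol mul_mxcol_mxrow; apply/eq_mxblock => s t.
  rewrite scale1r trmx_mul trmxK !mulmxA; congr (_ *m _).
  by rewrite /gram_inv trmx_inv trmx_mul trmxK.
pose D := diag_mx (\row_i (Num.sqrt (ls_cov 1 X Ms i i))^-1).
rewrite (_ : corr _ = D *m B *m (D *m B)^T); first exact: centered_normal_gram.
rewrite trmx_mul mulmxA -(mulmxA D) -covE tr_diag_mx.
apply/matrixP => i j; rewrite mul_mx_diag mul_diag_mx !mxE.
by rewrite invfM mulrCA mulrA.
Qed.

(* Main.v *)
(* The simultaneous coverage over the data-driven model follows from coverage
   for all models at once. In terms of the standardized noise z, the errors of
   all the coefficient estimators, divided by their true standard deviations,
   form a vector A z with A A' = corr (Gamma_n), and the columns of A are small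
   because the leverages are. Lindeberg's replacement argument with smoothed
   indicators of boxes, together with the anticoncentration of Gaussian
   coordinates, bounds the probability that |A z| <= (1 - o(1)) K below by
   1 - alpha - o(1), uniformly over the class of distributions.
   The variance estimator of a wrong model overestimates: if H is the hat
   matrix and b = (1 - H) mu the bias, the residual sum of squares is at least
   sigma^2 (|z|^2 - |H z|^2 - (u, z)^2) with u the unit vector along b, where
   the subtracted terms have bounded expectation and |z|^2 / n is at least
   1 - o(1) by a truncated law of large numbers. So sigma2_hat is at least
   (1 - o(1)) sigma^2 with probability tending to 1.
   That the box probabilities of a Gaussian vector depend on its covariance
   only is obtained without characteristic functions, by the stability of the
   normal law under (x + y) / sqrt 2. *)

Require Import Defs.
From HB Require Import structures.
From mathcomp Require Import all_boot all_order all_algebra.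
From mathcomp Require Import all_classical all_reals all_analysis.
From mathcomp Require Import measurable_realfun ring lra.

Set Implicit Arguments.
Unset Strict Implicit.
Unset Printing Implicit Defensive.

Import Order.TTheory GRing.Theory Num.Theory numFieldNormedType.Exports.

Local Open Scope classical_set_scope.
Local Open Scope ring_scope.

(** * Product structure of tuples *)

Section tuples.
Context {R : realType}.

(** The correlation matrix depends on n, need not converge and may be singular, so there is no limit
    law to appeal to. Every comparison is an explicit inequality at fixed n whose constants see the
    covariance only through its unit diagonal: Chebyshev's inequality bounds the quantile K, so that
    shrinking the box by a factor close to 1 costs a small absolute amount, and anticoncentration is
    used one coordinate at a time. Lindeberg's error is governed by two facts on the columns of A:
    their squared norms have a bounded sum, because the rows are unit vectors, while the largest one
    tends to 0 with the leverages. The moments of order 2 + delta enter only through the second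
    moments beyond a level B: the expansion is of third order below B and of second order above. The
    quantile belongs to a law chosen among all factorizations of the correlation matrix, whereas
    Lindeberg's argument produces the Gaussian vector A g for the studentized matrix A. This gap is
    why dependence on the covariance only has to be proved; equality on smooth test functions is
    enough. *)

Definition tcons n (z : measurableTypeR R * n.-tuple R) : n.+1.-tuple R :=
  [tuple of z.1 :: z.2].

Lemma measurable_tcons n : measurable_fun setT (@tcons n).
Proof. exact: measurable_cons. Qed.

Lemma tproj_tcons0 n z : tproj ord0 (@tcons n z) = z.1.
Proof. by []. Qed.

Lemma tproj_tconsS n z i : tproj (lift ord0 i) (@tcons n z) = tproj i z.2.
Proof. by rewrite /tproj tnthS. Qed.

Lemma measurable_tproj_preimage n (i : 'I_n) (B : set R) :
  measurable B -> measurable (@tproj R n i @^-1` B).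
Proof.
by move=> mB; rewrite -[X in measurable X]setTI; exact: measurable_tproj.
Qed.

Lemma measurable_rect n (J : {set 'I_n}) (B : 'I_n -> set R) :
  (forall i, measurable (B i)) ->
  measurable (\bigcap_(i in [set` J]) @tproj R n i @^-1` B i).
Proof.
move=> mB; apply: fin_bigcap_measurable; first exact: finite_finset.
by move=> i _; exact: measurable_tproj_preimage.
Qed.

(** Rectangles are stable under intersection and generate the product sigma-algebra, since the
    preimage of a set by one coordinate is a rectangle whose other sides are [setT]. *)
Lemma tuple_measure_unique n (P Q : probability (n.-tuple R) R) :
  (forall (B : 'I_n -> set R), (forall i, measurable (B i)) ->
    P (\bigcap_i tproj i @^-1` B i) = Q (\bigcap_i tproj i @^-1` B i)) ->
  forall A, measurable A -> P A = Q A.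
Proof.
move=> PQ A mA.
pose G : set (set (n.-tuple R)) :=
  [set C | exists B : 'I_n -> set R, (forall i, measurable (B i)) /\
     C = \bigcap_i tproj i @^-1` B i].
apply: (measure_unique G (fun=> setT)) => //.
- apply/seteqP; split; last first.
    apply: smallest_sub; first exact: sigma_algebra_measurable.
    move=> C [B [mB ->]].
    by apply: fin_bigcap_measurable => // i _; exact: measurable_tproj_preimage.
  apply: sub_sigma_algebra2.
  elim/big_ind : _ => [C []//|C D CG DG E [/CG|/DG]//|i _ C [B mB <-]].
  rewrite setTI; exists (fun j : 'I_n => if j == i then B else setT); split.
    by move=> j; case: ifP.
  apply/seteqP; split => [y /= yB j _ /=|y /= yB].
    by case: ifPn => // /eqP ->.
  by have := yB i I; rewrite /= eqxx.
- move=> C D [B [mB ->]] [B' [mB' ->]]; exists (fun i => B i `&` B' i); split.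
    by move=> i; exact: measurableI.
  rewrite -bigcapI; apply: eq_bigcapr => i _; exact: preimage_setI.
- move=> _; exists (fun=> setT); split=> //.
  by apply/seteqP; split.
- by apply/seteqP; split => // x _; exists 0%N.
- by move=> C [B [mB ->]]; exact: PQ.
- by move=> k; rewrite /= probability_setT ltry.
Qed.

(** Splits off the first coordinate, so that statements on independent coordinates go by induction
    on the dimension with Fubini's theorem as the inductive step. *)
Lemma indep_split n (P : probability (n.+1.-tuple R) R) :
  mutually_independent P (@tproj R n.+1) ->
  exists (P0 : probability (measurableTypeR R) R)
         (P' : probability (n.-tuple R) R),
    mutually_independent P' (@tproj R n) /\
    forall A, measurable A -> P A = (P0 \x P')%E (@tcons n @^-1` A).
Proof.
move=> indP.
have m0 : measurable_fun setT (@tproj R n.+1 ord0 : _ -> measurableTypeR R).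
  exact: measurable_tproj.
pose hd : {mfun _ >-> _} := HB.pack (@tproj R n.+1 ord0 : _ -> measurableTypeR R)
  (isMeasurableFun.Build _ _ _ _ _ m0).
pose t (y : n.+1.-tuple R) : n.-tuple R := [tuple of behead y].
have mt : measurable_fun setT t by exact: measurable_behead.
pose tl : {mfun _ >-> _} := HB.pack t (isMeasurableFun.Build _ _ _ _ t mt).
have tprojt y (i : 'I_n) : tproj i (t y) = tproj (lift ord0 i) y.
  by rewrite /tproj [in RHS](tuple_eta y) tnthS.
exists (distribution P hd), (distribution P tl); split.
  move=> J B mB.
  pose B' (j : 'I_n.+1) := if unlift ord0 j is Some i then B i else setT.
  pose J' := [set lift ord0 i | i in J]%SET.
  have mB' j : measurable (B' j) by rewrite /B'; case: unlift.
  have := indP J' B' mB'; rewrite big_imset/=; last first.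
    by move=> i j _ _; exact: lift_inj.
  rewrite /distribution /pushforward/=.
  move=> H; transitivity (P (\bigcap_(i in [set` J']) tproj i @^-1` B' i)).
    congr (P _); apply/seteqP; split=> y yJ j /=.
      move=> /imsetP[i iJ ->]; rewrite /B' liftK -tprojt.
      exact: yJ.
    move=> jJ; have := yJ (lift ord0 j); rewrite /B' /= liftK tprojt; apply.
    by apply/imsetP; exists j.
  rewrite H; apply: eq_bigr => i iJ; rewrite /B' liftK.
  by congr (P _); apply/seteqP; split => y /=; rewrite tprojt.
have mf := @measurable_tcons n.
pose f : {mfun _ >-> _} := HB.pack (@tcons n) (isMeasurableFun.Build _ _ _ _ _ mf).
pose Q : probability _ R := (distribution P hd \x distribution P tl)%E.
have QE A B : measurable A -> measurable B ->
    Q (A `*` B) = (distribution P hd A * distribution P tl B)%E.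
  by move=> mA mB; exact: product_measure1E.
apply: (@tuple_measure_unique _ P (distribution Q f)) => B mB.
transitivity (\prod_(i < n.+1) P (tproj i @^-1` B i))%E.
  rewrite (_ : \bigcap_i _ =
      \bigcap_(i in [set` [set: 'I_n.+1]%SET]) tproj i @^-1` B i).
    by rewrite indP//; apply: eq_bigl => i; rewrite inE.
  by apply/seteqP; split=> y yB i _; apply: yB; rewrite //= inE.
rewrite [RHS](_ : _ = Q (B ord0 `*` (\bigcap_(i in [set` [set: 'I_n]%SET]) tproj i @^-1` B (lift ord0 i)))); last first.
  rewrite /distribution /pushforward; congr (Q _); apply/seteqP; split.
    move=> -[x y] xyB; split; first exact: (xyB ord0).
    by move=> i _ /=; have := xyB (lift ord0 i) I; rewrite /= tproj_tconsS.
  move=> -[x y] [/= x0 yB] j _; case: (unliftP ord0 j) => [i|] -> //=.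
  by rewrite tproj_tconsS; apply: yB; rewrite /= inE.
rewrite QE; [|exact: mB|exact: measurable_rect].
rewrite big_ord_recl; congr (_ * _)%E.
rewrite /distribution /pushforward/=.
pose J' := [set lift ord0 i | i in [set: 'I_n]%SET]%SET.
transitivity (P (\bigcap_(i in [set` J']) tproj i @^-1` B i)).
  rewrite indP// big_imset/=; last by move=> i j _ _; exact: lift_inj.
  by apply: eq_bigl => i; rewrite inE.
congr (P _); apply/seteqP; split=> y yJ j /=.
  by move=> _; rewrite tprojt; apply: yJ; apply/imsetP; exists j; rewrite ?inE.
by move=> /imsetP[i _ ->]; have := yJ i; rewrite /= inE tprojt; exact.
Qed.

End tuples.

(** * Laws and integrals of bounded functions *)

Section law.
Context d1 d2 (T1 : measurableType d1) (T2 : measurableType d2) (R : realType).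
Implicit Types (P : probability T1 R) (Q : probability T2 R).

(** A relation rather than the construction of an image measure: the laws to be decomposed are
    given, and agree with an image measure on measurable sets. *)
Definition law (P : set T1 -> \bar R) (f : T1 -> T2) (Q : set T2 -> \bar R) :=
  forall A, measurable A -> Q A = P (f @^-1` A).

Lemma ge0_integral_law P f Q (g : T2 -> \bar R) : measurable_fun setT f ->
  law P f Q -> measurable_fun setT g -> (forall y, 0 <= g y)%E ->
  (\int[Q]_y g y = \int[P]_x g (f x))%E.
Proof.
move=> mf PfQ mg g0.
pose fm : {mfun _ >-> _} := HB.pack f (isMeasurableFun.Build _ _ _ _ _ mf).
rewrite (eq_measure_integral (distribution P fm)).
  by rewrite (ge0_integral_distribution (P := P) fm).
by move=> A mA _; exact: PfQ.
Qed.

Lemma integral_law P f Q (g : T2 -> \bar R) : measurable_fun setT f ->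
  law P f Q -> measurable_fun setT g ->
  (\int[Q]_y g y = \int[P]_x g (f x))%E.
Proof.
move=> mf PfQ mg; rewrite integralE [RHS]integralE.
have g0 (h : T2 -> \bar R) : measurable_fun setT h -> (forall y, 0 <= h y)%E ->
    (\int[Q]_y h y = \int[P]_x h (f x))%E by exact: ge0_integral_law.
congr (_ - _)%E.
- rewrite g0//; last exact: measurable_funepos. by apply: eq_integral => y _; rewrite !funeposE.
- rewrite g0//; last exact: measurable_funeneg. by apply: eq_integral => y _; rewrite !funenegE.
Qed.

End law.

(** Boundedness gives integrability under every probability at once, and partial integrals stay in
    the class, so that iterated real-valued integrals can be exchanged freely. *)
Definition bounded_mfun d (T : measurableType d) (R : realType) (f : T -> R) :=
  measurable_fun setT f /\ exists c, forall x, `|f x| <= c.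

Section bounded_mfun.
Context d (T : measurableType d) (R : realType).
Implicit Types (P : probability T R) (f g : T -> R).

Lemma bounded_mfun_integrable P f :
  bounded_mfun f -> P.-integrable setT (EFin \o f).
Proof.
move=> [mf [c fc]].
apply: measurable_bounded_integrable => //.
  by rewrite -ge0_fin_numE//; exact: fin_num_measure.
exists c; split; first exact: num_real.
by move=> M cM x _ /=; rewrite (le_trans (fc x))// ltW.
Qed.

Lemma ge0_Rintegral_le P f c : measurable_fun setT f ->
  (forall x, 0 <= f x) -> (\int[P]_x (f x)%:E <= c%:E)%E ->
  P.-integrable setT (EFin \o f) /\ \int[P]_x f x <= c.
Proof.
move=> mf f0 fc; have i : P.-integrable setT (EFin \o f).
  apply/integrableP; split; first exact/measurable_EFinP.
  under eq_integral do rewrite /= ger0_norm//.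
  by rewrite (le_lt_trans fc)// ltry.
split=> //; rewrite -lee_fin /Rintegral fineK//.
exact: integrable_fin_num.
Qed.

Lemma EFin_Rintegral P f : P.-integrable setT (EFin \o f) ->
  (\int[P]_x f x)%:E = (\int[P]_x (f x)%:E)%E.
Proof. by move=> fi; rewrite /Rintegral fineK//; exact: integrable_fin_num. Qed.

Lemma norm_Rintegral_le P f g : P.-integrable setT (EFin \o f) ->
  P.-integrable setT (EFin \o g) -> (forall x, `|f x| <= g x) ->
  `|\int[P]_x f x| <= \int[P]_x g x.
Proof.
move=> fi gi fg; apply: le_trans (le_normr_Rintegral _ fi) _ => //.
apply: le_Rintegral => //.
exact: integrable_norm.
Qed.

Lemma integral_probability_cst P (c : \bar R) : (\int[P]_x c = c)%E.
Proof.
by rewrite -/(cst c) integral_cst// [X in (_ * X)%E]probability_setT mule1.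
Qed.

Lemma Rintegral_probability_cst P (c : R) : \int[P]_x c = c.
Proof. by rewrite Rintegral_cst// [X in fine X]probability_setT mulr1. Qed.

Lemma norm_Rintegral_cst P f c : P.-integrable setT (EFin \o f) ->
  (forall x, `|f x| <= c) -> `|\int[P]_x f x| <= c.
Proof.
move=> fi fc; rewrite -[leRHS](Rintegral_probability_cst P).
apply: norm_Rintegral_le => //.
exact: finite_measure_integrable_cst.
Qed.

Lemma bounded_mfunB f g :
  bounded_mfun f -> bounded_mfun g -> bounded_mfun (fun x => f x - g x).
Proof.
move=> [mf [c fc]] [mg [e ge]]; split; first exact: measurable_funB.
exists (c + e) => x; rewrite (le_trans (ler_normB _ _))//.
exact: lerD.
Qed.

End bounded_mfun.

Lemma bounded_mfun_comp d1 d2 (T1 : measurableType d1) (T2 : measurableType d2)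
  (R : realType) (f : T2 -> R) (g : T1 -> T2) :
  measurable_fun setT g -> bounded_mfun f -> bounded_mfun (f \o g).
Proof.
move=> mg [mf [c fc]]; split; first exact: measurableT_comp.
by exists c => x; exact: fc.
Qed.

Lemma Rintegral_law d1 d2 (T1 : measurableType d1) (T2 : measurableType d2)
  (R : realType) (P : probability T1 R) (Q : probability T2 R) f (g : T2 -> R) :
  measurable_fun setT f -> law P f Q -> bounded_mfun g ->
  \int[Q]_y g y = \int[P]_x g (f x).
Proof.
move=> mf PfQ bg; rewrite /Rintegral (integral_law mf PfQ)//.
exact/measurable_EFinP/bg.1.
Qed.

Section fubini.
Context d1 d2 (T1 : measurableType d1) (T2 : measurableType d2) (R : realType).
Variables (P : probability T1 R) (Q : probability T2 R) (f : T1 * T2 -> R).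
Hypothesis bf : bounded_mfun f.

Lemma bounded_mfun_section1 x : bounded_mfun (fun y => f (x, y)).
Proof.
case: bf => mf [c fc]; split; last by exists c => y.
by apply: measurableT_comp => //; exact: pair1_measurable.
Qed.

Lemma bounded_mfun_section2 y : bounded_mfun (fun x => f (x, y)).
Proof.
case: bf => mf [c fc]; split; last by exists c => x.
by apply: measurableT_comp => //; exact: pair2_measurable.
Qed.

Let PQ : probability _ R := (P \x Q)%E.

Let fi : (P \x Q)%E.-integrable setT (EFin \o f).
Proof. exact: (@bounded_mfun_integrable _ _ _ PQ). Qed.

Lemma bounded_mfun_Rintegral1 : bounded_mfun (fun x => \int[Q]_y f (x, y)).
Proof.
split.
  apply/measurable_EFinP; have := measurable_fubini_F fi.
  apply: eq_measurable_fun => x _ /=.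
  by rewrite EFin_Rintegral//; exact/bounded_mfun_integrable/bounded_mfun_section1.
case: bf => mf [c fc]; exists c => x; apply: norm_Rintegral_cst => //.
exact/bounded_mfun_integrable/bounded_mfun_section1.
Qed.

Lemma bounded_mfun_Rintegral2 : bounded_mfun (fun y => \int[P]_x f (x, y)).
Proof.
split.
  apply/measurable_EFinP; have := measurable_fubini_G fi.
  apply: eq_measurable_fun => x _ /=.
  by rewrite EFin_Rintegral//; exact/bounded_mfun_integrable/bounded_mfun_section2.
case: bf => mf [c fc]; exists c => x; apply: norm_Rintegral_cst => //.
exact/bounded_mfun_integrable/bounded_mfun_section2.
Qed.

Lemma Rintegral_prod1 :
  \int[(P \x Q)%E]_z f z = \int[P]_x \int[Q]_y f (x, y).
Proof.
rewrite /Rintegral -(integral12_prod_meas1 fi); congr fine.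
apply: eq_integral => x _.
by rewrite EFin_Rintegral//; exact/bounded_mfun_integrable/bounded_mfun_section1.
Qed.

Lemma Rintegral_prod2 :
  \int[(P \x Q)%E]_z f z = \int[Q]_y \int[P]_x f (x, y).
Proof.
rewrite /Rintegral -(integral21_prod_meas1 fi); congr fine.
apply: eq_integral => x _.
by rewrite EFin_Rintegral//; exact/bounded_mfun_integrable/bounded_mfun_section2.
Qed.

End fubini.

Section product_law.
Context d1 d2 (T1 : measurableType d1) (T2 : measurableType d2) (R : realType).
Variables (P : probability T1 R) (Q : probability T2 R).

Lemma law_fst : law (P \x Q)%E fst P.
Proof.
move=> A mA; rewrite (_ : _ @^-1` _ = A `*` setT); last first.
  by apply/seteqP; split => -[x y] //= [].
by rewrite product_measure1E// [X in (_ * X)%E]probability_setT mule1.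
Qed.

Lemma law_snd : law (P \x Q)%E snd Q.
Proof.
move=> A mA; rewrite (_ : _ @^-1` _ = setT `*` A); last first.
  by apply/seteqP; split => -[x y] //= [].
by rewrite product_measure1E// [X in (X * _)%E]probability_setT mul1e.
Qed.

End product_law.

(** * Independent coordinates and Lindeberg replacement *)

Section indep.
Context {R : realType}.

Lemma integral_tconsS n (P : probability (n.+1.-tuple R) R) (P0 : probability (measurableTypeR R) R)
    (P' : probability (n.-tuple R) R) (g : R -> \bar R) i :
  law (P0 \x P')%E (@tcons R n) P -> measurable_fun setT g ->
  (\int[P]_y g (tproj (lift ord0 i) y) = \int[P']_y g (tproj i y))%E.
Proof.
move=> PP mg; rewrite (integral_law (@measurable_tcons R n) PP); last first.
  by apply: (measurableT_comp mg); exact: measurable_tproj.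
under eq_integral do rewrite tproj_tconsS.
rewrite [RHS](integral_law _ (@law_snd _ _ _ _ _ P0 P'))//.
by apply: measurableT_comp => //; exact: measurable_tproj.
Qed.

Lemma integral_tcons0 n (P : probability (n.+1.-tuple R) R) (P0 : probability (measurableTypeR R) R)
    (P' : probability (n.-tuple R) R) (g : R -> \bar R) :
  law (P0 \x P')%E (@tcons R n) P -> measurable_fun setT g ->
  (\int[P]_y g (tproj ord0 y) = \int[P0]_x g x)%E.
Proof.
move=> PP mg; rewrite (integral_law (@measurable_tcons R n) PP); last first.
  by apply: measurableT_comp => //; exact: measurable_tproj.
under eq_integral do rewrite tproj_tcons0.
by rewrite [RHS](integral_law _ (@law_fst _ _ _ _ _ P0 P')).
Qed.

Lemma ge0_integral_tcons n (P : probability (n.+1.-tuple R) R) (P0 : probability (measurableTypeR R) R)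
    (P' : probability (n.-tuple R) R) (g : n.+1.-tuple R -> \bar R) :
  law (P0 \x P')%E (@tcons R n) P -> measurable_fun setT g ->
  (forall y, 0 <= g y)%E ->
  (\int[P]_y g y = \int[P0]_x \int[P']_y g (tcons (x, y)))%E.
Proof.
move=> PP mg g0; rewrite (ge0_integral_law (@measurable_tcons R n) PP)//.
rewrite (fubini_tonelli1 (fun z => g (tcons z)))//.
by apply: measurableT_comp => //; exact: measurable_tcons.
Qed.

Lemma Rintegral_tcons1 n (P : probability (n.+1.-tuple R) R) (P0 : probability (measurableTypeR R) R)
    (P' : probability (n.-tuple R) R) (g : n.+1.-tuple R -> R) :
  law (P0 \x P')%E (@tcons R n) P -> bounded_mfun g ->
  \int[P]_y g y = \int[P0]_x \int[P']_y g (tcons (x, y)).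
Proof.
move=> PP bg; rewrite (Rintegral_law (@measurable_tcons R n) PP)//.
rewrite (Rintegral_prod1 P0 P' (f := fun z => g (tcons z)))//.
by apply: bounded_mfun_comp => //; exact: measurable_tcons.
Qed.

Lemma Rintegral_tcons2 n (P : probability (n.+1.-tuple R) R) (P0 : probability (measurableTypeR R) R)
    (P' : probability (n.-tuple R) R) (g : n.+1.-tuple R -> R) :
  law (P0 \x P')%E (@tcons R n) P -> bounded_mfun g ->
  \int[P]_y g y = \int[P']_y \int[P0]_x g (tcons (x, y)).
Proof.
move=> PP bg; rewrite (Rintegral_law (@measurable_tcons R n) PP)//.
rewrite (Rintegral_prod2 P0 P' (f := fun z => g (tcons z)))//.
by apply: bounded_mfun_comp => //; exact: measurable_tcons.
Qed.

Lemma sqr_integrable_integrable d (T : measurableType d) (P : probability T R)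
    (V : T -> R) v :
  measurable_fun setT V -> (\int[P]_x (V x ^+ 2)%:E = v%:E)%E ->
  P.-integrable setT (EFin \o (fun x => V x ^+ 2)) /\
  P.-integrable setT (EFin \o V).
Proof.
move=> mV Vv; have i2 : P.-integrable setT (EFin \o (fun x => V x ^+ 2)).
  apply/integrableP; split.
    by apply/measurable_EFinP; exact: measurable_funX.
  under eq_integral do rewrite /= ger0_norm ?sqr_ge0//.
  by rewrite Vv ltry.
split=> //; apply: (@le_integrable _ _ _ _ _ _ _ (fun x => (1 + V x ^+ 2)%:E)) => //.
- exact/measurable_EFinP.
- move=> x _ /=; rewrite lee_fin [leRHS]ger0_norm ?addr_ge0 ?sqr_ge0//.
  rewrite -(real_normK (num_real (V x))); move: `|V x| => a; nra.
- rewrite (_ : (fun _ => _) = (EFin \o cst 1) \+ (EFin \o (fun x => V x ^+ 2)))//.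
  by apply: integrableD => //; exact: finite_measure_integrable_cst.
Qed.

Lemma integral_quadratic d (T : measurableType d) (P : probability T R)
    (V : T -> R) v a b :
  measurable_fun setT V -> (\int[P]_x (V x ^+ 2)%:E = v%:E)%E ->
  (\int[P]_x (V x)%:E = 0)%E ->
  (\int[P]_x (a + b * V x + V x ^+ 2)%:E = (a + v)%:E)%E.
Proof.
move=> mV Vv V0; have [i2 i1] := sqr_integrable_integrable mV Vv.
have ic : P.-integrable setT (EFin \o cst a) by exact: finite_measure_integrable_cst.
have ib : P.-integrable setT (fun x => b%:E * (V x)%:E)%E.
  exact: integrableZl.
rewrite (_ : (fun x => (_ + _ + _)%:E) = ((EFin \o cst a) \+
   (fun x => b%:E * (V x)%:E)%E) \+ (EFin \o (fun x => V x ^+ 2)))//.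
rewrite integralD//; last exact: integrableD.
by rewrite integralD// integralZl// V0 mule0 adde0 Vv (integral_probability_cst P a%:E).
Qed.

(** The free constant [c] makes the induction work: once the first coordinate is fixed, its
    contribution is added to [c]. Used both for linear forms and for sums of centered truncated
    squares. *)
Lemma integral_sqr_sum_indep n (P : probability (n.-tuple R) R)
    (V : 'I_n -> R -> R) (v : 'I_n -> R) c :
  mutually_independent P (@tproj R n) ->
  (forall i, measurable_fun setT (V i)) ->
  (forall i, \int[P]_y (V i (tproj i y) ^+ 2)%:E = (v i)%:E)%E ->
  (forall i, \int[P]_y (V i (tproj i y))%:E = 0)%E ->
  (\int[P]_y ((c + \sum_i V i (tproj i y)) ^+ 2)%:E =
   (c ^+ 2 + \sum_i v i)%:E)%E.
Proof.
elim: n => [|n IH] in P V v c *.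
  move=> _ _ _ _; rewrite big_ord0; under eq_integral do rewrite big_ord0 addr0.
  by rewrite addr0 integral_probability_cst.
move=> indP mV Vv V0.
have [P0 [P' [indP' PP]]] := indep_split indP.
have mS (h : forall i, R -> R) (i : 'I_n.+1) : measurable_fun setT (h i) ->
    measurable_fun setT (fun y : n.+1.-tuple R => h i (tproj i y)).
  by move=> mh; apply: measurableT_comp => //; exact: measurable_tproj.
rewrite (ge0_integral_tcons PP); last 2 first.
  - apply/measurable_EFinP/measurable_funX; apply: measurable_funD => //.
    by apply: measurable_sum => i; exact: mS.
  - by move=> y; rewrite lee_fin sqr_ge0.
have IHx x : (\int[P']_y ((c + \sum_i V i (tproj i (tcons (x, y)))) ^+ 2)%:E =
    ((c + V ord0 x) ^+ 2 + \sum_(i < n) v (lift ord0 i))%:E)%E.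
  rewrite -(IH P' (fun i => V (lift ord0 i)))//.
  - apply: eq_integral => y _; rewrite big_ord_recl tproj_tcons0 addrA.
    by under eq_bigr do rewrite tproj_tconsS.
  - move=> i; rewrite -Vv.
    rewrite (integral_tconsS (g := fun x => (V (lift ord0 i) x ^+ 2)%:E) i PP)//.
    by apply/measurable_EFinP/measurable_funX.
  - move=> i; rewrite -(V0 (lift ord0 i)).
    rewrite (integral_tconsS (g := fun x => (V (lift ord0 i) x)%:E) i PP)//.
    exact/measurable_EFinP.
under eq_integral do rewrite IHx.
rewrite big_ord_recl.
pose s := \sum_(i < n) v (lift ord0 i).
transitivity (\int[P0]_x (c ^+ 2 + s + (2 * c) * V ord0 x + V ord0 x ^+ 2)%:E)%E.
  by apply: eq_integral => x _; rewrite /s; congr EFin; ring.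
rewrite (@integral_quadratic _ _ P0 _ (v ord0))//.
- by congr EFin; rewrite /s; ring.
- exact: mV.
- rewrite -Vv (integral_tcons0 (g := fun x => (V ord0 x ^+ 2)%:E) PP)//.
  by apply/measurable_EFinP/measurable_funX.
- rewrite -(V0 ord0) (integral_tcons0 (g := fun x => (V ord0 x)%:E) PP)//.
  exact/measurable_EFinP.
Qed.

End indep.

Section lindeberg.
Context {R : realType}.

Lemma Rintegral_near_quadratic (P : probability (measurableTypeR R) R)
    (f r : R -> R) b0 b1 b2 p :
  (\int[P]_x x%:E = 0)%E -> (\int[P]_x (x ^+ 2)%:E = 1)%E ->
  bounded_mfun f -> measurable_fun setT r ->
  (\int[P]_x (r x)%:E <= p%:E)%E ->
  (forall x, `|f x - (b0 + b1 * x + b2 * x ^+ 2)| <= r x) ->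
  `|\int[P]_x f x - (b0 + b2)| <= p.
Proof.
move=> P0 P1 bf mr rp fr.
have mid : measurable_fun setT (id : measurableTypeR R -> R) by exact: measurable_id.
have [i2 i1] := @sqr_integrable_integrable _ _ _ P _ _ mid P1.
have fi : P.-integrable setT (EFin \o f) by exact: bounded_mfun_integrable.
have ic : P.-integrable setT (EFin \o cst b0) by exact: finite_measure_integrable_cst.
have il : P.-integrable setT (EFin \o (fun x => b1 * x)).
  by rewrite (_ : _ \o _ = (fun x => b1%:E * x%:E)%E)//; exact: integrableZl.
have iq : P.-integrable setT (EFin \o (fun x => b2 * x ^+ 2)).
  by rewrite (_ : _ \o _ = (fun x => b2%:E * (x ^+ 2)%:E)%E)//; exact: integrableZl.
have icl : P.-integrable setT (EFin \o (fun x => b0 + b1 * x)).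
  by rewrite (_ : _ \o _ = (EFin \o cst b0) \+ (EFin \o (fun x => b1 * x)))//; exact: integrableD.
have iclq : P.-integrable setT (EFin \o (fun x => b0 + b1 * x + b2 * x ^+ 2)).
  by rewrite (_ : _ \o _ = (EFin \o (fun x => b0 + b1 * x)) \+ (EFin \o (fun x => b2 * x ^+ 2)))//; exact: integrableD.
have -> : b0 + b2 = \int[P]_x (b0 + b1 * x + b2 * x ^+ 2).
  rewrite RintegralD// RintegralD// (Rintegral_probability_cst P).
  by rewrite !RintegralZl// /Rintegral P0 P1/= mulr0 mulr1 addr0.
have r0 x : 0 <= r x by exact: le_trans (fr x).
have [ir rle] := @ge0_Rintegral_le _ _ _ P _ _ mr r0 rp.
rewrite -RintegralB//; apply: le_trans rle.
apply: norm_Rintegral_le => //.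
exact: (integrableB _ fi iclq).
Qed.

(* The [b0], [b1], [b2] expansions do not depend on the law of the [i]-th
   coordinate, so replacing that coordinate only costs the remainders. *)
Lemma lindeberg_swap n (P Q : probability (n.-tuple R) R) (F : n.-tuple R -> R)
    (r : 'I_n -> R -> R) (p q : 'I_n -> R) :
  mutually_independent P (@tproj R n) -> mutually_independent Q (@tproj R n) ->
  (forall i, \int[P]_y (tproj i y)%:E = 0)%E ->
  (forall i, \int[Q]_y (tproj i y)%:E = 0)%E ->
  (forall i, \int[P]_y (tproj i y ^+ 2)%:E = 1)%E ->
  (forall i, \int[Q]_y (tproj i y ^+ 2)%:E = 1)%E ->
  bounded_mfun F -> (forall i, measurable_fun setT (r i)) ->
  (forall i, \int[P]_y (r i (tproj i y))%:E <= (p i)%:E)%E ->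
  (forall i, \int[Q]_y (r i (tproj i y))%:E <= (q i)%:E)%E ->
  (forall i y, exists b0 b1 b2, forall y',
    (forall j, j != i -> tproj j y' = tproj j y) ->
    `|F y' - (b0 + b1 * tproj i y' + b2 * tproj i y' ^+ 2)| <= r i (tproj i y')) ->
  `|\int[P]_y F y - \int[Q]_y F y| <= \sum_i (p i + q i).
Proof.
elim: n => [|n IH] in P Q F r p q *.
  move=> _ _ _ _ _ _ _ _ _ _ _; rewrite big_ord0.
  suff -> : F = fun=> F [tuple] by rewrite !Rintegral_probability_cst subrr normr0.
  by apply/funext => y; rewrite [y]tuple0.
move=> indP indQ P1 Q1 P2 Q2 bF mr rp rq FT.
have [P0 [P' [indP' PP]]] := indep_split indP.
have [Q0 [Q' [indQ' QQ]]] := indep_split indQ.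
have msqr : measurable_fun [set: R] (fun x => (x ^+ 2)%:E).
  exact/measurable_EFinP/measurable_funX.
have mre i : measurable_fun [set: R] (fun x => (r i x)%:E) by exact/measurable_EFinP.
have bsec1 x : bounded_mfun (fun y => F (tcons (x, y))).
  by apply: bounded_mfun_comp bF; apply: measurableT_comp; [exact: measurable_tcons|exact: pair1_measurable].
have bsec2 y : bounded_mfun (fun x : measurableTypeR R => F (@tcons R n (x, y))).
  by apply: bounded_mfun_comp bF; apply: measurableT_comp; [exact: measurable_tcons|exact: pair2_measurable].
have bG : bounded_mfun (fun z => F (@tcons R n z)).
  exact: bounded_mfun_comp (@measurable_tcons R n) bF.
have bI2 (S : probability (measurableTypeR R) R) :
    bounded_mfun (fun y => \int[S]_x F (@tcons R n (x, y))).
  exact: (bounded_mfun_Rintegral2 S P' bG).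
have bI1 (S : probability (n.-tuple R) R) :
    bounded_mfun (fun x : measurableTypeR R => \int[S]_y F (tcons (x, y))).
  exact: (bounded_mfun_Rintegral1 P0 S bG).
rewrite (Rintegral_tcons2 PP)// (Rintegral_tcons1 QQ)//.
(* The hybrid law: [Q0] on the first coordinate, [P'] on the others. The first swap is estimated
   pointwise in the tail, the remaining ones by induction pointwise in the head. *)
pose mid := \int[P']_y \int[Q0]_x F (tcons (x, y)).
have midE : mid = \int[Q0]_x \int[P']_y F (tcons (x, y)).
  by rewrite /mid -(Rintegral_prod2 Q0 P' bG) (Rintegral_prod1 Q0 P' bG).
rewrite big_ord_recl -(subrK mid (\int[P']_y _)) -addrA.
rewrite (le_trans (ler_normD _ _))//; apply: lerD.
- rewrite /mid -RintegralB//; last 2 first.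
  + exact/bounded_mfun_integrable/bI2.
  + exact/bounded_mfun_integrable/bI2.
  apply: norm_Rintegral_cst.
    apply/bounded_mfun_integrable/bounded_mfunB.
      exact: bI2.
    exact: bI2.
  move=> y; have [b0 [b1 [b2 H]]] := FT ord0 (tcons (0, y)).
  have H' x : `|F (tcons (x, y)) - (b0 + b1 * x + b2 * x ^+ 2)| <= r ord0 x.
    apply: H => j; case: (unliftP ord0 j) => [i ->|->]; last by rewrite eqxx.
    by rewrite !tproj_tconsS.
  rewrite (_ : _ - _ = (\int[P0]_x F (tcons (x, y)) - (b0 + b2)) -
    (\int[Q0]_x F (tcons (x, y)) - (b0 + b2))); last by ring.
  rewrite (le_trans (ler_normB _ _))//; apply: lerD.
  + apply: (@Rintegral_near_quadratic P0 _ (r ord0) _ b1) => //.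
    * by rewrite -(P1 ord0) (integral_tcons0 (g := EFin) PP).
    * by rewrite -(P2 ord0) (integral_tcons0 (g := fun x => (x ^+ 2)%:E) PP).
    * exact: bsec2.
    * by have := rp ord0; rewrite (integral_tcons0 (g := fun x => (r ord0 x)%:E) PP (mre ord0)).
  + apply: (@Rintegral_near_quadratic Q0 _ (r ord0) _ b1) => //.
    * by rewrite -(Q1 ord0) (integral_tcons0 (g := EFin) QQ).
    * by rewrite -(Q2 ord0) (integral_tcons0 (g := fun x => (x ^+ 2)%:E) QQ).
    * exact: bsec2.
    * by have := rq ord0; rewrite (integral_tcons0 (g := fun x => (r ord0 x)%:E) QQ (mre ord0)).
- rewrite midE -RintegralB//; last 2 first.
  + exact/bounded_mfun_integrable/bI1.
  + exact/bounded_mfun_integrable/bI1.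
  apply: norm_Rintegral_cst.
    apply/bounded_mfun_integrable/bounded_mfunB.
      exact: bI1.
    exact: bI1.
  move=> x; apply: (IH _ _ _ (fun i => r (lift ord0 i))) => //.
  + by move=> i; rewrite -(P1 (lift ord0 i)) (integral_tconsS (g := EFin) i PP).
  + by move=> i; rewrite -(Q1 (lift ord0 i)) (integral_tconsS (g := EFin) i QQ).
  + by move=> i; rewrite -(P2 (lift ord0 i)) (integral_tconsS (g := fun x => (x ^+ 2)%:E) i PP).
  + by move=> i; rewrite -(Q2 (lift ord0 i)) (integral_tconsS (g := fun x => (x ^+ 2)%:E) i QQ).
  + by move=> i; have := rp (lift ord0 i); rewrite (integral_tconsS (g := fun x => (r (lift ord0 i) x)%:E) i PP (mre _)).
  + by move=> i; have := rq (lift ord0 i); rewrite (integral_tconsS (g := fun x => (r (lift ord0 i) x)%:E) i QQ (mre _)).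
  move=> i y; have [b0 [b1 [b2 H]]] := FT (lift ord0 i) (tcons (x, y)).
  exists b0, b1, b2 => y' yy'; rewrite -(tproj_tconsS (x, y')).
  apply: H => j; case: (unliftP ord0 j) => [k|] -> //.
  rewrite !tproj_tconsS => ki; apply: yy'; apply: contraNneq ki => ->.
  by rewrite eqxx.
Qed.

End lindeberg.

(** * The standard normal distribution *)

Section normal.
Context {R : realType}.
Local Notation mu := (@lebesgue_measure R).
Local Notation phi := (@normal_pdf R 0 1).

Definition stdN : probability (measurableTypeR R) R := normal_prob 0 1.

(** The change of variables is done with the Radon-Nikodym derivative, which equals the Gaussian
    density almost everywhere because both have the same integral over every measurable set. *)
Lemma ge0_integral_stdN (f : R -> \bar R) : measurable_fun setT f ->
  (forall x, 0 <= f x)%E ->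
  (\int[stdN]_x f x = \int[mu]_x (f x * (phi x)%:E))%E.
Proof.
move=> mf f0.
have dom : stdN `<< mu by exact: normal_prob_dominates.
rewrite -(Radon_Nikodym_SigmaFinite.change_of_variables dom)//.
have mfi := Radon_Nikodym_SigmaFinite.f_integrable dom.
have mphi : measurable_fun setT (EFin \o phi).
  by apply/measurable_EFinP; exact: measurable_normal_pdf.
apply: ge0_ae_eq_integral => //.
- apply: emeasurable_funM => //; exact: measurable_int mfi.
- exact: emeasurable_funM.
- by move=> x _; rewrite mule_ge0// Radon_Nikodym_SigmaFinite.f_ge0.
- by move=> x _; rewrite mule_ge0// lee_fin normal_pdf_ge0.
- apply: ae_eqe_mul2l; apply: integral_ae_eq => //.
  by move=> E _ mE; rewrite -Radon_Nikodym_SigmaFinite.f_integral.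
Qed.

Lemma normal_peakM (s : R) : 0 < s -> normal_peak s = s^-1 * normal_peak 1.
Proof.
move=> s0; rewrite /normal_peak -mulrnAr sqrtrM ?sqr_ge0// sqrtr_sqr gtr0_norm//.
by rewrite expr1n mul1r invfM.
Qed.

(** The integrand times the standard density is [s] times the centered normal density of standard
    deviation [s]. Combined with [1 + x <= expR x], these integrals control the second and third
    moments. *)
Lemma integral_stdN_expR_sqr (s : R) : 0 < s ->
  (\int[stdN]_x (expR ((1 - s ^- 2) * (x ^+ 2 / 2)))%:E = s%:E)%E.
Proof.
move=> s0; have sn0 : s != 0 by rewrite gt_eqF.
rewrite ge0_integral_stdN; last 2 first.
  - apply/measurable_EFinP/measurableT_comp => //.
    apply: measurable_funM => //; apply: measurable_funM => //.
  - by move=> x; rewrite lee_fin expR_ge0.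
transitivity (\int[mu]_x (s%:E * (normal_pdf 0 s x)%:E))%E; last first.
  rewrite ge0_integralZl//; first by rewrite integral_normal_pdf mule1.
  - by apply/measurable_EFinP; exact: measurable_normal_pdf.
  - by move=> x _; rewrite lee_fin normal_pdf_ge0.
  - by rewrite lee_fin ltW.
apply: eq_integral => x _; rewrite -!EFinM; congr EFin.
rewrite normal_pdfE ?oner_neq0// normal_pdfE// (normal_peakM s0).
rewrite -[X in s * X]mulrA mulVKf// mulrCA; congr (_ * _).
rewrite /normal_fun -expRD; congr expR; by field; rewrite ?sn0.
Qed.

(** Exponential tilting: the integrand times the standard density is the normal density of mean [m]
    and variance 1. *)
Lemma integral_stdN_expR (m : R) :
  (\int[stdN]_x (expR (m * x - m ^+ 2 / 2))%:E = 1)%E.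
Proof.
rewrite ge0_integral_stdN; last 2 first.
  - apply/measurable_EFinP/measurableT_comp => //.
    by apply: measurable_funB => //; exact: measurable_funM.
  - by move=> x; rewrite lee_fin expR_ge0.
rewrite -(integral_normal_pdf m 1).
apply: eq_integral => x _; rewrite -!EFinM; congr EFin.
rewrite !normal_pdfE ?oner_neq0// [LHS]mulrC -mulrA; congr (_ * _).
rewrite /normal_fun -expRD; congr expR; by field.
Qed.

Let mexpsq (c : R) : measurable_fun [set: R] (fun x => (expR (c * (x ^+ 2 / 2)))%:E).
Proof.
apply/measurable_EFinP/measurableT_comp => //.
by apply: measurable_funM => //; apply: measurable_funM.
Qed.

Lemma stdN_abs3_lty : exists c, (\int[stdN]_x (`|x| ^+ 3)%:E <= c%:E)%E.
Proof.
(* [|x| ^+ 3 <= 64 * (1 + x ^+ 2 / 8) ^+ 2 <= 64 * expR (x ^+ 2 / 4)], and the last exponential has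
   integral [Num.sqrt 2], by the case [s = Num.sqrt 2] of [integral_stdN_expR_sqr]. *)
exists (64 * Num.sqrt 2).
have s2 : 0 < Num.sqrt (2 : R) by rewrite sqrtr_gt0.
rewrite EFinM -(integral_stdN_expR_sqr s2) sqr_sqrtr//.
rewrite -ge0_integralZl//; last exact: mexpsq.
apply: ge0_le_integral => //.
- apply/measurable_EFinP/measurable_funX.
  exact: normr_measurable.
- by apply: emeasurable_funM => //; exact: mexpsq.
move=> x _; rewrite -EFinM lee_fin.
have -> : (1 - 2^-1) * (x ^+ 2 / 2) = x ^+ 2 / 8 + x ^+ 2 / 8 :> R by field.
rewrite expRD; have := expR_ge1Dx (x ^+ 2 / 8).
rewrite -(real_normK (num_real x)); move: `|x| (normr_ge0 x) => a a0.
move: (expR _) => e ae; apply: (@le_trans _ _ (64 * ((1 + a ^+ 2 / 8) * (1 + a ^+ 2 / 8)))).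
  have -> : 64 * ((1 + a ^+ 2 / 8) * (1 + a ^+ 2 / 8)) = 64 + 16 * a ^+ 2 + a ^+ 4 :> R by field.
  have := sqr_ge0 (a ^+ 2 - a / 2); have := sqr_ge0 a.
  have -> : (a ^+ 2 - a / 2) ^+ 2 = a ^+ 4 - a ^+ 3 + a ^+ 2 / 4 by field.
  lra.
by rewrite ler_pM2l// ler_pM//; rewrite addr_ge0// divr_ge0// sqr_ge0.
Qed.

(* With [m] the second moment, [1 + x <= expR x] applied to the exponential
   moments gives [1 + (1 - s ^- 2) / 2 * m <= s] for all [0 < s]; letting [s]
   approach 1 from both sides forces [m = 1]. *)
Lemma integral_stdN_sqr : (\int[stdN]_x (x ^+ 2)%:E = 1)%E.
Proof.
have msq : measurable_fun [set: R] (fun x => (x ^+ 2)%:E).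
  exact/measurable_EFinP/measurable_funX.
have sq0 (x : R) : (0 <= (x ^+ 2)%:E)%E by rewrite lee_fin sqr_ge0.
set M := (\int[stdN]_x (x ^+ 2)%:E)%E.
have M0 : (0 <= M)%E by apply: integral_ge0.
(* Finiteness comes first, from the case [s = 2]: [x ^+ 2 <= 8 * (1 + 3 / 8 * x ^+ 2)], and the
   dominating exponential has integral 2. *)
have Mfin : (M <= 16%:E)%E.
  have s2 : 0 < (2 : R) by [].
  have -> : 16%:E = (8%:E * (\int[stdN]_x (expR ((1 - 2 ^- 2) * (x ^+ 2 / 2)))%:E))%E.
    by rewrite integral_stdN_expR_sqr// -EFinM; congr EFin; lra.
  rewrite -ge0_integralZl//; last exact: mexpsq.
  apply: ge0_le_integral => //.
  - by apply: emeasurable_funM => //; exact: mexpsq.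
  move=> x _; rewrite -EFinM lee_fin.
  have := expR_ge1Dx ((1 - 2 ^- 2) * (x ^+ 2 / 2)).
  have := sqr_ge0 x; lra.
have ME : M = (fine M)%:E by rewrite fineK// ge0_fin_numE// (le_lt_trans Mfin)// ltry.
have key s : 0 < s -> 1 + (1 - s ^- 2) / 2 * fine M <= s.
  move=> s0; rewrite -lee_fin -(integral_stdN_expR_sqr s0).
  (* Additivity and monotonicity are applied to nonnegative integrands only; when the coefficient is
     negative, its term is moved to the other side of the inequality. *)
  have [u0|u0] := leP 0 (1 - s ^- 2).
    rewrite EFinD EFinM -ME -ge0_integralZl//; last by rewrite lee_fin divr_ge0.
    rewrite -[X in (X + _)%E](integral_probability_cst stdN) -ge0_integralD//; last 2 first.
      by move=> x _; rewrite mule_ge0// lee_fin divr_ge0.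
      exact: emeasurable_funM.
    apply: ge0_le_integral => //.
    - by move=> x _; rewrite adde_ge0// mule_ge0// lee_fin divr_ge0.
    - by apply: emeasurable_funD => //; exact: emeasurable_funM.
    - exact: mexpsq.
    move=> x _; rewrite -EFinM -EFinD lee_fin.
    by have := expR_ge1Dx ((1 - s ^- 2) * (x ^+ 2 / 2)); lra.
  have v0 : 0 <= (s ^- 2 - 1) / 2 by rewrite divr_ge0//; lra.
  rewrite (_ : 1 + _ = 1 - (s ^- 2 - 1) / 2 * fine M); last by ring.
  rewrite EFinB leeBlDr// EFinM -ME -ge0_integralZl//.
  rewrite -[leLHS](integral_probability_cst stdN) -ge0_integralD//; last 3 first.
  - exact: mexpsq.
  - by move=> x _; rewrite mule_ge0// lee_fin.
  - exact: emeasurable_funM.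
  apply: ge0_le_integral => //.
  - by apply: emeasurable_funD; [exact: mexpsq|exact: emeasurable_funM].
  move=> x _; rewrite -EFinM -EFinD lee_fin.
  by have := expR_ge1Dx ((1 - s ^- 2) * (x ^+ 2 / 2)); lra.
have m0 : 0 <= fine M by exact: fine_ge0.
rewrite ME; congr EFin; move: (fine M) m0 key => m m0 key; apply/eqP; rewrite eq_le.
have key' s : 0 < s -> (s ^+ 2 - 1) * m <= 2 * s ^+ 2 * (s - 1).
  move=> s0; have s20 : 0 < 2 * s ^+ 2 by rewrite mulr_gt0// exprn_gt0.
  have : (1 + (1 - s ^- 2) / 2 * m) * (2 * s ^+ 2) <= s * (2 * s ^+ 2).
    by rewrite ler_pM2r//; exact: key.
  have -> : (1 + (1 - s ^- 2) / 2 * m) * (2 * s ^+ 2) = 2 * s ^+ 2 + (s ^+ 2 - 1) * m.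
    by field; rewrite gt_eqF.
  lra.
apply/andP; split; rewrite leNgt; apply/negP => m1.
(* With [m = 1 + 4 * t] and [s = 1 + t], the first-order terms in [key'] agree and the second-order
   ones are [9 * t ^+ 2] on the left against [4 * t ^+ 2] on the right. The case [m < 1] is the same
   with [- t], where [t <= 4^-1] absorbs the cubic terms. *)
- have [t tE] : exists t, m = 1 + 4 * t by exists ((m - 1) / 4); field.
  have t0 : 0 < t by lra.
  have t2 : 0 < t ^+ 2 by rewrite exprn_gt0.
  have t3 : 0 < t ^+ 3 by rewrite exprn_gt0.
  have s0 : 0 < 1 + t by lra.
  by have := key' _ s0; rewrite tE; nra.
- have [t tE] : exists t, m = 1 - 4 * t by exists ((1 - m) / 4); field.
  have t0 : 0 < t by lra.
  have t2 : 0 < t ^+ 2 by rewrite exprn_gt0.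
  have t1 : t <= 4^-1 by lra.
  have t3 : t ^+ 3 <= t ^+ 2 / 4 by rewrite exprSr ler_pM2l.
  have s0 : 0 < 1 - t by lra.
  by have := key' _ s0; rewrite tE; nra.
Qed.

(** Integrating [1 + x <= expR x] in the tilting identity bounds [m * e] by [m ^+ 2 / 2] for every
    [m], where [e] is the mean; taking [m = e] forces [e = 0]. *)
Lemma integral_stdN_id : (\int[stdN]_x x%:E = 0)%E.
Proof.
have mid : measurable_fun setT (id : measurableTypeR R -> R) by exact: measurable_id.
have [_ i1] := @sqr_integrable_integrable _ _ _ stdN _ _ mid integral_stdN_sqr.
rewrite -(EFin_Rintegral i1); set e := \int[stdN]_x _; congr EFin.
have key m : 1 + m * e - m ^+ 2 / 2 <= 1.
  have im : stdN.-integrable setT (EFin \o (fun x => m * x)).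
    by rewrite (_ : _ \o _ = (fun x => m%:E * x%:E)%E)//; exact: integrableZl.
  have ic c : stdN.-integrable setT (EFin \o cst c).
    exact: finite_measure_integrable_cst.
  have imc : stdN.-integrable setT (EFin \o (fun x => 1 - m ^+ 2 / 2 + m * x)).
    rewrite (_ : _ \o _ = (EFin \o cst (1 - m ^+ 2 / 2)) \+ (EFin \o (fun x => m * x)))//.
    exact: integrableD.
  have -> : 1 + m * e - m ^+ 2 / 2 = \int[stdN]_x (1 - m ^+ 2 / 2 + m * x).
    rewrite RintegralD//; last exact: ic.
    by rewrite Rintegral_cst// [X in fine X]probability_setT mulr1 RintegralZl// -/e; ring.
  have mex : measurable_fun setT (fun x : measurableTypeR R => expR (m * x - m ^+ 2 / 2)).
    apply: measurableT_comp => //.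
    by apply: measurable_funB => //; exact: measurable_funM.
  have [|ie ele] := @ge0_Rintegral_le _ _ _ stdN _ 1 mex (fun x => expR_ge0 _).
    by rewrite integral_stdN_expR.
  apply: le_trans ele; apply: le_Rintegral => //.
  by move=> x _; rewrite (le_trans _ (expR_ge1Dx _))//; lra.
have := key e; have := sqr_ge0 e; rewrite -expr2 => ? ?.
by apply/eqP; rewrite -sqrf_eq0 eq_le; apply/andP; split=> //; lra.
Qed.

End normal.

(** * Stability of the standard normal law on the line *)

Section stability.
Context {R : realType}.
Local Notation mu := (@lebesgue_measure R).
Local Notation phi := (@normal_pdf R 0 1).

Lemma ge0_integral_affine (G : R -> R) (a m : R) : 0 < a -> continuous G ->
  (forall x, 0 <= G x) ->
  (\int[mu]_x (G x)%:E = \int[mu]_x (G ((x - m) * a) * a)%:E)%E.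
Proof.
move=> a0 cG G0; pose F (x : R^o) := (x - m) * a.
have F'E : F^`()%classic = cst a.
  apply/funext => x; rewrite /F derive1E deriveM// deriveD// derive_cst scaler0.
  by rewrite add0r derive_id derive_cst addr0 scaler1.
rewrite (increasing_ge0_integration_by_substitutionT (F := F))//.
- by apply: eq_integral => x _ /=; rewrite !fctE F'E.
- by move=> x y xy; rewrite /F ltr_pM2r// ltrD2r.
- by rewrite F'E => ?; exact: cvg_cst.
- by rewrite F'E; exact: is_cvg_cst.
- by rewrite F'E; exact: is_cvg_cst.
- by apply/gt0_cvgMlNy => //; exact: cvg_addrr_Ny.
- by apply/gt0_cvgMly => //; exact: cvg_addrr.
Qed.

(** In the variables [x] and [u = (x + y) / r], the joint density is proportional to
    [phi x * phi (r * u - x)], which equals [phi u * phi (r * x - u)] by rotation invariance.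
    Tonelli's theorem then allows [x] to be integrated out first, which leaves [phi u]. *)
Lemma stdN_stable (f : R -> R) : continuous f -> (forall x, 0 <= f x) ->
  (\int[stdN]_x \int[stdN]_y (f ((x + y) / Num.sqrt 2))%:E =
   \int[stdN]_x (f x)%:E)%E.
Proof.
move=> cf f0; pose r : R := Num.sqrt 2.
have r0 : 0 < r by rewrite sqrtr_gt0.
have rn0 : r != 0 by rewrite gt_eqF.
have r2 : r ^+ 2 = 2 by rewrite sqr_sqrtr.
have cphi : continuous phi by apply: continuous_normal_pdf; rewrite oner_neq0.
have mf : measurable_fun [set: R] f by exact: continuous_measurable_fun.
have mphi : measurable_fun [set: R] phi by exact: measurable_normal_pdf.
have phi0 x : 0 <= phi x by exact: normal_pdf_ge0.
have phiM x u : phi x * phi (r * u - x) = phi u * phi (r * x - u).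
  rewrite !normal_pdfE ?oner_neq0// mulrACA [RHS]mulrACA; congr (_ * _).
  rewrite /normal_fun -!expRD; congr expR.
  rewrite !subr0 expr1n; have -> : (r * u - x) ^+ 2 = 2 * u ^+ 2 - 2 * r * u * x + x ^+ 2.
    by rewrite -[X in X * u ^+ 2]r2; ring.
  have -> : (r * x - u) ^+ 2 = 2 * x ^+ 2 - 2 * r * u * x + u ^+ 2.
    by rewrite -[X in X * x ^+ 2]r2; ring.
  by field.
have inner x : (\int[stdN]_y (f ((x + y) / r))%:E =
    \int[mu]_u (f u * phi (r * u - x) * r)%:E)%E.
  have cg : continuous (fun y => f ((x + y) / r)).
    move=> y; apply: (continuous_comp (f := fun y => (x + y) / r)); last exact: cf.
    by apply: cvgMl; apply: cvgD; [exact: cvg_cst|exact: cvg_id].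
  rewrite ge0_integral_stdN; last 2 first.
  - by apply/measurable_EFinP; exact: continuous_measurable_fun.
  - by move=> y; rewrite lee_fin.
  under eq_integral do rewrite -EFinM.
  have cG : continuous (fun y => f ((x + y) / r) * phi y).
    by move=> y; apply: cvgM; [exact: cg|exact: cphi].
  have G0 y : 0 <= f ((x + y) / r) * phi y by rewrite mulr_ge0.
  apply: etrans (ge0_integral_affine (x / r) r0 cG G0) _.
  apply: eq_integral => u _; congr EFin; congr (f _ * phi _ * _); by field.
under eq_integral do rewrite inner.
pose h (z : measurableTypeR R * measurableTypeR R) : \bar R :=
  (f z.2 * phi (r * z.2 - z.1) * r)%:E.
have mh : measurable_fun setT h.
  apply/measurable_EFinP; apply: measurable_funM => //; apply: measurable_funM.
    exact: (measurableT_comp mf).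
  apply: (measurableT_comp mphi); apply: measurable_funB => //.
  exact: measurable_funM.
have h0 z : (0 <= h z)%E by rewrite lee_fin !mulr_ge0// ltW.
have mphi1 : measurable_fun setT (fun z : measurableTypeR R * measurableTypeR R => (phi z.1)%:E).
  by apply/measurable_EFinP; exact: (measurableT_comp mphi).
rewrite [RHS]ge0_integral_stdN; last 2 first.
- exact/measurable_EFinP.
- by move=> x; rewrite lee_fin.
rewrite ge0_integral_stdN; last 2 first.
- exact: (measurable_fun_fubini_tonelli_F h).
- by move=> x; apply: integral_ge0 => u _; exact: (h0 (x, u)).
transitivity (\int[mu]_x \int[mu]_u (h (x, u) * (phi x)%:E))%E.
  apply: eq_integral => x _; rewrite -ge0_integralZr//.
  - exact: (measurableT_comp mh (pair1_measurable x)).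
  - by move=> u _; exact: (h0 (x, u)).
  - by rewrite lee_fin.
rewrite (fubini_tonelli (fun z => h z * (phi z.1)%:E)%E)/=; last 2 first.
- exact: emeasurable_funM.
- by move=> z; rewrite mule_ge0// lee_fin.
apply: eq_integral => u _; rewrite -EFinM.
transitivity ((f u * phi u)%:E * \int[mu]_x (phi ((x - u / r) * r) * r)%:E)%E.
  rewrite -ge0_integralZl//; last 3 first.
  - apply/measurable_EFinP; apply: measurable_funM => //; apply: (measurableT_comp mphi).
    by apply: measurable_funM => //; exact: measurable_funB.
  - by move=> x _; rewrite lee_fin mulr_ge0// ltW.
  - by rewrite lee_fin mulr_ge0.
  apply: eq_integral => x _; rewrite /h/= -!EFinM; congr EFin.
  rewrite (_ : (x - u / r) * r = r * x - u); last by field.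
  by ring: (phiM x u).
by rewrite -ge0_integral_affine// integral_normal_pdf mule1.
Qed.

End stability.

(** * Linear forms in standardized vectors *)

Definition standardized (R : realType) n (P : probability (n.-tuple R) R) :=
  [/\ mutually_independent P (@tproj R n),
      forall i, (\int[P]_y (tproj i y)%:E = 0)%E &
      forall i, (\int[P]_y (tproj i y ^+ 2)%:E = 1)%E].

Section moments.
Context {R : realType} {n : nat}.
Variable P : probability (n.-tuple R) R.
Hypothesis stP : standardized P.

Definition linform (u : 'I_n -> R) (y : n.-tuple R) := \sum_i u i * tproj i y.

Lemma measurable_linform u : measurable_fun setT (linform u).
Proof.
apply: measurable_sum => i; apply: measurable_funM => //; exact: measurable_tproj.
Qed.

Lemma integral_linform_sqrD c u :
  (\int[P]_y ((c + linform u y) ^+ 2)%:E = (c ^+ 2 + \sum_i u i ^+ 2)%:E)%E.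
Proof.
have [indP P1 P2] := stP.
apply: (@integral_sqr_sum_indep R n P (fun i x => u i * x)) => //.
- by move=> i; exact: measurable_funM.
- move=> i; under eq_integral do rewrite exprMn EFinM.
  rewrite ge0_integralZl ?P2 ?mule1// ?lee_fin ?sqr_ge0//.
    by apply/measurable_EFinP/measurable_funX; exact: measurable_tproj.
  by move=> y _; rewrite lee_fin sqr_ge0.
- move=> i; under eq_integral do rewrite EFinM.
  rewrite integralZl ?P1 ?mule0//.
  exact: (sqr_integrable_integrable (@measurable_tproj R n i) (P2 i)).2.
Qed.

Lemma integral_linform_sqr u :
  (\int[P]_y (linform u y ^+ 2)%:E = (\sum_i u i ^+ 2)%:E)%E.
Proof.
have := integral_linform_sqrD 0 u; rewrite expr0n/= add0r => <-.
by apply: eq_integral => y _; rewrite add0r.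
Qed.

Lemma linform_integrable u : P.-integrable setT (EFin \o linform u).
Proof.
exact: (sqr_integrable_integrable (measurable_linform u) (integral_linform_sqr u)).2.
Qed.

Lemma linform_sqr_integrable u :
  P.-integrable setT (EFin \o (fun y => linform u y ^+ 2)).
Proof.
exact: (sqr_integrable_integrable (measurable_linform u) (integral_linform_sqr u)).1.
Qed.

Lemma Rintegral_linform_sqr u : \int[P]_y (linform u y ^+ 2) = \sum_i u i ^+ 2.
Proof. by rewrite /Rintegral integral_linform_sqr. Qed.

(** Read off from the second moments of [1 + linform u y] and [linform u y] by expanding the square;
    [Rintegral_linformM] is obtained by polarization in the same way. *)
Lemma Rintegral_linform u : \int[P]_y (linform u y) = 0.
Proof.
have H : \int[P]_y ((1 + linform u y) ^+ 2) = 1 + \sum_i u i ^+ 2.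
  by rewrite /Rintegral integral_linform_sqrD expr1n.
have i1 : P.-integrable setT (EFin \o cst 1) by exact: finite_measure_integrable_cst.
have i2 : P.-integrable setT (EFin \o (fun y => 2 * linform u y)).
  rewrite (_ : _ \o _ = (fun y => 2%:E * (linform u y)%:E)%E)//.
  by apply: integrableZl => //; exact: linform_integrable.
have i12 : P.-integrable setT (EFin \o (fun y => 1 + 2 * linform u y)).
  rewrite (_ : _ \o _ = (EFin \o cst 1) \+ (EFin \o (fun y => 2 * linform u y)))//.
  exact: integrableD.
have : \int[P]_y (1 + 2 * linform u y + linform u y ^+ 2) = 1 + \sum_i u i ^+ 2.
  by rewrite -H; apply: eq_Rintegral => y _; ring.
rewrite RintegralD//; last exact: linform_sqr_integrable.
rewrite RintegralD// RintegralZl//; last exact: linform_integrable.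
rewrite (Rintegral_probability_cst P) Rintegral_linform_sqr; lra.
Qed.

Lemma linformD u v y :
  linform (fun i => u i + v i) y = linform u y + linform v y.
Proof. by rewrite -big_split; apply: eq_bigr => i _; rewrite mulrDl. Qed.

Lemma linformM_integrable u v :
  P.-integrable setT (EFin \o (fun y => linform u y * linform v y)).
Proof.
apply: (@le_integrable _ _ _ _ _ _ _ (fun y => (linform u y ^+ 2 + linform v y ^+ 2)%:E)) => //.
- by apply/measurable_EFinP/measurable_funM; exact: measurable_linform.
- move=> y _ /=; rewrite lee_fin [leRHS]ger0_norm ?addr_ge0 ?sqr_ge0// normrM.
  rewrite -(real_normK (num_real (linform u y))) -(real_normK (num_real (linform v y))).
  have := sqr_ge0 (`|linform u y| - `|linform v y|).
  have := sqr_ge0 (`|linform u y| + `|linform v y|).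
  by move: `|_| `|_| => a b; nra.
- rewrite (_ : (fun _ => _) = (EFin \o (fun y => linform u y ^+ 2)) \+
    (EFin \o (fun y => linform v y ^+ 2)))//.
  by apply: integrableD => //; exact: linform_sqr_integrable.
Qed.

Lemma Rintegral_linformM u v :
  \int[P]_y (linform u y * linform v y) = \sum_i u i * v i.
Proof.
have H := Rintegral_linform_sqr (fun i => u i + v i).
have i2 : P.-integrable setT (EFin \o (fun y => 2 * (linform u y * linform v y))).
  rewrite (_ : _ \o _ = (fun y => 2%:E * (linform u y * linform v y)%:E)%E)//.
  by apply: integrableZl => //; exact: linformM_integrable.
have i12 : P.-integrable setT (EFin \o (fun y => linform u y ^+ 2 + 2 * (linform u y * linform v y))).
  rewrite (_ : _ \o _ = (EFin \o (fun y => linform u y ^+ 2)) \+ (EFin \o (fun y => 2 * (linform u y * linform v y))))//.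
  by apply: integrableD => //; exact: linform_sqr_integrable.
have : \int[P]_y (linform u y ^+ 2 + 2 * (linform u y * linform v y) + linform v y ^+ 2)
   = \sum_i (u i + v i) ^+ 2.
  by rewrite -H; apply: eq_Rintegral => y _; rewrite linformD; ring.
rewrite RintegralD//; last exact: linform_sqr_integrable.
rewrite RintegralD//; last exact: linform_sqr_integrable.
rewrite RintegralZl//; last exact: linformM_integrable.
rewrite !Rintegral_linform_sqr.
have -> : \sum_i (u i + v i) ^+ 2 =
    \sum_i u i ^+ 2 + 2 * (\sum_i u i * v i) + \sum_i v i ^+ 2.
  by rewrite mulr_sumr -!big_split; apply: eq_bigr => i _ /=; ring.
lra.
Qed.

End moments.

(** * Stability of standard normal vectors *)

Section std_normal.
Context {R : realType}.

Lemma law_std_normal n (S : probability (n.-tuple R) R) i :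
  std_normal S -> law S (tproj i : n.-tuple R -> measurableTypeR R) (@stdN R).
Proof. by move=> [_ NS] B mB; rewrite NS. Qed.

Lemma integral_std_normal n (S : probability (n.-tuple R) R) i (g : R -> \bar R) :
  std_normal S -> measurable_fun setT g ->
  (\int[S]_y g (tproj i y) = \int[stdN]_x g x)%E.
Proof.
move=> NS mg; have mi : measurable_fun setT (tproj i : n.-tuple R -> measurableTypeR R).
  exact: measurable_tproj.
by rewrite (integral_law mi (law_std_normal i NS)).
Qed.

Lemma std_normal_standardized n (S : probability (n.-tuple R) R) :
  std_normal S -> standardized S.
Proof.
move=> NS; split; first exact: NS.1.
- move=> i; rewrite (@integral_std_normal _ S i EFin)//; exact: integral_stdN_id.
- move=> i; rewrite (@integral_std_normal _ S i (fun x => (x ^+ 2)%:E))//.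
    exact: integral_stdN_sqr.
  exact/measurable_EFinP/measurable_funX.
Qed.

Lemma std_normal_split n (S : probability (n.+1.-tuple R) R) :
  std_normal S -> exists S' : probability (n.-tuple R) R,
    std_normal S' /\ law (@stdN R \x S')%E (@tcons R n) S.
Proof.
move=> NS; have [P0 [S' [indS' PP]]] := indep_split NS.1.
have P0E B : measurable B -> P0 B = stdN B.
  move=> mB; rewrite (@law_fst _ _ _ _ _ P0 S' B mB).
  by rewrite [RHS](law_std_normal ord0 NS mB) PP//; exact: measurable_tproj_preimage.
exists S'; split.
  split=> // i B mB; rewrite (@law_snd _ _ _ _ _ P0 S' (tproj i @^-1` B))//; last exact: measurable_tproj_preimage.
  rewrite -(NS.2 (lift ord0 i) B mB) PP; last exact: measurable_tproj_preimage.
  by congr (_ _); apply/seteqP; split=> -[x y] /=; rewrite tproj_tconsS.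
move=> A mA; rewrite PP//.
rewrite [LHS]/product_measure1 [RHS]/product_measure1 /=.
by apply: eq_measure_integral => B mB _; exact: P0E.
Qed.

Definition tavg n (z : n.-tuple R * n.-tuple R) : n.-tuple R :=
  [tuple (tproj i z.1 + tproj i z.2) / Num.sqrt 2 | i < n].

Lemma tproj_tavg n z i :
  tproj i (@tavg n z) = (tproj i z.1 + tproj i z.2) / Num.sqrt 2.
Proof. by rewrite [LHS]tnth_mktuple. Qed.

Lemma measurable_tavg n : measurable_fun setT (@tavg n).
Proof.
apply/measurable_fun_tnthP => i.
rewrite (_ : _ \o _ = fun z => (tproj i z.1 + tproj i z.2) / Num.sqrt 2); last first.
  by apply/funext => z; rewrite -tproj_tavg.
apply: measurable_funM => //; apply: measurable_funD.
- by apply: measurableT_comp => //; exact: measurable_tproj.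
- by apply: measurableT_comp => //; exact: measurable_tproj.
Qed.

Lemma tavg_tcons n x x' y y' :
  tavg (@tcons R n (x, y), tcons (x', y')) =
  tcons ((x + x') / Num.sqrt 2 : R, tavg (y, y')).
Proof.
apply: eq_from_tnth => j; rewrite -!/(tproj _ _) tproj_tavg.
case: (unliftP ord0 j) => [i|] -> //.
by rewrite !tproj_tconsS tproj_tavg.
Qed.

(* Continuity along curves, so that no topology on tuples is needed. *)
Definition curve_continuous n (F : n.-tuple R -> R) :=
  forall c : R -> n.-tuple R, (forall i, continuous (fun t => tproj i (c t))) ->
  continuous (fun t => F (c t)).

Lemma Rintegral_stdN_stable (f : measurableTypeR R -> R) : bounded_mfun f ->
  continuous (f : R -> R) -> (forall x, 0 <= f x) ->
  \int[stdN]_x f x = \int[stdN]_x \int[stdN]_y f ((x + y) / Num.sqrt 2).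
Proof.
move=> bf cf f0; rewrite [LHS]/Rintegral -stdN_stable//.
rewrite /Rintegral; congr fine; apply: eq_integral => x _.
rewrite fineK//; apply: integrable_fin_num => //.
apply: (@bounded_mfun_integrable _ _ _ stdN (fun y => f ((x + y) / Num.sqrt 2))).
apply: (bounded_mfun_comp (f := f) (g := fun y : measurableTypeR R => (x + y) / Num.sqrt 2)) bf.
by apply: measurable_funM => //; exact: measurable_funD.
Qed.

(** Induction on the dimension: the integrals over two heads and two tails are regrouped by Fubini's
    theorem so that the heads form one pair and the tails another. Stability on the line handles the
    first pair, the induction hypothesis the second. *)
Lemma std_normal_stable n (S : probability (n.-tuple R) R) (F : n.-tuple R -> R) :
  std_normal S -> bounded_mfun F -> (forall y, 0 <= F y) -> curve_continuous F ->
  \int[S]_y F y = \int[S]_y \int[S]_z F (tavg (y, z)).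
Proof.
elim: n => [|n IH] in S F *.
  move=> NS bF F0 cF.
  have FE : F = fun=> F [tuple] by apply/funext => y; rewrite [y]tuple0.
  by rewrite FE !Rintegral_probability_cst.
move=> NS bF F0 cF; have [S' [NS' SS]] := std_normal_split NS.
have bFa : bounded_mfun (F \o @tavg n.+1).
  exact: bounded_mfun_comp (@measurable_tavg _) bF.
have mtc := @measurable_tcons R n.
pose N : probability (measurableTypeR R) R := stdN.
pose K (z : (measurableTypeR R * measurableTypeR R) * (n.-tuple R * n.-tuple R)) :=
  F (tcons ((z.1.1 + z.1.2) / Num.sqrt 2 : R, tavg z.2)).
have bK : bounded_mfun K.
  apply: bounded_mfun_comp bF; apply: (measurableT_comp mtc).
  apply: measurable_fun_pair => /=.
    apply: measurable_funM => //; apply: measurable_funD.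
      by apply: measurableT_comp => //; exact: measurable_fst.
    by apply: measurableT_comp => //; exact: measurable_snd.
  by apply: measurableT_comp; [exact: measurable_tavg|exact: measurable_snd].
have bH x : bounded_mfun (fun z : (n.-tuple R * measurableTypeR R) * n.-tuple R =>
    K ((x, z.1.2), (z.1.1, z.2))).
  apply: (bounded_mfun_comp (f := K) (g := fun z => ((x, z.1.2), (z.1.1, z.2)))) bK.
  apply: measurable_fun_pair => /=; apply: measurable_fun_pair => //=.
  - by apply: measurableT_comp; [exact: measurable_snd|exact: measurable_fst].
  - by apply: measurableT_comp; [exact: measurable_fst|exact: measurable_fst].
have bK1 x := bounded_mfun_Rintegral1 (S' \x N)%E S' (bH x).
have bSec x : bounded_mfun (fun z => F (@tcons R n (x, z))).
  by apply: bounded_mfun_comp bF; apply: (measurableT_comp mtc).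
have bSec2 z : bounded_mfun (fun x : measurableTypeR R => F (@tcons R n (x, z))).
  by apply: bounded_mfun_comp bF; apply: (measurableT_comp mtc).
transitivity (\int[N]_x \int[S']_y \int[N]_x' \int[S']_y' K ((x, x'), (y, y'))); last first.
  rewrite (Rintegral_tcons1 SS); last exact: (bounded_mfun_Rintegral1 S S bFa).
  apply: eq_Rintegral => x _; apply: eq_Rintegral => y _.
  rewrite (Rintegral_tcons1 SS); last exact: (bounded_mfun_section1 bFa).
  apply: eq_Rintegral => x' _; apply: eq_Rintegral => y' _.
  by rewrite tavg_tcons.
transitivity (\int[N]_x \int[N]_x' \int[S']_y \int[S']_y' K ((x, x'), (y, y'))); last first.
  apply: eq_Rintegral => x _.
  have := Rintegral_prod1 S' N (bK1 x); rewrite (Rintegral_prod2 S' N (bK1 x)).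
  exact.
transitivity (\int[(N \x N)%E]_p \int[(S' \x S')%E]_q K (p, q)); last first.
  rewrite (Rintegral_prod1 N N (bounded_mfun_Rintegral1 (N \x N)%E (S' \x S')%E bK)).
  apply: eq_Rintegral => x _; apply: eq_Rintegral => x' _.
  exact: (Rintegral_prod1 S' S' (bounded_mfun_section1 bK (x, x'))).
rewrite -(Rintegral_prod1 (N \x N)%E (S' \x S')%E bK).
rewrite (Rintegral_prod2 (N \x N)%E (S' \x S')%E bK).
pose G (z : measurableTypeR R * (n.-tuple R * n.-tuple R)) := F (@tcons R n (z.1, tavg z.2)).
have bG : bounded_mfun G.
  apply: bounded_mfun_comp bF; apply: (measurableT_comp mtc).
  apply: measurable_fun_pair => //=.
  by apply: measurableT_comp; [exact: measurable_tavg|exact: measurable_snd].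
rewrite (Rintegral_tcons1 SS bF).
transitivity (\int[N]_x \int[(S' \x S')%E]_q G (x, q)).
  apply: eq_Rintegral => x _.
  rewrite (Rintegral_prod1 S' S' (bounded_mfun_section1 bG x)).
  apply: IH => //.
  move=> c cc; apply: cF => i; case: (unliftP ord0 i) => [j|] ->.
    by under eq_fun do rewrite tproj_tconsS; exact: cc.
  by move=> t; exact: cvg_cst.
rewrite -(Rintegral_prod1 N (S' \x S')%E bG) (Rintegral_prod2 N (S' \x S')%E bG).
apply: eq_Rintegral => q _.
rewrite (Rintegral_prod1 N N (bounded_mfun_section2 bK q)).
apply: (Rintegral_stdN_stable (bounded_mfun_section2 bG q)) => [|x]; last exact: F0.
apply: cF => i; case: (unliftP ord0 i) => [j|] ->.
  by under eq_fun do rewrite tproj_tconsS; move=> t; exact: cvg_cst.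
by move=> t; exact: cvg_id.
Qed.

End std_normal.

(** * A centered Gaussian law is determined by its covariance *)

Section test_functions.
Context {R : realType} {k : nat}.
Implicit Types (f : 'cV[R]_k -> R) (w h z : 'cV[R]_k).

(** Only the existence of an expansion is required: the coefficients need not be identified with
    derivatives. *)
Definition taylor3 (L : R) f := forall w, exists (l : 'I_k -> R)
    (H : 'I_k -> 'I_k -> R), forall h,
  `|f (w + h) - (f w + \sum_i l i * h i ord0 +
     \sum_i \sum_j H i j * (h i ord0 * h j ord0))| <= L * (\sum_i `|h i ord0|) ^+ 3.

Definition lipschitz_cV f := exists K, forall w h,
  `|f (w + h) - f w| <= K * \sum_i `|h i ord0|.

(** The Lipschitz bound provides the continuity along curves that stability asks for; the whole
    class is preserved by freezing one argument of the average, see [test_fun_avg]. *)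
Definition test_fun f := [/\ measurable_fun setT (f \o @tcol R k),
  forall w, 0 <= f w, exists c, forall w, f w <= c & lipschitz_cV f].

Lemma coltupK (w : 'cV[R]_k) : tcol (coltup w) = w.
Proof. by apply/colP => i; rewrite mxE tnth_mktuple. Qed.

Lemma test_fun_comp f d (T : measurableType d) (W : T -> 'cV[R]_k) :
  test_fun f -> (forall i, measurable_fun setT (fun x => W x i ord0)) ->
  bounded_mfun (fun x => f (W x)).
Proof.
move=> [mf f0 [c fc] _] mW; split.
  rewrite (_ : (fun x => _) = (f \o @tcol R k) \o (fun x => coltup (W x))); last first.
    by apply/funext => x /=; rewrite coltupK.
  apply: measurableT_comp => //; apply/measurable_fun_tnthP => i.
  by rewrite (_ : _ \o _ = fun x => W x i ord0)//; apply/funext => x /=; rewrite tnth_mktuple.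
by exists c => x; rewrite ger0_norm.
Qed.

Lemma mulmx_linform n (A : 'M[R]_(k, n)) (y : n.-tuple R) i :
  (A *m tcol y) i ord0 = linform (A i) y.
Proof. by rewrite mxE; apply: eq_bigr => j _; rewrite mxE. Qed.

Lemma test_fun_curve_continuous f n (A : 'M[R]_(k, n)) :
  test_fun f -> curve_continuous (fun y => f (A *m tcol y)).
Proof.
move=> [_ _ _ [K fK]] c cc t.
have cW i : continuous (fun s => (A *m tcol (c s)) i ord0).
  under eq_fun do rewrite mulmx_linform.
  move=> s; apply: cvg_big => [|j _]; first exact: add_continuous.
  by apply: cvgMr; exact: cc.
have cS : (fun s => K * \sum_i `|(A *m tcol (c s) - A *m tcol (c t)) i ord0|) @ t --> 0.
  rewrite -[X in _ --> X](_ : K * \sum_(i < k) `|(A *m tcol (c t)) i ord0 - (A *m tcol (c t)) i ord0| = 0); last first.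
    by rewrite big1 ?mulr0// => i _; rewrite subrr normr0.
  apply: cvgMr; apply: cvg_big => [|i _]; first exact: add_continuous.
  under eq_fun do rewrite mxE [X in _ + X]mxE.
  by apply: cvg_norm; apply: cvgB; [exact: cW|exact: cvg_cst].
apply/cvgrPdistC_lt => e e0; near=> s.
rewrite -[A *m tcol (c s)](subrKC (A *m tcol (c t))).
apply: le_lt_trans (fK _ _) _.
apply: le_lt_trans (ler_norm _) _.
by near: s; move/cvgr0_norm_lt : cS; apply.
Unshelve. all: by end_near. Qed.

Lemma taylor3_avg f L (r : R) z : 0 < r -> taylor3 L f ->
  taylor3 (L * r ^+ 3) (fun w => f (r *: (w + z))).
Proof.
move=> r0 Lf w; have [l [H lH]] := Lf (r *: (w + z)).
exists (fun i => r * l i), (fun i j => r ^+ 2 * H i j) => h.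
rewrite addrAC scalerDr; have := lH (r *: h).
rewrite (_ : \sum_i `|(r *: h) i ord0| = r * \sum_i `|h i ord0|); last first.
  rewrite mulr_sumr; apply: eq_bigr => i _.
  by rewrite mxE normrM gtr0_norm.
rewrite (_ : \sum_i l i * (r *: h) i ord0 = \sum_i r * l i * h i ord0); last first.
  by apply: eq_bigr => i _; rewrite mxE; ring.
rewrite (_ : \sum_i \sum_j H i j * ((r *: h) i ord0 * (r *: h) j ord0) =
  \sum_i \sum_j r ^+ 2 * H i j * (h i ord0 * h j ord0)); last first.
  by apply: eq_bigr => i _; apply: eq_bigr => j _; rewrite !mxE; ring.
by rewrite -mulrA -exprMn.
Qed.

Lemma test_fun_avg f (r : R) z : 0 < r -> test_fun f ->
  test_fun (fun w => f (r *: (w + z))).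
Proof.
move=> r0 tf; have [mf f0 [c fc] [K fK]] := tf; split.
- suff [] : bounded_mfun (fun y : k.-tuple R => f (r *: (tcol y + z))) by [].
  apply: (@test_fun_comp f _ _ (fun y : k.-tuple R => r *: (tcol y + z)) tf) => i.
  rewrite (_ : (fun _ => _) = fun y => r * (tproj i y + z i ord0)); last first.
    by apply/funext => y; rewrite !mxE.
  by apply: measurable_funM => //; apply: measurable_funD => //; exact: measurable_tproj.
- by move=> w.
- by exists c.
- exists (K * r) => w h; rewrite addrAC scalerDr (le_trans (fK _ _))//.
  rewrite -mulrA [X in _ <= _ * X]mulr_sumr le_eqVlt; apply/orP; left; apply/eqP.
  by congr (_ * _); apply: eq_bigr => i _; rewrite mxE normrM gtr0_norm.
Qed.

End test_functions.

Lemma norm_RintegralB_le d (T : measurableType d) (R : realType)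
    (P : probability T R) (f g : T -> R) c :
  bounded_mfun f -> bounded_mfun g -> (forall x, `|f x - g x| <= c) ->
  `|\int[P]_x f x - \int[P]_x g x| <= c.
Proof.
move=> bf bg fgc; rewrite -RintegralB//.
- apply: norm_Rintegral_cst => //; exact/bounded_mfun_integrable/bounded_mfunB.
- exact: bounded_mfun_integrable.
- exact: bounded_mfun_integrable.
Qed.

Section gauss_eq.
Context {R : realType} {k : nat}.
Implicit Types (f : 'cV[R]_k -> R).

Lemma abs3_sum_integrable d (T : measurableType d) (P : probability T R)
    (I : Type) (r : seq I) (X : I -> T -> R) :
  (forall i, measurable_fun setT (X i)) ->
  (forall i, P.-integrable setT (EFin \o (fun x => `|X i x| ^+ 3))) ->
  P.-integrable setT (EFin \o (fun x => `|\sum_(i <- r) X i x| ^+ 3)).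
Proof.
move=> mX iX; elim: r => [|i r IH].
  under [X in EFin \o X]eq_fun do rewrite big_nil normr0 expr0n/=.
  exact: finite_measure_integrable_cst.
apply: (@le_integrable _ _ _ _ _ _ _ (fun x => (8 * `|X i x| ^+ 3 + 8 * `|\sum_(i <- r) X i x| ^+ 3)%:E)) => //.
- apply/measurable_EFinP/measurable_funX; apply: measurableT_comp => //.
  exact: measurable_sum.
- move=> x _; rewrite /= lee_fin big_cons.
  move: (X i x) (\sum_(_ <- _) _) => a b.
  rewrite [leRHS]ger0_norm ?addr_ge0 ?mulr_ge0 ?exprn_ge0// ger0_norm ?exprn_ge0//.
  apply: (@le_trans _ _ ((`|a| + `|b|) ^+ 3)).
    by rewrite lerXn2r ?nnegrE ?addr_ge0//; exact: ler_normD.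
  move: `|a| `|b| (normr_ge0 a) (normr_ge0 b) => {}a {}b a0 b0.
  wlog ab : a b a0 b0 / a <= b.
    move=> H; have [ab|ba] := leP a b; first exact: H.
    by rewrite [X in X ^+ 3]addrC [leRHS]addrC; apply: H => //; exact: ltW.
  apply: (@le_trans _ _ ((b + b) ^+ 3)).
    by rewrite lerXn2r ?nnegrE ?addr_ge0// lerD2r.
  have -> : (b + b) ^+ 3 = 8 * b ^+ 3 by ring.
  by rewrite lerDr mulr_ge0// exprn_ge0.
- rewrite (_ : (fun _ => _) = (fun x => 8%:E * (`|X i x| ^+ 3)%:E)%E \+
    (fun x => 8%:E * (`|\sum_(i <- r) X i x| ^+ 3)%:E)%E)//.
  apply: integrableD => //.
    by apply: integrableZl => //; exact: iX.
  by apply: integrableZl => //; exact: IH.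
Qed.

Lemma linform_abs3_integrable n (S : probability (n.-tuple R) R) u :
  std_normal S -> S.-integrable setT (EFin \o (fun y => `|linform u y| ^+ 3)).
Proof.
move=> NS; apply: abs3_sum_integrable => i.
  by apply: measurable_funM => //; exact: measurable_tproj.
have [c hc] := @stdN_abs3_lty R.
have mabs3 : measurable_fun [set: R] (fun x : R => `|x| ^+ 3).
  by apply: measurable_funX; exact: normr_measurable.
have mt3 : measurable_fun setT (fun y : n.-tuple R => `|(tproj i y : R)| ^+ 3).
  by apply: (measurableT_comp mabs3); exact: measurable_tproj.
have [] := @ge0_Rintegral_le _ _ _ S (fun y => `|(tproj i y : R)| ^+ 3) c mt3.
- by move=> y; rewrite exprn_ge0.
- rewrite (@integral_std_normal _ _ S i (fun x => (`|x| ^+ 3)%:E))//.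
  exact/measurable_EFinP.
move=> it _.
rewrite (_ : _ \o _ = (fun y => (`|u i| ^+ 3)%:E * (`|(tproj i y : R)| ^+ 3)%:E)%E).
  exact: integrableZl.
by apply/funext => y /=; rewrite -EFinM normrM exprMn.
Qed.

Definition gauss_abs3 n (S : probability (n.-tuple R) R) (A : 'M[R]_(k, n)) :=
  \int[S]_y ((\sum_i `|linform (A i) y|) ^+ 3).

Lemma sum_abs3_integrable n (S : probability (n.-tuple R) R) (A : 'M[R]_(k, n)) :
  std_normal S ->
  S.-integrable setT (EFin \o (fun y => (\sum_i `|linform (A i) y|) ^+ 3)).
Proof.
move=> NS; have := @abs3_sum_integrable _ _ S _ (index_enum 'I_k)
  (fun i y => `|linform (A i) y|).
rewrite (_ : (fun y => `|\sum_i _| ^+ 3) = (fun y => (\sum_i `|linform (A i) y|) ^+ 3)); last first.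
  by apply/funext => y; rewrite ger0_norm ?sumr_ge0.
apply => i; first by apply: measurableT_comp => //; exact: measurable_linform.
under [X in EFin \o X]eq_fun do rewrite normr_id.
exact: linform_abs3_integrable.
Qed.

Lemma Rintegral_sum d (T : measurableType d) (P : probability T R) (I : Type)
    (r : seq I) (h : I -> T -> R) :
  (forall i, P.-integrable setT (EFin \o h i)) ->
  P.-integrable setT (EFin \o (fun x => \sum_(i <- r) h i x)) /\
  \int[P]_x (\sum_(i <- r) h i x) = \sum_(i <- r) \int[P]_x h i x.
Proof.
move=> ih; have H : P.-integrable setT (EFin \o (fun x => \sum_(i <- r) h i x)).
  rewrite (_ : _ \o _ = fun x => (\sum_(i <- r) (h i x)%:E)%E).
    by apply: integrable_sum => // i _; exact: ih.
  by apply/funext => x /=; rewrite sumEFin.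
split=> //; elim: r H => [|i r IH] H.
  by rewrite big_nil; under eq_Rintegral do rewrite big_nil; rewrite Rintegral_probability_cst.
have H' : P.-integrable setT (EFin \o (fun x => \sum_(i <- r) h i x)).
  rewrite (_ : _ \o _ = fun x => (\sum_(i <- r) (h i x)%:E)%E).
    by apply: integrable_sum => // j _; exact: ih.
  by apply/funext => x /=; rewrite sumEFin.
under eq_Rintegral do rewrite big_cons.
by rewrite RintegralD// IH// big_cons.
Qed.

(** The linear part has mean 0 and the quadratic part sees only [A *m A^T]. Two Gaussian vectors
    with the same covariance thus share the main term and differ at most by third absolute
    moments. *)
Lemma gauss_near_quadratic n (S : probability (n.-tuple R) R) (A : 'M[R]_(k, n))
    f L l (H : 'I_k -> 'I_k -> R) :
  std_normal S -> test_fun f ->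
  (forall h, `|f h - (f 0 + \sum_i l i * h i ord0 +
     \sum_i \sum_j H i j * (h i ord0 * h j ord0))| <= L * (\sum_i `|h i ord0|) ^+ 3) ->
  `|\int[S]_y f (A *m tcol y) - (f 0 + \sum_i \sum_j H i j * (A *m A^T) i j)|
    <= L * gauss_abs3 S A.
Proof.
move=> NS tf fT; have stS := std_normal_standardized NS.
pose X i (y : n.-tuple R) := linform (A i) y.
have WE y i : (A *m tcol y) i ord0 = X i y by rewrite mulmx_linform.
have bf : bounded_mfun (fun y : n.-tuple R => f (A *m tcol y)).
  apply: (@test_fun_comp _ _ f _ _ (fun y : n.-tuple R => A *m tcol y) tf) => i.
  by under eq_fun do rewrite WE; exact: measurable_linform.
have il i : S.-integrable setT (EFin \o (fun y => l i * X i y)).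
  rewrite (_ : _ \o _ = (fun y => (l i)%:E * (X i y)%:E)%E)//.
  by apply: integrableZl => //; exact: linform_integrable.
have iH i j : S.-integrable setT (EFin \o (fun y => H i j * (X i y * X j y))).
  rewrite (_ : _ \o _ = (fun y => (H i j)%:E * (X i y * X j y)%:E)%E)//.
  by apply: integrableZl => //; exact: linformM_integrable.
have [isl slE] := Rintegral_sum (index_enum 'I_k) il.
have iH1 i := Rintegral_sum (index_enum 'I_k) (iH i).
have [isH sHE] := Rintegral_sum (index_enum 'I_k) (fun i => (iH1 i).1).
have ic : S.-integrable setT (EFin \o cst (f 0)) by exact: finite_measure_integrable_cst.
have icl : S.-integrable setT (EFin \o (fun y => f 0 + \sum_i l i * X i y)).
  rewrite (_ : _ \o _ = (EFin \o cst (f 0)) \+ (EFin \o (fun y => \sum_i l i * X i y)))//.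
  exact: integrableD.
pose q y := f 0 + \sum_i l i * X i y + \sum_i \sum_j H i j * (X i y * X j y).
have iq : S.-integrable setT (EFin \o q).
  rewrite (_ : _ \o _ = (EFin \o (fun y => f 0 + \sum_i l i * X i y)) \+
     (EFin \o (fun y => \sum_i \sum_j H i j * (X i y * X j y))))//.
  exact: integrableD.
have qE : \int[S]_y q y = f 0 + \sum_i \sum_j H i j * (A *m A^T) i j.
  rewrite /q RintegralD// RintegralD// (Rintegral_probability_cst S) slE sHE big1 ?addr0.
    congr (_ + _); apply: eq_bigr => i _; rewrite (iH1 i).2; apply: eq_bigr => j _.
    rewrite RintegralZl//; last exact: linformM_integrable.
    rewrite Rintegral_linformM// !mxE; congr (_ * _).
    by apply: eq_bigr => m _; rewrite mxE.
  by move=> i _; rewrite RintegralZl ?Rintegral_linform ?mulr0//; exact: linform_integrable.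
rewrite -qE -RintegralB//; last exact: bounded_mfun_integrable.
have iA := sum_abs3_integrable A NS.
rewrite /gauss_abs3 -RintegralZl//.
apply: norm_Rintegral_le.
- exact: (integrableB _ (bounded_mfun_integrable S bf) iq).
- rewrite (_ : _ \o _ = (fun y => L%:E * ((\sum_i `|linform (A i) y|) ^+ 3)%:E)%E)//.
  exact: integrableZl.
move=> y; have := fT (A *m tcol y).
have -> : \sum_i l i * (A *m tcol y) i ord0 = \sum_i l i * X i y.
  by apply: eq_bigr => i _; rewrite WE.
have -> : \sum_i \sum_j H i j * ((A *m tcol y) i ord0 * (A *m tcol y) j ord0) =
    \sum_i \sum_j H i j * (X i y * X j y).
  by apply: eq_bigr => i _; apply: eq_bigr => j _; rewrite !WE.
have -> : \sum_i `|(A *m tcol y) i ord0| = \sum_i `|X i y|.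
  by apply: eq_bigr => i _; rewrite WE.
by [].
Qed.

(* Both Gaussian vectors are stable under [(y, z) |-> (y + z) / Num.sqrt 2].
   Freezing one of the two arguments rescales [f] by [r = (Num.sqrt 2)^-1] and
   hence [L] by [r ^+ 3]; two such replacements give the factor
   [2 * r ^+ 3 = r] at each step. *)
Lemma gauss_contraction n n' (S : probability (n.-tuple R) R)
    (S' : probability (n'.-tuple R) R) (A : 'M[R]_(k, n)) (A' : 'M[R]_(k, n')) N f L :
  A *m A^T = A' *m A'^T -> std_normal S -> std_normal S' ->
  test_fun f -> taylor3 L f ->
  `|\int[S]_y f (A *m tcol y) - \int[S']_y f (A' *m tcol y)| <=
  L * (gauss_abs3 S A + gauss_abs3 S' A') * (Num.sqrt 2)^-1 ^+ N.
Proof.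
move=> AA NS NS'; elim: N f L => [|N IH] f L tf Lf.
  have [l [H lH]] := Lf 0.
  have lH0 h : `|f h - (f 0 + \sum_i l i * h i ord0 +
     \sum_i \sum_j H i j * (h i ord0 * h j ord0))| <= L * (\sum_i `|h i ord0|) ^+ 3.
    by rewrite -[h in f h]add0r; exact: lH.
  rewrite expr0 mulr1 mulrDr.
  have e1 := gauss_near_quadratic A NS tf lH0.
  have e2 := gauss_near_quadratic A' NS' tf lH0.
  rewrite -AA distrC in e2.
  exact: le_trans (ler_distD _ _ _) (lerD e1 e2).
pose r : R := (Num.sqrt 2)^-1.
have r0 : 0 < r by rewrite invr_gt0 sqrtr_gt0.
have r2 : r ^+ 2 = 2^-1 by rewrite exprVn sqr_sqrtr.
have avgE m (B : 'M[R]_(k, m)) y z : B *m tcol (tavg (y, z)) = r *: (B *m tcol y + B *m tcol z).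
  rewrite -mulmxDr scalemxAr; congr (_ *m _); apply/colP => i.
  by rewrite !mxE -!/(tproj _ _) tproj_tavg mulrC.
have stab m (T : probability (m.-tuple R) R) (B : 'M[R]_(k, m)) : std_normal T ->
    \int[T]_y f (B *m tcol y) =
    \int[T]_y \int[T]_z f (r *: (B *m tcol y + B *m tcol z)).
  move=> NT; rewrite (std_normal_stable NT).
  - by apply: eq_Rintegral => y _; apply: eq_Rintegral => z _; rewrite avgE.
  - apply: (@test_fun_comp _ _ f _ _ (fun y : m.-tuple R => B *m tcol y) tf) => i.
    by under eq_fun do rewrite mulmx_linform; exact: measurable_linform.
  - by case: tf.
  - exact: test_fun_curve_continuous.
rewrite (stab _ _ _ NS) (stab _ _ _ NS').
have bf m m' (B : 'M[R]_(k, m)) (B' : 'M[R]_(k, m')) :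
    bounded_mfun (fun z => f (r *: (B *m tcol z.1 + B' *m tcol z.2))).
  apply: (@test_fun_comp _ _ f _ _ (fun z : m.-tuple R * m'.-tuple R => r *: (B *m tcol z.1 + B' *m tcol z.2)) tf) => i.
  rewrite (_ : (fun _ => _) = fun z => r * (linform (B i) z.1 + linform (B' i) z.2)).
    apply: measurable_funM => //; apply: measurable_funD.
      by apply: measurableT_comp => //; exact: measurable_linform.
    by apply: measurableT_comp => //; exact: measurable_linform.
  by apply/funext => z; rewrite -!mulmx_linform !mxE.
pose mid := \int[S']_y \int[S]_z f (r *: (A' *m tcol y + A *m tcol z)).
have midE : mid = \int[S]_z \int[S']_y f (r *: (A' *m tcol y + A *m tcol z)).
  exact: etrans (esym (Rintegral_prod1 S' S (bf _ _ A' A)))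
    (Rintegral_prod2 S' S (bf _ _ A' A)).
have SSE : \int[S]_y \int[S]_z f (r *: (A *m tcol y + A *m tcol z)) =
    \int[S]_z \int[S]_y f (r *: (A *m tcol y + A *m tcol z)).
  exact: etrans (esym (Rintegral_prod1 S S (bf _ _ A A)))
    (Rintegral_prod2 S S (bf _ _ A A)).
have IHz z : `|\int[S]_y f (r *: (A *m tcol y + z)) - \int[S']_y f (r *: (A' *m tcol y + z))|
    <= L * r ^+ 3 * (gauss_abs3 S A + gauss_abs3 S' A') * r ^+ N.
  exact: (IH (fun w => f (r *: (w + z))) (L * r ^+ 3) (test_fun_avg z r0 tf) (taylor3_avg z r0 Lf)).
apply: le_trans (ler_distD mid _ _) _.
set D := gauss_abs3 S A + _ in IHz *.
have -> : L * D * r ^+ N.+1 = L * r ^+ 3 * D * r ^+ N + L * r ^+ 3 * D * r ^+ N.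
  have -> : r ^+ 3 = r / 2 by rewrite exprS r2.
  by rewrite exprS; field.
apply: lerD.
- rewrite SSE midE.
  apply: norm_RintegralB_le.
  + exact: (bounded_mfun_Rintegral2 S S (bf _ _ A A)).
  + exact: (bounded_mfun_Rintegral2 S' S (bf _ _ A' A)).
  + by move=> z; exact: (IHz (A *m tcol z)).
- apply: norm_RintegralB_le.
  + exact: (bounded_mfun_Rintegral1 S' S (bf _ _ A' A)).
  + exact: (bounded_mfun_Rintegral1 S' S' (bf _ _ A' A')).
  move=> z; have := IHz (A' *m tcol z).
  by under eq_Rintegral do rewrite addrC; under [X in _ - X]eq_Rintegral do rewrite addrC.
Qed.

(** The bound of [gauss_contraction] holds for every [N], and its geometric factor tends to 0. The
    two factorizations may even have different inner dimensions. *)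
Lemma Rintegral_gauss_eq n n' (S : probability (n.-tuple R) R)
    (S' : probability (n'.-tuple R) R) (A : 'M[R]_(k, n)) (A' : 'M[R]_(k, n')) f L :
  A *m A^T = A' *m A'^T -> std_normal S -> std_normal S' ->
  test_fun f -> taylor3 L f ->
  \int[S]_y f (A *m tcol y) = \int[S']_y f (A' *m tcol y).
Proof.
move=> AA NS NS' tf Lf; apply/eqP; rewrite -subr_eq0 -normr_le0.
have H N := gauss_contraction N AA NS NS' tf Lf.
have cv : (L * (gauss_abs3 S A + gauss_abs3 S' A') * (Num.sqrt 2)^-1 ^+ N) @[N --> \oo] --> (0 : R).
  rewrite -[X in _ --> X](mulr0 (L * (gauss_abs3 S A + gauss_abs3 S' A'))).
  apply: cvgMr; apply: cvg_expr; rewrite ger0_norm ?invr_ge0// invf_lt1 ?sqrtr_gt0//.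
  by rewrite -[ltLHS]sqrtr1 ltr_sqrt// ltr1n.
rewrite -[leRHS](cvg_lim _ cv)//; apply: limr_ge; first by apply/cvg_ex; exists 0.
by near=> N; exact: H.
Unshelve. all: by end_near. Qed.

End gauss_eq.

(** * Smooth approximation of boxes *)

Section spline.
Context {R : realType}.
Implicit Types (x t : R).

Definition pos x : R := Num.max x 0.

Lemma posP x : 0 <= x /\ pos x = x \/ x <= 0 /\ pos x = 0.
Proof.
rewrite /pos; have [x0|x0] := leP x 0; first by right; split.
by left; split=> //; exact: ltW.
Qed.

(** The second derivative of the truncated cube, [6 * pos x], is Lipschitz with constant 6, whence a
    Taylor remainder with coefficient 1. *)
Lemma pos_cube_taylor x t :
  `|pos (x + t) ^+ 3 - (pos x ^+ 3 + 3 * pos x ^+ 2 * t + 3 * pos x * t ^+ 2)| <=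
  `|t| ^+ 3.
Proof.
have [[x0 ->]|[x0 ->]] := posP x; have [[xt ->]|[xt ->]] := posP (x + t).
- rewrite (_ : _ - _ = t ^+ 3); last by ring.
  by rewrite normrX.
- have t0 : t <= 0 by lra.
  have [s [s0 tE]] : exists s, 0 <= s /\ t = - (x + s).
    by exists (- (x + t)); split; [lra|ring].
  rewrite (ler0_norm t0) tE opprK.
  rewrite (_ : _ - _ = s ^+ 3 - (x + s) ^+ 3); last by ring.
  have s3 : 0 <= s ^+ 3 by rewrite exprn_ge0.
  have : s ^+ 3 <= (x + s) ^+ 3 by rewrite lerXn2r ?nnegrE//; lra.
  by rewrite ler_norml => h; apply/andP; split; lra.
- have t0 : 0 <= t by lra.
  rewrite (ger0_norm t0) !expr0n/= !mulr0 !mul0r !addr0 subr0 ger0_norm ?exprn_ge0//.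
  by rewrite lerXn2r ?nnegrE//; lra.
- by rewrite !expr0n/= !mulr0 !mul0r !addr0 subr0 normr0 exprn_ge0.
Qed.

(* The distribution function of the sum of three independent uniform variables
   on [0, 1]; [spline1] is its derivative and [spline2] half of its second
   derivative. *)
Definition spline x : R :=
  (pos x ^+ 3 - 3 * pos (x - 1) ^+ 3 + 3 * pos (x - 2) ^+ 3 - pos (x - 3) ^+ 3) / 6.

Definition spline1 x : R :=
  (pos x ^+ 2 - 3 * pos (x - 1) ^+ 2 + 3 * pos (x - 2) ^+ 2 - pos (x - 3) ^+ 2) / 2.

Definition spline2 x : R :=
  (pos x - 3 * pos (x - 1) + 3 * pos (x - 2) - pos (x - 3)) / 2.

Lemma spline_le0 x : x <= 0 -> spline x = 0.
Proof.
move=> x0; rewrite /spline /pos !max_r ?subr_le0//; [|lra..].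
by rewrite !expr0n/= mulr0 subr0 addr0 subr0 mul0r.
Qed.

Lemma spline_ge3 x : 3 <= x -> spline x = 1.
Proof.
move=> x3; rewrite /spline /pos !max_l; [|lra..].
by field.
Qed.

Lemma spline_bounds x :
  [/\ 0 <= spline x, spline x <= 1, `|spline1 x| <= 1 & `|spline2 x| <= 1].
Proof.
rewrite /spline /spline1 /spline2 !ler_norml.
have [[x0 ->]|[x0 ->]] := posP x; have [[x1 ->]|[x1 ->]] := posP (x - 1);
have [[x2 ->]|[x2 ->]] := posP (x - 2); have [[x3 ->]|[x3 ->]] := posP (x - 3);
  try (exfalso; lra); rewrite ?expr0n/= ?mulr0 ?subr0 ?addr0 ?sub0r ?subr0.
- by split; [| |apply/andP; split|apply/andP; split]; lra.
- have v3 : 0 <= (3 - x) ^+ 3 by rewrite exprn_ge0//; lra.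
  have v31 : (3 - x) ^+ 3 <= 1 by rewrite exprn_ile1//; lra.
  have v2 : 0 <= (3 - x) ^+ 2 by rewrite exprn_ge0//; lra.
  have v21 : (3 - x) ^+ 2 <= 1 by rewrite exprn_ile1//; lra.
  by split; [| |apply/andP; split|apply/andP; split]; lra.
- have u0 : 0 <= x - 1 by lra.
  have u1 : x - 1 <= 1 by lra.
  have u2 : (x - 1) * (x - 1) <= x - 1 by rewrite ler_piMl.
  have u3 : (x - 1) ^+ 3 <= (x - 1) ^+ 2 by rewrite exprS ler_piMl ?sqr_ge0.
  have u4 : 0 <= (x - 1) ^+ 3 by rewrite exprn_ge0.
  have v3 : (2 - x) ^+ 3 <= (2 - x) ^+ 2.
    by rewrite exprS ler_piMl ?sqr_ge0//; lra.
  have v2 := sqr_ge0 (2 - x); have w2 := sqr_ge0 (x - 3 / 2).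
  have v0 : 0 <= (2 - x) ^+ 3 by rewrite exprn_ge0//; lra.
  by split; [| |apply/andP; split|apply/andP; split]; lra.
- have v3 : 0 <= x ^+ 3 by rewrite exprn_ge0//; lra.
  have v31 : x ^+ 3 <= 1 by rewrite exprn_ile1//; lra.
  have v2 : 0 <= x ^+ 2 by rewrite exprn_ge0//; lra.
  have v21 : x ^+ 2 <= 1 by rewrite exprn_ile1//; lra.
  by split; [| |apply/andP; split|apply/andP; split]; lra.
- by split; [| |apply/andP; split|apply/andP; split]; lra.
Qed.

(** The four truncated cubes have weights 1, 3, 3, 1 over 6, which gives 4/3, rounded up to 2. *)
Lemma spline_taylor x t :
  `|spline (x + t) - (spline x + spline1 x * t + spline2 x * t ^+ 2)| <= 2 * `|t| ^+ 3.
Proof.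
have H a : `|pos (x + t - a) ^+ 3 - (pos (x - a) ^+ 3 + 3 * pos (x - a) ^+ 2 * t +
    3 * pos (x - a) * t ^+ 2)| <= `|t| ^+ 3 by rewrite addrAC; exact: pos_cube_taylor.
have := pos_cube_taylor x t; have := H 1; have := H 2; have := H 3.
rewrite /spline /spline1 /spline2 !ler_norml.
move=> /andP[? ?] /andP[? ?] /andP[? ?] /andP[? ?]; apply/andP; split; lra.
Qed.

(** For [|t| <= 1] the lower orders follow from the third-order expansion and the bounds on its
    coefficients; for larger [t] they follow from the fact that [spline] takes its values in [0, 1].
    One constant then serves all orders. *)
Lemma spline_expansion x t :
  [/\ `|spline (x + t) - spline x| <= 4 * `|t|,
      `|spline (x + t) - spline x - spline1 x * t| <= 4 * `|t| ^+ 2 &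
      `|spline (x + t) - spline x - spline1 x * t - spline2 x * t ^+ 2| <= 4 * `|t| ^+ 3].
Proof.
have [s0 s1 d1 d2] := spline_bounds x; have [s0' s1' _ _] := spline_bounds (x + t).
have := spline_taylor x t.
rewrite (_ : _ - _ = spline (x + t) - spline x - spline1 x * t - spline2 x * t ^+ 2); last by ring.
set D := spline (x + t) - spline x; set A := spline1 x * t; set B := spline2 x * t ^+ 2.
move=> T; have D1 : `|D| <= 1 by rewrite ler_norml /D; apply/andP; split; lra.
have hA : `|A| <= `|t| by rewrite normrM ler_piMl.
have hB : `|B| <= `|t| ^+ 2 by rewrite normrM normrX ler_piMl// exprn_ge0.
have T1 : `|D - A| <= 2 * `|t| ^+ 3 + `|t| ^+ 2.
  rewrite -[D - A](subrK B); apply: le_trans (ler_normD _ _) _; exact: lerD.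
have T0 : `|D| <= 2 * `|t| ^+ 3 + `|t| ^+ 2 + `|t|.
  rewrite -[D](subrK A); apply: le_trans (ler_normD _ _) _; exact: lerD.
have T1' : `|D - A| <= 1 + `|t| by apply: le_trans (ler_normB _ _) _; exact: lerD.
move: T T0 T1 T1'; move: `|t| (normr_ge0 t) => a a0 T T0 T1 T1'.
have a30 : 0 <= a ^+ 3 by rewrite exprn_ge0.
have a20 : 0 <= a ^+ 2 by rewrite exprn_ge0.
have [al|al] := leP a 1.
  have a2 : a ^+ 2 <= a by rewrite expr2 ler_piMl.
  have a3 : a ^+ 3 <= a ^+ 2 by rewrite exprS ler_piMl.
  by split; lra.
have a2 : a <= a ^+ 2 by rewrite expr2 ler_peMl// ltW.
by split; lra.
Qed.

Lemma measurable_spline : measurable_fun [set: R] spline.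
Proof.
have mp a : measurable_fun [set: R] (fun x => pos (x - a) ^+ 3).
  apply: measurable_funX; apply: measurable_maxr => //.
  exact: measurable_funB.
have -> : spline = fun x => (pos (x - 0) ^+ 3 - 3 * pos (x - 1) ^+ 3 +
    3 * pos (x - 2) ^+ 3 - pos (x - 3) ^+ 3) / 6.
  by apply/funext => x; rewrite subr0.
apply: measurable_funM => //; apply: measurable_funB => //.
apply: measurable_funD; last exact: measurable_funM.
by apply: measurable_funB => //; exact: measurable_funM.
Qed.

End spline.

Section smooth.
Context {R : realType} {k : nat}.
Implicit Types (f : 'cV[R]_k -> R) (w h : 'cV[R]_k).

Definition norm1 h : R := \sum_i `|h i ord0|.
Definition lin_form (l : 'I_k -> R) h : R := \sum_i l i * h i ord0.
Definition quad_form (H : 'I_k -> 'I_k -> R) h : R :=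
  \sum_i \sum_j H i j * (h i ord0 * h j ord0).

Lemma norm1_ge0 h : 0 <= norm1 h. Proof. exact: sumr_ge0. Qed.

Lemma norm1_coord h i : `|h i ord0| <= norm1 h.
Proof. by rewrite /norm1 (bigD1 i)//= lerDl sumr_ge0. Qed.

(** Remainders of all three orders are recorded with common coefficients: the third and second
    orders serve small and large jumps in Lindeberg's argument, and all of them are needed for
    stability under products. The range [0, 1] keeps the constants of products under control. *)
Definition smooth (C : R) f := (forall w, 0 <= f w <= 1) /\
  forall w, exists l H, forall h,
  [/\ `|lin_form l h| <= C * norm1 h, `|quad_form H h| <= C * norm1 h ^+ 2,
      `|f (w + h) - f w| <= C * norm1 h,
      `|f (w + h) - f w - lin_form l h| <= C * norm1 h ^+ 2 &
      `|f (w + h) - f w - lin_form l h - quad_form H h| <= C * norm1 h ^+ 3].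

Lemma smooth1 : smooth 0 (fun=> 1).
Proof.
split=> [w|w]; first by rewrite ler01 lexx.
exists (fun=> 0), (fun _ _ => 0) => h; rewrite !mul0r subrr.
have -> : lin_form (fun=> 0) h = 0 by apply: big1 => i _; rewrite mul0r.
have -> : quad_form (fun _ _ => 0) h = 0.
  by apply: big1 => i _; apply: big1 => j _; rewrite mul0r.
by rewrite !subr0 normr0.
Qed.

Lemma ler_normM_le (a b A B : R) : `|a| <= A -> `|b| <= B -> `|a * b| <= A * B.
Proof. by move=> aA bB; rewrite normrM ler_pM. Qed.

Lemma ler_norm_add (a b A B : R) : `|a| <= A -> `|b| <= B -> `|a + b| <= A + B.
Proof. by move=> aA bB; rewrite (le_trans (ler_normD _ _))// lerD. Qed.

(** The third-order remainder of the product splits into the two remainders, multiplied by values at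
    most 1, and two cross terms of size [C1 * C2]; this fixes the constant, which also covers the
    lower orders. *)
Lemma smoothM C1 C2 f1 f2 : 0 <= C1 -> 0 <= C2 -> smooth C1 f1 -> smooth C2 f2 ->
  smooth (C1 + C2 + 2 * C1 * C2) (fun w => f1 w * f2 w).
Proof.
move=> C10 C20 [f1b s1] [f2b s2]; split.
  move=> w; have /andP[a0 a1] := f1b w; have /andP[b0 b1] := f2b w.
  by rewrite mulr_ge0//= mulr_ile1.
move=> w; have [l1 [H1 E1]] := s1 w; have [l2 [H2 E2]] := s2 w.
exists (fun i => l1 i * f2 w + f1 w * l2 i),
  (fun i j => H1 i j * f2 w + l1 i * l2 j + f1 w * H2 i j) => h.
have -> : lin_form (fun i => l1 i * f2 w + f1 w * l2 i) h =
    lin_form l1 h * f2 w + f1 w * lin_form l2 h.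
  rewrite /lin_form mulr_suml mulr_sumr -big_split; apply: eq_bigr => i _ /=.
  by ring.
have -> : quad_form (fun i j => H1 i j * f2 w + l1 i * l2 j + f1 w * H2 i j) h =
    quad_form H1 h * f2 w + lin_form l1 h * lin_form l2 h + f1 w * quad_form H2 h.
  rewrite /quad_form /lin_form big_distrlr mulr_suml mulr_sumr -!big_split.
  apply: eq_bigr => i _ /=; rewrite mulr_suml mulr_sumr -!big_split.
  by apply: eq_bigr => j _ /=; ring.
have [a1 a2 a3 a4 a5] := E1 h; have [b1 b2 b3 b4 b5] := E2 h.
have n0 := norm1_ge0 h; set n := norm1 h in a1 a2 a3 a4 a5 b1 b2 b3 b4 b5 n0 *.
have nf1 : `|f1 w| <= 1 by have /andP[? ?] := f1b w; rewrite ger0_norm.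
have nf2 : `|f2 w| <= 1 by have /andP[? ?] := f2b w; rewrite ger0_norm.
have nf2' : `|f2 (w + h)| <= 1 by have /andP[? ?] := f2b (w + h); rewrite ger0_norm.
move: a1 a2 a3 a4 a5 b1 b2 b3 b4 b5.
set L1 := lin_form l1 h; set L2 := lin_form l2 h.
set Q1 := quad_form H1 h; set Q2 := quad_form H2 h.
move: (f1 w) (f1 (w + h)) (f2 w) (f2 (w + h)) nf1 nf2 nf2' => x x' y y' nx ny ny'.
move=> a1 a2 a3 a4 a5 b1 b2 b3 b4 b5.
have CC : 0 <= C1 * C2 by rewrite mulr_ge0.
have CCn m : 0 <= C1 * C2 * n ^+ m by rewrite mulr_ge0// exprn_ge0.
split.
- apply: le_trans (ler_norm_add (ler_normM_le a1 ny) (ler_normM_le nx b1)) _.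
  by have := CCn 1; rewrite expr1; lra.
- apply: le_trans (ler_norm_add (ler_norm_add (ler_normM_le a2 ny) (ler_normM_le a1 b1)) (ler_normM_le nx b2)) _.
  by have := CCn 2; lra.
- have -> : x' * y' - x * y = (x' - x) * y' + x * (y' - y) by ring.
  apply: le_trans (ler_norm_add (ler_normM_le a3 ny') (ler_normM_le nx b3)) _.
  by have := CCn 1; rewrite expr1; lra.
- have -> : x' * y' - x * y - (L1 * y + x * L2) =
    (x' - x - L1) * y' + L1 * (y' - y) + x * (y' - y - L2) by ring.
  apply: le_trans (ler_norm_add (ler_norm_add (ler_normM_le a4 ny') (ler_normM_le a1 b3)) (ler_normM_le nx b4)) _.
  by have := CCn 2; lra.
- have -> : x' * y' - x * y - (L1 * y + x * L2) - (Q1 * y + L1 * L2 + x * Q2) =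
    (x' - x - L1 - Q1) * y' + Q1 * (y' - y) + L1 * (y' - y - L2) + x * (y' - y - L2 - Q2) by ring.
  apply: le_trans (ler_norm_add (ler_norm_add (ler_norm_add (ler_normM_le a5 ny')
     (ler_normM_le a2 b3)) (ler_normM_le a1 b4)) (ler_normM_le nx b5)) _.
  by have := CCn 3; lra.
Qed.

Definition smooth_prod_cst (C : R) m := iter m (fun D => C + D + 2 * C * D) 0.

Lemma smooth_prod_cst_ge0 C m : 0 <= C -> 0 <= smooth_prod_cst C m.
Proof.
by move=> C0; elim: m => //= m IH; rewrite !addr_ge0// !mulr_ge0.
Qed.

Lemma smooth_prod (I : Type) (s : seq I) C (F : I -> 'cV[R]_k -> R) : 0 <= C ->
  (forall i, smooth C (F i)) ->
  smooth (smooth_prod_cst C (size s)) (fun w => \prod_(i <- s) F i w).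
Proof.
move=> C0 sF; elim: s => [|i s IH].
  by under eq_fun do rewrite big_nil; exact: smooth1.
under eq_fun do rewrite big_cons.
by apply: smoothM => //; exact: smooth_prod_cst_ge0.
Qed.

(** Scaling the argument by [e] multiplies the order-m bound of [spline_expansion] by [e ^+ m]; the
    sum dominates the three factors. *)
Definition spline_cst (e : R) := 4 * (e + e ^+ 2 + e ^+ 3).

Lemma smooth_spline (a b : R) j :
  smooth (spline_cst `|a|) (fun w => 1 - spline (a * w j ord0 + b)).
Proof.
split.
  by move=> w; have [? ? _ _] := spline_bounds (a * w j ord0 + b); apply/andP; split; lra.
move=> w; set x := a * w j ord0 + b.
exists (fun i => if i == j then - (spline1 x * a) else 0),
 (fun i i' => if (i == j) && (i' == j) then - (spline2 x * a ^+ 2) else 0) => h.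
have -> : lin_form (fun i => if i == j then - (spline1 x * a) else 0) h =
    - (spline1 x * (a * h j ord0)).
  rewrite /lin_form (bigD1 j)//= eqxx big1 ?addr0 => [|i /negPf ->]; last by rewrite mul0r.
  by ring.
have -> : quad_form (fun i i' => if (i == j) && (i' == j) then - (spline2 x * a ^+ 2) else 0) h
    = - (spline2 x * (a * h j ord0) ^+ 2).
  rewrite /quad_form (bigD1 j)//= (bigD1 j)//= eqxx big1 => [|i /negPf ->]; last by rewrite mul0r.
  rewrite big1 => [|i /negPf ij]; last first.
    by apply: big1 => i' _; rewrite ij/= mul0r.
  by rewrite /=; ring.
rewrite mxE (_ : a * (w j ord0 + h j ord0) + b = x + a * h j ord0); last by rewrite /x; ring.
have [_ _ d1 d2] := spline_bounds x.
have [e1 e2 e3] := spline_expansion x (a * h j ord0).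
have th : `|a * h j ord0| <= `|a| * norm1 h.
  by rewrite normrM ler_wpM2l//; exact: norm1_coord.
set t := a * h j ord0 in e1 e2 e3 th *.
set n := norm1 h in th *; have n0 : 0 <= n by exact: norm1_ge0.
have A0 : 0 <= `|a| by [].
set A := `|a| in th A0 *.
have t2 : `|t| ^+ 2 <= A ^+ 2 * n ^+ 2 by rewrite -exprMn lerXn2r ?nnegrE// mulr_ge0.
have t3 : `|t| ^+ 3 <= A ^+ 3 * n ^+ 3 by rewrite -exprMn lerXn2r ?nnegrE// mulr_ge0.
have q p m : 0 <= A ^+ p * n ^+ m by rewrite mulr_ge0// exprn_ge0.
have := q 1 1; have := q 2 1; have := q 3 1; have := q 1 2; have := q 2 2.
have := q 3 2; have := q 1 3; have := q 2 3; have := q 3 3.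
rewrite !expr1 => q33 q23 q13 q32 q22 q12 q31 q21 q11.
rewrite /spline_cst; split.
- rewrite normrN normrM.
  have : `|spline1 x| * `|t| <= `|t| by rewrite ler_piMl.
  lra.
- rewrite normrN normrM normrX.
  have : `|spline2 x| * `|t| ^+ 2 <= `|t| ^+ 2 by rewrite ler_piMl// exprn_ge0.
  lra.
- rewrite (_ : _ - _ = - (spline (x + t) - spline x)); last by ring.
  by rewrite normrN; lra.
- rewrite (_ : _ - _ = - (spline (x + t) - spline x - spline1 x * t)); last by ring.
  by rewrite normrN; lra.
- rewrite (_ : _ - _ = - (spline (x + t) - spline x - spline1 x * t - spline2 x * t ^+ 2)); last by ring.
  by rewrite normrN; lra.
Qed.

Lemma smooth_taylor3 C f : smooth C f -> taylor3 C f.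
Proof.
move=> [_ sf] w; have [l [H E]] := sf w; exists l, H => h; have [_ _ _ _] := E h.
by rewrite (_ : f (w + h) - (f w + _ + _) = f (w + h) - f w - lin_form l h - quad_form H h)// /lin_form /quad_form; ring.
Qed.

Lemma smooth_test_fun C f : measurable_fun setT (f \o @tcol R k) ->
  smooth C f -> test_fun f.
Proof.
move=> mf [fb sf]; split=> //.
- by move=> w; case/andP: (fb w).
- by exists 1 => w; case/andP: (fb w).
- by exists C => w h; have [l [H E]] := sf w; case: (E h).
Qed.

(** A smoothed indicator of the cube with sides [lo, hi]: in each coordinate it drops from 1 to 0
    across a layer of width [3 / e] inside each face, 3 being the length of the ramp of [spline]. *)
Definition soft_box (e lo hi : R) w := \prod_j
  ((1 - spline (e * w j ord0 + (3 - e * hi))) *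
   (1 - spline (- e * w j ord0 + (e * lo + 3)))).

(** Depends on [e] and the dimension but not on the position of the box. The box follows the
    quantile, which varies with n, so this uniformity is essential. *)
Definition soft_box_cst (e : R) :=
  smooth_prod_cst (spline_cst e + spline_cst e + 2 * spline_cst e * spline_cst e)
    (size (index_enum 'I_k)).

Lemma spline_cst_ge0 e : 0 <= e -> 0 <= spline_cst e.
Proof. by move=> e0; rewrite /spline_cst mulr_ge0// !addr_ge0// exprn_ge0. Qed.

Lemma soft_box_cst_ge0 e : 0 <= e -> 0 <= soft_box_cst e.
Proof.
move=> e0; apply: smooth_prod_cst_ge0; have c0 := spline_cst_ge0 e0.
by apply: addr_ge0; [exact: addr_ge0|apply: mulr_ge0 => //; exact: mulr_ge0].
Qed.

Lemma smooth_soft_box e lo hi : 0 <= e ->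
  smooth (soft_box_cst e) (soft_box e lo hi).
Proof.
move=> e0; have c0 := spline_cst_ge0 e0.
apply: smooth_prod => [|j]; first by apply: addr_ge0; [exact: addr_ge0|apply: mulr_ge0 => //; exact: mulr_ge0].
apply: smoothM => //.
- by rewrite -[X in spline_cst X](ger0_norm e0); exact: smooth_spline.
- by rewrite -[X in spline_cst X](ger0_norm e0) -normrN; exact: smooth_spline.
Qed.

Lemma measurable_soft_box e lo hi : measurable_fun setT (soft_box e lo hi \o @tcol R k).
Proof.
apply: measurable_prod => j _; apply: measurable_funM.
- apply: measurable_funB => //; apply: (measurableT_comp measurable_spline).
  apply: measurable_funD => //; apply: measurable_funM => //.
  by under eq_fun do rewrite mxE; exact: (@measurable_tproj R k j).
- apply: measurable_funB => //; apply: (measurableT_comp measurable_spline).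
  apply: measurable_funD => //; apply: measurable_funM => //.
  by under eq_fun do rewrite mxE; exact: (@measurable_tproj R k j).
Qed.

Lemma soft_box_ge0_le1 e lo hi w : 0 <= e -> 0 <= soft_box e lo hi w <= 1.
Proof. by move=> e0; have [/(_ w)] := smooth_soft_box lo hi e0. Qed.

Lemma soft_box_eq1 e lo hi w : 0 < e ->
  (forall j, lo + 3 / e <= w j ord0 <= hi - 3 / e) -> soft_box e lo hi w = 1.
Proof.
move=> e0 wb; apply: big1 => j _; have /andP[w1 w2] := wb j.
have e3 : e * (3 / e) = 3 by field; rewrite gt_eqF.
rewrite !spline_le0 ?subr0 ?mulr1//.
- have : e * (lo + 3 / e) <= e * w j ord0 by rewrite ler_pM2l.
  by rewrite mulrDr e3; lra.
- have : e * w j ord0 <= e * (hi - 3 / e) by rewrite ler_pM2l.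
  by rewrite mulrBr e3; lra.
Qed.

Lemma soft_box_eq0 e lo hi w j : 0 < e ->
  w j ord0 <= lo \/ hi <= w j ord0 -> soft_box e lo hi w = 0.
Proof.
move=> e0 wb; rewrite /soft_box (bigD1 j)//=; case: wb => wb.
- rewrite [X in _ * (1 - X) * _]spline_ge3 ?subrr ?mulr0 ?mul0r//.
  have : e * w j ord0 <= e * lo by rewrite ler_pM2l.
  lra.
- rewrite [X in (1 - X) * _ * _]spline_ge3 ?subrr ?mul0r//.
  have : e * hi <= e * w j ord0 by rewrite ler_pM2l.
  lra.
Qed.

End smooth.

(** * Normal approximation of the probability of a box *)

Section indicator_bounds.
Context d (T : measurableType d) (R : realType) (P : probability T R).

Lemma probability_le_Rintegral (B : set T) f : measurable B -> bounded_mfun f ->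
  (forall x, 0 <= f x) -> (forall x, B x -> 1 <= f x) ->
  (P B <= (\int[P]_x f x)%:E)%E.
Proof.
move=> mB bf f0 f1; rewrite EFin_Rintegral; last exact: bounded_mfun_integrable.
rewrite -[B]setIT -integral_indic//; apply: ge0_le_integral => //.
- exact/measurable_EFinP.
- exact/measurable_EFinP/bf.1.
- move=> x _; rewrite lee_fin indicE; have [xB|//] := boolP (x \in B).
  by apply: f1; rewrite inE in xB.
Qed.

Lemma Rintegral_le_probability (B : set T) f : measurable B -> bounded_mfun f ->
  (forall x, 0 <= f x <= 1) -> (forall x, ~ B x -> f x = 0) ->
  ((\int[P]_x f x)%:E <= P B)%E.
Proof.
move=> mB bf f01 f0; rewrite EFin_Rintegral; last exact: bounded_mfun_integrable.
rewrite -[B]setIT -integral_indic//; apply: ge0_le_integral => //.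
- by move=> x _; rewrite lee_fin; case/andP: (f01 x).
- exact/measurable_EFinP/bf.1.
- exact/measurable_EFinP.
- move=> x _; rewrite lee_fin indicE; have [xB|xB] := boolP (x \in B).
    by case/andP: (f01 x).
  by rewrite f0//= => Bx; move: xB; rewrite notin_setE.
Qed.

End indicator_bounds.

(** * Anticoncentration of Gaussian coordinates *)

Section anticoncentration.
Context {R : realType}.

Lemma stdN_itv_le (a b : R) : a <= b -> (stdN `[a, b]%classic <= (b - a)%:E)%E.
Proof.
move=> ab; rewrite /stdN/= /normal_prob.
apply: (@le_trans _ _ (\int[lebesgue_measure]_(x in `[a, b]) (cst 1%:E x))%E).
  apply: ge0_le_integral => //=.
  - by move=> x _; rewrite lee_fin normal_pdf_ge0.
  - by apply/measurable_EFinP/measurable_funTS; exact: measurable_normal_pdf.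
  - move=> x _; rewrite lee_fin (le_trans (normal_pdf_ub _ _ _)) ?oner_neq0//.
    have p2 : (1 : R) <= pi *+ 2.
      by have := pi_ge2 R; rewrite -mulr_natr; lra.
    rewrite /normal_peak expr1n mul1r invf_le1 ?sqrtr_gt0.
      by rewrite -[leLHS]sqrtr1 ler_sqrt// (le_trans ler01 p2).
    exact: lt_le_trans ltr01 p2.
rewrite (@integral_cst _ _ _ lebesgue_measure)// mul1e.
rewrite [X in (X <= _)%E](lebesgue_measure_itv `[a, b])/= lte_fin.
by case: ifPn => // _; rewrite lee_fin subr_ge0.
Qed.

(** The linear form is compared with a single standard normal variable, but equality is available on
    smooth functions only. The interval is therefore enlarged by half its length on each side to fit
    a soft box, and the constant 2 is this doubling, the density being at most 1. *)
Lemma anticoncentration n (S : probability (n.-tuple R) R) (u : 'I_n -> R) lo hi :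
  std_normal S -> \sum_i u i ^+ 2 = 1 -> lo < hi ->
  (S [set y | lo <= linform u y <= hi]%R <= (2 * (hi - lo))%:E)%E.
Proof.
move=> NS u1 lohi.
have [S1 NS1] := std_normal_exists R 1.
pose A : 'M[R]_(1, n) := \row_i u i.
pose A1 : 'M[R]_(1, 1) := 1%:M.
have AA : A *m A^T = A1 *m A1^T.
  rewrite trmx1 mulmx1; apply/matrixP => i j; rewrite !ord1 !mxE/= -u1.
  by apply: eq_bigr => l _; rewrite !mxE expr2.
pose e := 6 / (hi - lo).
have w0 : 0 < hi - lo by rewrite subr_gt0.
have e0 : 0 < e by rewrite divr_gt0.
have e3 : 3 / e = (hi - lo) / 2 by rewrite /e; field; rewrite gt_eqF.
pose f : 'cV[R]_1 -> R := soft_box e (lo - 3 / e) (hi + 3 / e).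
have sf := @smooth_soft_box R 1 e (lo - 3 / e) (hi + 3 / e) (ltW e0).
have tf := smooth_test_fun (measurable_soft_box e (lo - 3 / e) (hi + 3 / e)) sf.
have lf y : (A *m tcol y) ord0 ord0 = linform u y.
  by rewrite mulmx_linform; apply: eq_bigr => i _; rewrite mxE.
have bf m (B : 'M[R]_(1, m)) : bounded_mfun (fun y : m.-tuple R => f (B *m tcol y)).
  apply: (@test_fun_comp _ _ f _ _ (fun y : m.-tuple R => B *m tcol y) tf) => i.
  by under eq_fun do rewrite mulmx_linform; exact: measurable_linform.
have f01 w : 0 <= f w <= 1 := soft_box_ge0_le1 _ _ w (ltW e0).
have mset : measurable [set y | lo <= linform u y <= hi]%R.
  rewrite (_ : [set _ | _] = linform u @^-1` `[lo, hi]).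
    by rewrite -[X in measurable X]setTI; exact: measurable_linform.
  by apply/seteqP; split=> y /=; rewrite in_itv.
apply: (@le_trans _ _ (\int[S]_y f (A *m tcol y))%:E).
  apply: probability_le_Rintegral => //; first exact: bf.
    by move=> y; case/andP: (f01 (A *m tcol y)).
  move=> y /= yb; rewrite /f soft_box_eq1// => j; rewrite ord1 lf.
  by rewrite subrK addrK.
rewrite (Rintegral_gauss_eq AA NS NS1 tf (smooth_taylor3 sf)).
pose I : set R := `[lo - 3 / e, hi + 3 / e]%classic.
apply: (@le_trans _ _ (S1 (tproj ord0 @^-1` I))).
  apply: Rintegral_le_probability => //.
  - by apply: measurable_tproj_preimage; exact: measurable_itv.
  - exact: bf.
  move=> y; rewrite /I /= in_itv/= => /negP; rewrite negb_and -!ltNge => /orP yb.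
  apply: (@soft_box_eq0 _ _ _ _ _ _ ord0) => //.
  rewrite /A1 mul1mx mxE -/(tproj _ _).
  by case: yb => /ltW; [left|right].
have mI : measurable I by exact: measurable_itv.
rewrite [leLHS](_ : _ = stdN I); last by rewrite [RHS](law_std_normal ord0 NS1).
apply: le_trans (stdN_itv_le _) _.
  by rewrite e3; lra.
by rewrite lee_fin e3; lra.
Qed.

End anticoncentration.

(** * Lindeberg's bound for smooth functions of linear forms *)

Section clt.
Context {R : realType}.

Definition tail (B x : R) := if B < `|x| then x ^+ 2 else 0.

Lemma measurable_tail B : measurable_fun [set: R] (tail B).
Proof.
apply: measurable_fun_ifT => //.
by apply: measurable_fun_ltr => //; exact: normr_measurable.
Qed.

Lemma tail_ge0 B x : 0 <= tail B x.
Proof. by rewrite /tail; case: ifP => // _; exact: sqr_ge0. Qed.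

(** Changing coordinate [i] moves the argument along [col i A]. Beyond [B] the second-order
    remainder costs a multiple of the squared jump, which is counted by [tail]; below [B] the
    third-order one applies, with [|t| ^+ 3 <= B * t ^+ 2]. *)
Lemma clt_smooth k n (P Q : probability (n.-tuple R) R) (A : 'M[R]_(k, n))
    f C B kP kQ :
  standardized P -> standardized Q -> 0 <= C -> 0 <= B ->
  test_fun f -> smooth C f ->
  (forall i, \int[P]_y (tail B (tproj i y))%:E <= kP%:E)%E ->
  (forall i, \int[Q]_y (tail B (tproj i y))%:E <= kQ%:E)%E ->
  `|\int[P]_y f (A *m tcol y) - \int[Q]_y f (A *m tcol y)| <=
  \sum_i 2 * C * norm1 (col i A) ^+ 2 * (kP + kQ + 2 * (norm1 (col i A) * B)).
Proof.
move=> stP stQ C0 B0 tf sf tP tQ.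
have [indP P1 P2] := stP; have [indQ Q1 Q2] := stQ.
pose c i := norm1 (col i A).
have c0 i : 0 <= c i by exact: norm1_ge0.
pose r i x := 2 * C * c i ^+ 2 * (tail B x + c i * B * x ^+ 2).
have mr i : measurable_fun [set: R] (r i).
  apply: measurable_funM => //; apply: measurable_funD; first exact: measurable_tail.
  by apply: measurable_funM => //; exact: measurable_funX.
have Er (T : probability (n.-tuple R) R) kT : standardized T ->
    (forall i, \int[T]_y (tail B (tproj i y))%:E <= kT%:E)%E ->
    forall i, (\int[T]_y (r i (tproj i y))%:E <= (2 * C * c i ^+ 2 * (kT + c i * B))%:E)%E.
  move=> [_ _ T2] tT i.
  have mt : measurable_fun setT (fun y : n.-tuple R => (tail B (tproj i y))%:E).
    apply/measurable_EFinP; apply: (measurableT_comp (measurable_tail B)).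
    exact: measurable_tproj.
  have ms : measurable_fun setT (fun y : n.-tuple R => (tproj i y ^+ 2)%:E).
    by apply/measurable_EFinP/measurable_funX; exact: measurable_tproj.
  under eq_integral do rewrite /r EFinM EFinD (EFinM (c i * B)).
  have cB : (0 <= (c i * B)%:E)%E by rewrite lee_fin mulr_ge0.
  rewrite ge0_integralZl//; last 3 first.
  - by apply: emeasurable_funD => //; exact: emeasurable_funM.
  - by move=> y _; apply: adde_ge0; [rewrite lee_fin tail_ge0|apply: mule_ge0 => //; rewrite lee_fin sqr_ge0].
  - by rewrite lee_fin !mulr_ge0// exprn_ge0.
  rewrite [leRHS]EFinM; apply: lee_wpmul2l.
    by rewrite lee_fin !mulr_ge0// exprn_ge0.
  rewrite ge0_integralD//; last 3 first.
  - by move=> y _; rewrite lee_fin tail_ge0.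
  - by move=> y _; rewrite mule_ge0// lee_fin sqr_ge0.
  - exact: emeasurable_funM.
  rewrite EFinD; apply: leeD; first exact: tT.
  rewrite ge0_integralZl//; last by move=> y _; rewrite lee_fin sqr_ge0.
  by rewrite T2 mule1.
have bf : bounded_mfun (fun y : n.-tuple R => f (A *m tcol y)).
  apply: (@test_fun_comp _ _ f _ _ (fun y : n.-tuple R => A *m tcol y) tf) => i.
  by under eq_fun do rewrite mulmx_linform; exact: measurable_linform.
apply: le_trans (lindeberg_swap indP indQ P1 Q1 P2 Q2 bf mr (Er P kP stP tP) (Er Q kQ stQ tQ) _) _.
  move=> i y.
  (* The base point with the [i]-th contribution removed is the same for all [y'] that agree with
     [y] off [i], so its expansion has coefficients independent of the replaced coordinate. *)
  pose w := A *m tcol y - tproj i y *: col i A.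
  have [l [H E]] := sf.2 w.
  exists (f w), (lin_form l (col i A)), (quad_form H (col i A)) => y' yy'.
  have wE : A *m tcol y' = w + tproj i y' *: col i A.
    rewrite /w -addrA -scaleNr -scalerDl; apply/colP => j; rewrite !mxE.
    rewrite (bigD1 i)//= [in RHS](bigD1 i)//= !mxE -!/(tproj _ _).
    rewrite (eq_bigr (fun l => A j l * tcol y l ord0)).
      by ring.
    by move=> m mi; rewrite !mxE -!/(tproj _ _) yy'.
  have [] := E (tproj i y' *: col i A); rewrite -wE.
  move: (tproj i y') => t.
  have -> : norm1 (t *: col i A) = `|t| * c i.
    by rewrite /norm1 mulr_sumr; apply: eq_bigr => j _; rewrite mxE normrM.
  have -> : lin_form l (t *: col i A) = lin_form l (col i A) * t.
    by rewrite /lin_form mulr_suml; apply: eq_bigr => j _; rewrite mxE; ring.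
  have -> : quad_form H (t *: col i A) = quad_form H (col i A) * t ^+ 2.
    rewrite /quad_form mulr_suml; apply: eq_bigr => j _; rewrite mulr_suml.
    by apply: eq_bigr => m _; rewrite !mxE; ring.
  set L := lin_form _ _; set q := quad_form _ _ => _ e2 _ e4 e5.
  rewrite (_ : _ - _ = f (A *m tcol y') - f w - L * t - q * t ^+ 2); last by ring.
  have cB0 : 0 <= c i * B by rewrite mulr_ge0.
  have cc0 : 0 <= 2 * C * c i ^+ 2 by rewrite !mulr_ge0// exprn_ge0.
  rewrite /r /tail; case: ifPn => [Bt|].
    apply: le_trans (ler_normB _ _) _; apply: le_trans (lerD e4 e2) _.
    rewrite exprMn real_normK ?num_real//.
    have -> : C * (t ^+ 2 * c i ^+ 2) + C * (t ^+ 2 * c i ^+ 2) =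
      2 * C * c i ^+ 2 * t ^+ 2 by ring.
    by rewrite ler_wpM2l// lerDl mulr_ge0// sqr_ge0.
  rewrite -leNgt add0r => tB; apply: le_trans e5 _.
  have -> : C * (`|t| * c i) ^+ 3 = C * c i ^+ 2 * (c i * `|t| * `|t| ^+ 2) by ring.
  rewrite real_normK ?num_real//.
  have -> : 2 * C * c i ^+ 2 * (c i * B * t ^+ 2) =
    C * c i ^+ 2 * (2 * (c i * B * t ^+ 2)) by ring.
  apply: ler_wpM2l; first by rewrite mulr_ge0// exprn_ge0.
  have h1 : c i * `|t| * t ^+ 2 <= c i * B * t ^+ 2.
    by apply: ler_wpM2r; [exact: sqr_ge0|exact: ler_wpM2l].
  have h2 : 0 <= c i * B * t ^+ 2 by rewrite mulr_ge0// sqr_ge0.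
  lra.
rewrite le_eqVlt; apply/orP; left; apply/eqP; apply: eq_bigr => i _.
by rewrite -/(c i); ring.
Qed.

End clt.

Section probability_bounds.
Context d (T : measurableType d) (R : realType) (P : probability T R).

Lemma probability_le_integral (B : set T) (f : T -> R) : measurable B ->
  measurable_fun setT f -> (forall x, 0 <= f x) -> (forall x, B x -> 1 <= f x) ->
  (P B <= \int[P]_x (f x)%:E)%E.
Proof.
move=> mB mf f0 f1; rewrite -[B]setIT -integral_indic//; apply: ge0_le_integral => //.
- exact/measurable_EFinP.
- exact/measurable_EFinP.
- move=> x _; rewrite lee_fin indicE; have [xB|//] := boolP (x \in B).
  by apply: f1; rewrite inE in xB.
Qed.

Lemma probability_le_sum (I : finType) (B : set T) (A : I -> set T) :
  measurable B -> (forall i, measurable (A i)) ->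
  (forall x, B x -> exists i, A i x) -> (P B <= \sum_i P (A i))%E.
Proof.
move=> mB mA BA; apply: (@le_trans _ _ (P (\big[setU/set0]_i A i))).
  apply: le_measure; rewrite ?inE//; first exact: bigsetU_measurable.
  by move=> x /BA [i Ai]; rewrite -bigcup_seq; exists i => //=; rewrite mem_index_enum.
elim: (index_enum I) => [|i s IH]; first by rewrite !big_nil measure0.
rewrite !big_cons (le_trans (measureU2 _ _ _))//; first exact: bigsetU_measurable.
exact: leeD2l.
Qed.

End probability_bounds.

Lemma cV_norm_le (R : realType) k (w : 'cV[R]_k) x : 0 <= x ->
  (`|w| <= x) <-> (forall j, `|w j ord0| <= x).
Proof.
move=> x0; rewrite [`|w|]mx_normrE; split=> [h j|h].
  by apply: le_trans h; apply: (le_bigmax _ (fun ij => `|w ij.1 ij.2|) (j, ord0)).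
by apply: bigmax_le => // -[i j] _ /=; rewrite ord1.
Qed.

(** * Boxes of Gaussian vectors and their quantiles *)

Section gauss_quantile.
Context {R : realType} {k : nat}.

Definition lin_box n (A : 'M[R]_(k, n)) (x : R) : set (n.-tuple R) :=
  [set y | forall j, `|linform (A j) y| <= x].

Lemma measurable_lin_box n (A : 'M[R]_(k, n)) x : measurable (lin_box A x).
Proof.
rewrite (_ : lin_box A x = \bigcap_(j in [set: 'I_k]) linform (A j) @^-1` `[-x, x]).
  apply: fin_bigcap_measurable => // j _.
  by rewrite -[X in measurable X]setTI; exact: measurable_linform.
apply/seteqP; split=> y yb j; first by move=> _; rewrite /= in_itv/= -ler_norml.
by have := yb j I; rewrite /= in_itv/= -ler_norml.
Qed.

Lemma lin_box_sub n (A : 'M[R]_(k, n)) x x' : x <= x' -> lin_box A x `<=` lin_box A x'.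
Proof. by move=> xx' y yb j; exact: le_trans (yb j) xx'. Qed.

(** Outside the box the sum of the [k] squares, each of mean 1, exceeds [x ^+ 2]. This crude
    estimate bounds the quantile uniformly over all correlation matrices. *)
Lemma lin_box_chebyshev n (P : probability (n.-tuple R) R) (A : 'M[R]_(k, n)) x :
  standardized P -> (forall j, (A *m A^T) j j = 1) -> 0 < x ->
  ((1 - k%:R / x ^+ 2)%:E <= P (lin_box A x))%E.
Proof.
move=> stP A1 x0.
have A1' j : \sum_i A j i ^+ 2 = 1.
  by rewrite -(A1 j) mxE; apply: eq_bigr => i _; rewrite mxE expr2.
have mB := measurable_lin_box A x.
rewrite -[P _]fineK ?fin_num_measure// lee_fin lerBlDr -lerBlDl -lee_fin EFinB fineK ?fin_num_measure//.
rewrite -probability_setC//.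
have mX2 j : measurable_fun setT (fun y : n.-tuple R => linform (A j) y ^+ 2).
  by apply: measurable_funX; exact: measurable_linform.
apply: (le_trans (@probability_le_integral _ _ _ P _
  (fun y => x ^- 2 * \sum_j linform (A j) y ^+ 2) _ _ _ _)).
- exact: measurableC.
- apply: measurable_funM => //; apply: measurable_sum => j; exact: mX2.
- by move=> y; rewrite mulr_ge0 ?invr_ge0 ?exprn_ge0 ?(ltW x0)// sumr_ge0// => j _; exact: sqr_ge0.
- move=> y /existsNP [j /negP]; rewrite -ltNge => xj.
  rewrite ler_pdivlMl ?exprn_gt0// mulr1 (bigD1 j)//=.
  rewrite -[X in _ <= X + _]real_normK ?num_real//.
  apply: ler_wpDr; first by rewrite sumr_ge0// => i _; exact: sqr_ge0.
  by rewrite lerXn2r ?nnegrE ?(ltW x0)// ltW.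
have iX j : P.-integrable setT (EFin \o (fun y => linform (A j) y ^+ 2)).
  exact: linform_sqr_integrable.
have [isum sE] := Rintegral_sum (index_enum 'I_k) iX.
under eq_integral do rewrite EFinM.
rewrite integralZl// -EFin_Rintegral// sE -EFinM lee_fin mulrC.
rewrite (eq_bigr (fun=> 1)) => [|j _]; last by rewrite Rintegral_linform_sqr.
by rewrite sumr_const card_ord.
Qed.

(** A union bound over the two slabs of each coordinate, of probability at most [2 * (x' - x)] each.
    Only the unit variances enter, so a singular covariance is allowed. *)
Lemma lin_box_anticoncentration n (S : probability (n.-tuple R) R) (A : 'M[R]_(k, n)) x x' :
  std_normal S -> (forall j, (A *m A^T) j j = 1) -> x < x' ->
  (S (lin_box A x') <= S (lin_box A x) + (k%:R * (4 * (x' - x)))%:E)%E.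
Proof.
move=> NS A1 xx'.
have A1' j : \sum_i A j i ^+ 2 = 1.
  by rewrite -(A1 j) mxE; apply: eq_bigr => i _; rewrite mxE expr2.
pose J (o : unit + 'I_k * bool) := match o with
  | inl _ => lin_box A x
  | inr (j, b) => if b then [set y | x <= linform (A j) y <= x']%R
                   else [set y | - x' <= linform (A j) y <= - x]%R end.
have mI j a b : measurable [set y : n.-tuple R | a <= linform (A j) y <= b]%R.
  rewrite (_ : [set _ | _] = linform (A j) @^-1` `[a, b]).
    by rewrite -[X in measurable X]setTI; exact: measurable_linform.
  by apply/seteqP; split=> y /=; rewrite in_itv.
apply: (le_trans (@probability_le_sum _ _ _ S _ _ J _ _ _)).
- exact: measurable_lin_box.
- by case=> [[]|[j []]] /=; [exact: measurable_lin_box|exact: mI|exact: mI].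
- move=> y yx'; have [yx|/existsNP[j /negP]] := pselect (lin_box A x y).
    by exists (inl tt).
  rewrite -ltNge => xj; have := yx' j; rewrite ler_norml => /andP[h1 h2].
  have [l0|l0] := leP 0 (linform (A j) y).
    by exists (inr (j, true)); rewrite /= h2 andbT ltW// -[ltRHS]ger0_norm.
  exists (inr (j, false)); rewrite /= h1/= lerNr ltW// -[ltRHS]ler0_norm//.
  exact: ltW.
rewrite big_sumType/= (big_pred1 tt) => [|[]//]; apply: leeD => //.
rewrite (eq_bigr (fun p => S (J (inr (p.1, p.2))))); last by case.
rewrite -(pair_bigA _ (fun j b => S (J (inr (j, b)))))/=.
rewrite mulr_natl -[k in _ *+ k]card_ord -sumr_const -sumEFin.
apply: lee_sum => j _; rewrite big_bool/=.
have -> : 4 * (x' - x) = 2 * (x' - x) + 2 * (- x - - x') :> R by ring.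
rewrite EFinD; apply: leeD; apply: anticoncentration => //.
by rewrite ltrN2.
Qed.

(** The matrix and the normal vector are those of the law selected by [get]. The slack [eta] avoids
    having to show that the infimum is attained, and [k.+1] keeps the upper bound positive when
    [k = 0]. *)
Lemma normal_quantileP (G : 'M[R]_k) (a : R) : 0 < a < 1 ->
  centered_normal G !=set0 -> (forall j, G j j = 1) ->
  exists n (A : 'M[R]_(k, n)) (S : probability (n.-tuple R) R),
  [/\ A *m A^T = G, std_normal S, 0 <= normal_quantile a G,
      normal_quantile a G <= Num.sqrt (k.+1%:R / (1 - a)) &
      forall eta, 0 < eta -> (a%:E <= S (lin_box A (normal_quantile a G + eta)))%E].
Proof.
move=> /andP[a0 a1] G0 G1.
rewrite /normal_quantile /quantile; set Q := get (centered_normal G).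
have : centered_normal G Q by case: G0 => Q0 Q0P; apply: getPex; exists Q0.
move=> [n [A [S [AG NS QS]]]].
exists n, A, S.
have stS := std_normal_standardized NS.
have A1 j : (A *m A^T) j j = 1 by rewrite AG.
set E := [set x | _].
have QE x : 0 <= x -> Q [set t | `|tcol t| <= x]%R = S (lin_box A x).
  move=> x0; rewrite QS.
    congr (S _); apply/seteqP; split=> y /=; rewrite coltupK cV_norm_le// => yb j.
      by have := yb j; rewrite mulmx_linform.
    by rewrite mulmx_linform; exact: yb.
  rewrite (_ : [set t | _] = \bigcap_(j in [set: 'I_k]) (@tproj R k j @^-1` `[-x, x])).
    apply: fin_bigcap_measurable => // j _.
    by apply: measurable_tproj_preimage; exact: measurable_itv.
  apply/seteqP; split=> y /=; rewrite cV_norm_le// => yb j.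
    by move=> _; rewrite /= in_itv/= -ler_norml; have := yb j; rewrite mxE.
  by have := yb j I; rewrite /= in_itv/= -ler_norml mxE.
have E0 x : E x -> 0 <= x.
  rewrite /E/= => h; rewrite leNgt; apply/negP => x0; move: h.
  rewrite (_ : [set t | _] = set0); last first.
    apply/seteqP; split=> // y /= h; have := lt_le_trans x0 (normr_ge0 (tcol y)).
    by rewrite ltNge h.
  by rewrite measure0 lee_fin leNgt a0.
set Km := Num.sqrt _.
have Km0 : 0 < Km by rewrite sqrtr_gt0 divr_gt0// subr_gt0.
have EKm : E Km.
  rewrite /E/= QE; last exact: ltW.
  apply: le_trans (lin_box_chebyshev stS A1 Km0).
  rewrite lee_fin sqr_sqrtr; last by rewrite divr_ge0// subr_ge0 ltW.
  have -> : k%:R / (k.+1%:R / (1 - a)) = (k%:R / k.+1%:R) * (1 - a).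
    by rewrite invf_div mulrA mulrAC.
  have : k%:R / k.+1%:R * (1 - a) <= 1 - a.
    by rewrite ler_piMl ?subr_ge0 ?(ltW a1)// ler_pdivrMr// mul1r ler_nat.
  by move: (k%:R / k.+1%:R * (1 - a)) => z; lra.
have lbE : has_lbound E by exists 0 => x /E0.
have infE : has_inf E by split; [exists Km|].
have inf0 : 0 <= inf E by apply: lb_le_inf; [exists Km|move=> x /E0].
split=> //; first exact: (ge_inf lbE).
move=> eta eta0; have [x Ex xK] := inf_adherent eta0 infE.
apply: (le_trans Ex); rewrite QE; last exact: E0.
apply: le_measure; rewrite ?inE; [exact: measurable_lin_box|exact: measurable_lin_box|].
by apply: lin_box_sub; exact: ltW.
Qed.

End gauss_quantile.

Section gauss_approximation.
Context {R : realType} {k : nat}.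

Lemma stdN_tail (m3 B : R) : 0 < B -> (\int[stdN]_x (`|x| ^+ 3)%:E <= m3%:E)%E ->
  (\int[stdN]_x (tail B x)%:E <= (m3 / B)%:E)%E.
Proof.
move=> B0 hm3.
have mabs3 : measurable_fun [set: R] (fun x : R => `|x| ^+ 3).
  by apply: measurable_funX; exact: normr_measurable.
apply: (@le_trans _ _ (B^-1%:E * \int[stdN]_x (`|x| ^+ 3)%:E)%E); last first.
  by rewrite mulrC EFinM; apply: lee_wpmul2l => //; rewrite lee_fin invr_ge0 ltW.
rewrite -ge0_integralZl//; last 2 first.
- exact/measurable_EFinP.
- by rewrite lee_fin invr_ge0 ltW.
apply: ge0_le_integral => //.
- by move=> x _; rewrite lee_fin tail_ge0.
- by apply/measurable_EFinP; exact: measurable_tail.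
- by apply/measurable_EFinP/measurable_funM.
move=> x _; rewrite -EFinM lee_fin /tail; case: ifPn => [Bx|_]; last first.
  by rewrite mulr_ge0 ?invr_ge0 ?(ltW B0)// exprn_ge0.
rewrite ler_pdivlMl// [`|x| ^+ 3]exprS real_normK ?num_real//.
by rewrite ler_wpM2r ?sqr_ge0// ltW.
Qed.

(** With [f] a soft box inside the cube of half-side [t], the chain is: the probability under [P] is
    at least the integral of [f] under [P], hence up to Lindeberg's error that of [f (A *m g)] for a
    standard normal [g], hence that of [f (A' *m g')] for the representation of the quantile. This
    last one is at least the probability of the box of half-side [t - 3 / e], which
    anticoncentration compares with the box of half-side [K + eta]. *)
Lemma lin_box_ge n (P : probability (n.-tuple R) R) (A : 'M[R]_(k, n))
    (a t eta e B kP m3 : R) :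
  standardized P -> (forall j, (A *m A^T) j j = 1) -> 0 < a < 1 ->
  0 < eta -> 0 < e -> 0 < B -> t <= normal_quantile a (A *m A^T) ->
  (forall i, \int[P]_y (tail B (tproj i y))%:E <= kP%:E)%E ->
  (\int[stdN]_x (`|x| ^+ 3)%:E <= m3%:E)%E ->
  ((a - k%:R * (4 * (normal_quantile a (A *m A^T) + eta - t + 3 / e)) -
   \sum_i 2 * @soft_box_cst R k e * norm1 (col i A) ^+ 2 *
      (kP + m3 / B + 2 * (norm1 (col i A) * B)))%:E <= P (lin_box A t))%E.
Proof.
move=> stP A1 a01 eta0 e0 B0 tK tP hm3.
have [S NS] := std_normal_exists R n.
have G1 j : (A *m A^T) j j = 1 by [].
have [m [A' [S' [AG NS' K0 _ SK]]]] := normal_quantileP a01 (centered_normal_gram A) G1.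
set K := normal_quantile a _ in tK K0 SK *.
pose f : 'cV[R]_k -> R := soft_box e (- t) t.
have sf := @smooth_soft_box R k e (- t) t (ltW e0).
have tf := smooth_test_fun (measurable_soft_box e (- t) t) sf.
have C0 : 0 <= @soft_box_cst R k e := soft_box_cst_ge0 (ltW e0).
have bf l (M : 'M[R]_(k, l)) : bounded_mfun (fun y : l.-tuple R => f (M *m tcol y)).
  apply: (@test_fun_comp _ _ f _ _ (fun y : l.-tuple R => M *m tcol y) tf) => i.
  by under eq_fun do rewrite mulmx_linform; exact: measurable_linform.
have f01 w : 0 <= f w <= 1 := soft_box_ge0_le1 _ _ w (ltW e0).
have tS i : (\int[S]_y (tail B (tproj i y))%:E <= (m3 / B)%:E)%E.
  rewrite (@integral_std_normal _ _ S i (fun x => (tail B x)%:E))//.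
    exact: stdN_tail.
  by apply/measurable_EFinP; exact: measurable_tail.
have err := clt_smooth A stP (std_normal_standardized NS) C0 (ltW B0) tf sf tP tS.
set Err := \sum_i _ in err *.
have upP : ((\int[P]_y f (A *m tcol y))%:E <= P (lin_box A t))%E.
  apply: Rintegral_le_probability => //.
  - exact: measurable_lin_box.
  - exact: bf.
  move=> y /existsNP[j /negP]; rewrite -ltNge => tj.
  apply: (@soft_box_eq0 _ _ _ _ _ _ j) => //; rewrite mulmx_linform.
  have [l0|l0] := leP 0 (linform (A j) y).
    by right; rewrite ltW// -[ltRHS]ger0_norm.
  by left; rewrite lerNr ltW// -[ltRHS]ltr0_norm.
have loS : (S' (lin_box A' (t - 3 / e)) <= (\int[S']_y f (A' *m tcol y))%:E)%E.
  apply: probability_le_Rintegral => //.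
  - exact: measurable_lin_box.
  - exact: bf.
  - by move=> y; case/andP: (f01 (A' *m tcol y)).
  move=> y yb; rewrite /f soft_box_eq1// => j; rewrite mulmx_linform.
  by have := yb j; rewrite ler_norml opprB addrC.
have A'1 j : (A' *m A'^T) j j = 1 by rewrite AG.
have e3 : 0 < 3 / e by rewrite divr_gt0.
have tKe : t - 3 / e < K + eta by lra.
have := lin_box_anticoncentration NS' A'1 tKe.
move=> /(le_trans (SK _ eta0)) /le_trans/(_ (leeD2r _ loS)).
rewrite -EFinD lee_fin => low.
apply: le_trans upP; rewrite lee_fin.
move: err low; rewrite (Rintegral_gauss_eq (esym AG) NS NS' tf (smooth_taylor3 sf)).
move: (\int[P]_y _) (\int[S']_y _) => p s.
rewrite ler_norml => /andP[h _].
have -> : 4 * (K + eta - (t - 3 / e)) = 4 * (K + eta - t + 3 / e) by ring.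
lra.
Qed.

End gauss_approximation.

(** * A lower bound for the residual sum of squares *)

Section lln.
Context {R : realType} {n : nat}.
Variable P : probability (n.-tuple R) R.

Lemma measurable_tproj_comp (g : R -> R) i : measurable_fun setT g ->
  measurable_fun setT (fun y : n.-tuple R => g (tproj i y)).
Proof. by move=> mg; apply: (measurableT_comp mg); exact: measurable_tproj. Qed.

(* The squares need not have a variance: they are truncated at [B ^+ 2] before
   Chebyshev's inequality is applied. *)
Lemma sum_sqr_lower (B kappa zeta rho : R) (rest : n.-tuple R -> R) :
  standardized P -> 0 < B -> 0 < zeta -> (0 < n)%N ->
  (forall i, \int[P]_y (tail B (tproj i y))%:E <= kappa%:E)%E ->
  kappa <= zeta / 4 ->
  measurable_fun setT rest -> (forall y, 0 <= rest y) ->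
  (\int[P]_y (rest y)%:E <= rho%:E)%E ->
  (P [set y | \sum_i tproj i y ^+ 2 - rest y < (1 - zeta) * n%:R]%R <=
   (16 * B ^+ 4 / (zeta ^+ 2 * n%:R) + 2 * rho / (zeta * n%:R))%:E)%E.
Proof.
move=> stP B0 z0 n0 tP kz mrest rest0 Erest.
have [indP P1 P2] := stP.
have nR0 : 0 < n%:R :> R by rewrite ltr0n.
pose w (x : R) := Num.min (x ^+ 2) (B ^+ 2).
have mw : measurable_fun [set: R] w by apply: measurable_minr.
have w0 x : 0 <= w x by rewrite /w le_min !sqr_ge0.
have wB x : w x <= B ^+ 2 by rewrite /w ge_min lexx orbT.
have wx x : w x <= x ^+ 2 by rewrite /w ge_min lexx.
have bw i : bounded_mfun (fun y : n.-tuple R => w (tproj i y)).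
  by split; [exact: measurable_tproj_comp|exists (B ^+ 2) => y; rewrite ger0_norm].
pose m i := \int[P]_y w (tproj i y).
have i2 i : P.-integrable setT (EFin \o (fun y => tproj i y ^+ 2)).
  exact: (sqr_integrable_integrable (@measurable_tproj R n i) (P2 i)).1.
have m1 i : 1 - zeta / 4 <= m i.
  have [|it tle] := @ge0_Rintegral_le _ _ _ P (fun y => tail B (tproj i y)) kappa
    (measurable_tproj_comp i (measurable_tail B)) _ (tP i).
    by move=> y; exact: tail_ge0.
  have E1 : \int[P]_y (tproj i y ^+ 2) = 1 by rewrite /Rintegral P2.
  have iw := bounded_mfun_integrable P (bw i).
  have : \int[P]_y (tproj i y ^+ 2) <= \int[P]_y (w (tproj i y) + tail B (tproj i y)).
    apply: le_Rintegral => //.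
      rewrite (_ : _ \o _ = (EFin \o (fun y => w (tproj i y))) \+
        (EFin \o (fun y => tail B (tproj i y))))//.
      exact: integrableD.
    move=> y _; move: (tproj i y) => x; rewrite /tail; case: ifPn => [_|].
      by rewrite lerDr.
    rewrite -leNgt => xB; rewrite addr0 /w le_min lexx/=.
    by rewrite -(real_normK (num_real x)) lerXn2r// ?nnegrE// ltW.
  rewrite RintegralD// E1 -/(m i); lra.
pose V i x := w x - m i.
have m0 i : 0 <= m i by apply: Rintegral_ge0.
have mB i : m i <= B ^+ 2.
  rewrite -[leRHS](Rintegral_probability_cst P); apply: le_Rintegral => //.
  - exact: bounded_mfun_integrable.
  - exact: finite_measure_integrable_cst.
have VB i x : `|V i x| <= B ^+ 2.
  by rewrite /V ler_norml; have := w0 x; have := wB x; have := m0 i; have := mB i;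
    move=> *; apply/andP; split; lra.
have mV i : measurable_fun [set: R] (V i) by exact: measurable_funB.
have bV i : bounded_mfun (fun y : n.-tuple R => V i (tproj i y)).
  by split; [exact: measurable_tproj_comp|exists (B ^+ 2)].
have bV2 i : bounded_mfun (fun y : n.-tuple R => V i (tproj i y) ^+ 2).
  split; first by apply: measurable_funX; exact: (bV i).1.
  by exists (B ^+ 2 ^+ 2) => y; rewrite normrX lerXn2r ?nnegrE ?sqr_ge0.
pose v i := \int[P]_y (V i (tproj i y) ^+ 2).
have vB i : v i <= B ^+ 4.
  rewrite (_ : B ^+ 4 = B ^+ 2 ^+ 2); last by rewrite -exprM.
  rewrite -[leRHS](Rintegral_probability_cst P); apply: le_Rintegral => //.
  - exact: bounded_mfun_integrable.
  - exact: finite_measure_integrable_cst.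
  - move=> y _; rewrite -[leLHS](real_normK (num_real _)) lerXn2r ?nnegrE ?sqr_ge0//.
have EV : (\int[P]_y ((0 + \sum_i V i (tproj i y)) ^+ 2)%:E = (0 ^+ 2 + \sum_i v i)%:E)%E.
  apply: integral_sqr_sum_indep => //.
  - by move=> i; rewrite -EFin_Rintegral//; exact: bounded_mfun_integrable.
  - move=> i; rewrite -EFin_Rintegral//; last exact: bounded_mfun_integrable.
    rewrite RintegralB//; last 2 first.
    + exact: bounded_mfun_integrable.
    + exact: finite_measure_integrable_cst.
    by rewrite (Rintegral_probability_cst P) subrr.
(* The deficit [zeta * n%:R] is shared out: a quarter is the bias of truncation, since [m i] is at
   least [1 - zeta / 4], a quarter is left to fluctuations and a half, [2 * q], to [rest]. *)
pose q := zeta * n%:R / 4.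
have q0 : 0 < q by rewrite divr_gt0// mulr_gt0.
have mS : measurable_fun setT (fun y : n.-tuple R => \sum_i tproj i y ^+ 2).
  apply: measurable_sum => i; apply: measurable_funX; exact: measurable_tproj.
have mSV : measurable_fun setT (fun y : n.-tuple R => \sum_i V i (tproj i y)).
  apply: measurable_sum => i; exact: (bV i).1.
pose J (b : bool) : set (n.-tuple R) :=
  if b then (fun y => \sum_i V i (tproj i y)) @^-1` `]-oo, - q]
  else rest @^-1` `[2 * q, +oo[.
apply: (le_trans (@probability_le_sum _ _ _ P _ _ J _ _ _)).
- rewrite (_ : [set _ | _] = (fun y => \sum_i tproj i y ^+ 2 - rest y) @^-1` `]-oo, ((1 - zeta) * n%:R)[).
    rewrite -[X in measurable X]setTI.
    by apply: measurable_funB => //; exact: measurable_itv.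
  by apply/seteqP; split=> y /=; rewrite in_itv.
- case; rewrite /J -[X in measurable X]setTI.
    by apply: mSV => //; exact: measurable_itv.
  by apply: mrest => //; exact: measurable_itv.
- move=> y /= yz; have [Vq|Vq] := leP (\sum_i V i (tproj i y)) (- q).
    by exists true; rewrite /J/= in_itv.
  exists false; rewrite /J/= in_itv/= andbT.
  have : \sum_i V i (tproj i y) <= \sum_i (tproj i y ^+ 2 - (1 - zeta / 4)).
    by apply: ler_sum => i _; apply: lerB.
  rewrite [leRHS]sumrB sumr_const card_ord -[_ *+ n]mulr_natr.
  rewrite /q in Vq *; lra.
rewrite big_bool/= EFinD; apply: leeD.
- apply: (@le_trans _ _ (\int[P]_y (q ^- 2 * (0 + \sum_i V i (tproj i y)) ^+ 2)%:E)%E).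
    apply: probability_le_integral.
    + by rewrite -[X in measurable X]setTI; apply: mSV => //; exact: measurable_itv.
    + by apply: measurable_funM => //; apply: measurable_funX; exact: measurable_funD.
    + by move=> y; rewrite mulr_ge0 ?sqr_ge0// invr_ge0 exprn_ge0// ltW.
    + move=> y /=; rewrite in_itv/= add0r => Vq; rewrite ler_pdivlMl ?exprn_gt0// mulr1.
      by rewrite -[leRHS]sqrrN lerXn2r ?nnegrE ?(ltW q0)//; lra.
  under eq_integral do rewrite EFinM.
  rewrite ge0_integralZl//; last 3 first.
  + by apply/measurable_EFinP/measurable_funX; exact: measurable_funD.
  + by move=> y _; rewrite lee_fin sqr_ge0.
  + by rewrite lee_fin invr_ge0 exprn_ge0// ltW.
  rewrite EV -EFinM lee_fin expr0n/= add0r ler_pdivrMl ?exprn_gt0//.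
  apply: (@le_trans _ _ (\sum_(i < n) B ^+ 4)); first by apply: ler_sum.
  rewrite sumr_const card_ord -mulr_natr le_eqVlt; apply/orP; left; apply/eqP.
  by rewrite /q; field; rewrite !gt_eqF.
- apply: (@le_trans _ _ (\int[P]_y ((2 * q)^-1 * rest y)%:E)%E).
    apply: probability_le_integral.
    + by rewrite -[X in measurable X]setTI; apply: mrest => //; exact: measurable_itv.
    + exact: measurable_funM.
    + by move=> y; rewrite mulr_ge0// invr_ge0 mulr_ge0// ltW.
    + by move=> y /=; rewrite in_itv/= andbT => qr; rewrite ler_pdivlMl ?mulr_gt0// mulr1.
  under eq_integral do rewrite EFinM.
  rewrite ge0_integralZl//; last 3 first.
  + exact/measurable_EFinP.
  + by move=> y _; rewrite lee_fin.
  + by rewrite lee_fin invr_ge0 mulr_ge0// ltW.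
  have -> : 2 * rho / (zeta * n%:R) = (2 * q)^-1 * rho.
    by rewrite /q; field; rewrite !gt_eqF.
  rewrite EFinM; apply: lee_wpmul2l => //.
  by rewrite lee_fin invr_ge0 mulr_ge0// ltW.
Qed.

End lln.

(** * Projections and residuals *)

Section projection.
Context {R : realType} {n : nat}.
Implicit Types (v w : 'cV[R]_n).

Definition sqnorm v : R := \sum_i v i ord0 ^+ 2.

Lemma sqnormE v : sqnorm v = (v^T *m v) ord0 ord0.
Proof. by rewrite mxE; apply: eq_bigr => i _; rewrite mxE expr2. Qed.

Lemma sqnorm_ge0 v : 0 <= sqnorm v.
Proof. by apply: sumr_ge0 => i _; exact: sqr_ge0. Qed.

Lemma sqnormZ a v : sqnorm (a *: v) = a ^+ 2 * sqnorm v.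
Proof. by rewrite mulr_sumr; apply: eq_bigr => i _; rewrite mxE exprMn. Qed.

Lemma sqnormD v w : sqnorm (v + w) = sqnorm v + 2 * (v^T *m w) ord0 ord0 + sqnorm w.
Proof.
rewrite mxE mulr_sumr -!big_split; apply: eq_bigr => i _ /=.
by rewrite !mxE; ring.
Qed.

Lemma sqnorm_eq0 v : sqnorm v = 0 -> v = 0.
Proof.
move=> v0; apply/colP => i; rewrite mxE; apply/eqP; rewrite -sqrf_eq0.
move/eqP: v0; rewrite psumr_eq0 => [/allP/(_ i)|j _]; last exact: sqr_ge0.
by rewrite mem_index_enum; exact.
Qed.

Variable H : 'M[R]_n.
Hypotheses (symH : H^T = H) (idemH : H *m H = H).

(** As the inverse of 0 is 0, the direction of the null vector is null. A model without bias thus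
    needs no separate treatment, at the price of a norm at most 1 instead of equal to 1. *)
Definition direction v := (Num.sqrt (sqnorm v))^-1 *: v.

Lemma sqnorm_direction v : sqnorm (direction v) <= 1.
Proof.
rewrite sqnormZ exprVn sqr_sqrtr ?sqnorm_ge0//.
have [->|v0] := eqVneq (sqnorm v) 0; first by rewrite mulr0.
by rewrite mulVf.
Qed.

Lemma directionK v : v = Num.sqrt (sqnorm v) *: direction v.
Proof.
have [v0|v0] := eqVneq (sqnorm v) 0.
  by rewrite v0 sqrtr0 scale0r; exact: sqnorm_eq0.
rewrite scalerA divff ?scale1r// gt_eqF// sqrtr_gt0 lt_neqAle eq_sym v0.
exact: sqnorm_ge0.
Qed.

(* Only the component of [e] along the direction of the bias [(1 - H) mu] can
   decrease the residual sum of squares. *)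
Lemma sqnorm_residual_ge (mu e : 'cV[R]_n) (s : R) :
  let b := (1%:M - H) *m mu in
  s ^+ 2 * (sqnorm e - (sqnorm (H *m e) + ((direction b)^T *m e) ord0 ord0 ^+ 2)) <=
  sqnorm ((1%:M - H) *m (mu + s *: e)).
Proof.
move=> /=; set b := (1%:M - H) *m mu; pose J := 1%:M - H.
have symJ : J^T = J by rewrite /J linearB/= trmx1 symH.
have idemJ : J *m J = J.
  by rewrite /J mulmxBr mulmx1 mulmxBl mul1mx idemH subrr subr0.
have JE : sqnorm (J *m e) = sqnorm e - sqnorm (H *m e).
  have eE : e = J *m e + H *m e by rewrite -mulmxDl subrK mul1mx.
  have HJ : (J *m e)^T *m (H *m e) = 0.
    rewrite trmx_mul symJ -mulmxA [J *m _]mulmxA /J mulmxBl mul1mx idemH subrr.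
    by rewrite mul0mx mulmx0.
  by rewrite [in X in X - _]eE sqnormD HJ mxE mulr0 addr0 addrK.
have bE : J *m b = b by rewrite /b mulmxA idemJ.
rewrite -/J mulmxDr -scalemxAr -/b sqnormD sqnormZ JE -scalemxAr.
have sE (M : 'M[R]_1) a : (a *: M) ord0 ord0 = a * M ord0 ord0 by rewrite mxE.
rewrite sE.
have -> : (b^T *m (J *m e)) ord0 ord0 =
    Num.sqrt (sqnorm b) * ((direction b)^T *m e) ord0 ord0.
  rewrite mulmxA -[J]symJ -trmx_mul bE {1}(directionK b) linearZ/= -scalemxAl.
  by rewrite sE.
have := sqr_sqrtr (sqnorm_ge0 b); move: (Num.sqrt _) ((direction b)^T *m e) => c ue cE.
rewrite -cE; move: (ue ord0 ord0) => x.
(* Completing the square: bias and cross term contribute [c ^+ 2 + 2 * s * c * x], which is at least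
   [- (s * x) ^+ 2] whatever the size [c] of the bias. *)
have := sqr_ge0 (c + s * x); lra.
Qed.

End projection.

Section hat_matrix.
Context {R : realType} {n m : nat}.
Variable X : 'M[R]_(n, m).
Hypothesis Xunit : X^T *m X \in unitmx.

Let G := invmx (X^T *m X).

Definition hat_mx := X *m G *m X^T.

Lemma trmx_gram_inv : G^T = G.
Proof. by rewrite /G trmx_inv trmx_mul trmxK. Qed.

Lemma trmx_hat : hat_mx^T = hat_mx.
Proof. by rewrite /hat_mx !trmx_mul trmxK trmx_gram_inv mulmxA. Qed.

Lemma hat_idem : hat_mx *m hat_mx = hat_mx.
Proof.
rewrite (_ : _ *m _ = X *m (G *m (X^T *m X)) *m G *m X^T).
  by rewrite mulVmx// mulmx1.
by rewrite /hat_mx !mulmxA.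
Qed.

(** The sum is the trace of [hat_mx *m hat_mx^T], that is of an orthogonal projection of rank [m].
    It is the expected energy of standardized noise in the fitted space. *)
Lemma sum_sqr_hat : \sum_i \sum_j hat_mx i j ^+ 2 = m%:R.
Proof.
transitivity (\tr (hat_mx *m hat_mx^T)).
  apply: eq_bigr => i _; rewrite [RHS]mxE; apply: eq_bigr => j _.
  by rewrite [X in _ = _ * X]mxE expr2.
by rewrite trmx_hat hat_idem /hat_mx mxtrace_mulC mulmxA mulmxV// mxtrace1.
Qed.

End hat_matrix.

(** * Standardization of the data *)

Section normalization.
Context {R : realType} {n : nat}.
Implicit Types (P : probability (n.-tuple R) R).

Definition recenter (mu : 'cV[R]_n) (s : R) (y : n.-tuple R) : n.-tuple R :=
  [tuple (tproj i y - mu i ord0) / s | i < n].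

Lemma tproj_recenter mu s y i :
  tproj i (recenter mu s y) = (tproj i y - mu i ord0) / s.
Proof. by rewrite [LHS]tnth_mktuple. Qed.

Lemma measurable_recenter mu s : measurable_fun setT (recenter mu s).
Proof.
apply/measurable_fun_tnthP => i.
rewrite (_ : _ \o _ = fun y => (tproj i y - mu i ord0) / s); last first.
  by apply/funext => y; rewrite -tproj_recenter.
apply: measurable_funM => //; apply: measurable_funB => //; exact: measurable_tproj.
Qed.

Lemma tail_le_powR (B x delta : R) : 0 < B -> 0 < delta ->
  tail B x <= (B `^ delta)^-1 * `|x| `^ (2 + delta).
Proof.
move=> B0 d0; rewrite /tail; case: ifPn => [Bx|_]; last first.
  by rewrite mulr_ge0 ?invr_ge0 ?powR_ge0.
have x0 : 0 < `|x| := lt_trans B0 Bx.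
rewrite ler_pdivlMl ?powR_gt0// powRD; last by apply/implyP => _; rewrite gt_eqF.
rewrite [`|x| `^ 2](powR_mulrn 2 (normr_ge0 x)) real_normK ?num_real// mulrC.
rewrite ler_wpM2l ?sqr_ge0// ge0_ler_powR ?nnegrE ?(ltW d0)//; exact: ltW.
Qed.

Lemma moment_le (delta tau s2 : R) (E : \bar R) : 0 < delta -> 0 <= tau -> 0 < s2 ->
  (0 <= E)%E -> (E `^ (2 / (2 + delta)) <= (tau * s2)%:E)%E ->
  (E <= ((tau * s2) `^ (1 + delta / 2))%:E)%E.
Proof.
move=> d0 t0 s0 E0 h.
have h2 : 0 < 1 + delta / 2 by lra.
have -> : E = ((E `^ (2 / (2 + delta))) `^ (1 + delta / 2))%E.
  rewrite -poweRrM (_ : _ * _ = 1) ?poweRe1//; field; lra.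
rewrite -poweR_EFin; apply: gt0_ler_poweR => //; first exact: ltW.
- by rewrite in_itv/= poweR_ge0 leey.
- by rewrite in_itv/= lee_fin mulr_ge0 ?(ltW s0)// leey.
Qed.

Lemma lm_class_recenter P (delta tau : R) : 0 < delta -> 1 <= tau ->
  lm_class delta tau P ->
  exists s (Q : probability (n.-tuple R) R), [/\ 0 < s,
    law P (recenter (mean P) s) Q, standardized Q &
    forall B i, 0 < B ->
      (\int[Q]_y (tail B (tproj i y))%:E <= (tau `^ (1 + delta / 2) / B `^ delta)%:E)%E].
Proof.
move=> d0 tau1 [indP [s2 [s20 varP momP]]].
pose s := Num.sqrt s2; have s0 : 0 < s by rewrite sqrtr_gt0.
have ss : s ^+ 2 = s2 by rewrite sqr_sqrtr// ltW.
have mr := measurable_recenter (mean P) s.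
pose rm : {mfun _ >-> _} := HB.pack (recenter (mean P) s) (isMeasurableFun.Build _ _ _ _ _ mr).
pose Q : probability _ R := distribution P rm.
have PQ : law P (recenter (mean P) s) Q by [].
pose z i (y : n.-tuple R) := tproj i y - mean P i ord0.
have mz i : measurable_fun setT (z i).
  by apply: measurable_funB => //; exact: measurable_tproj.
have Ez2 i : (\int[P]_y (z i y ^+ 2)%:E = s2%:E)%E.
  rewrite -(varP i) /variance unlock/= unlock; apply: eq_integral => y _.
  by rewrite /z /mean mxE unlock expr2.
have iz i := (sqr_integrable_integrable (mz i) (Ez2 i)).2.
have ic c : P.-integrable setT (EFin \o cst c) by exact: finite_measure_integrable_cst.
have iy i : P.-integrable setT (EFin \o tproj i).
  rewrite (_ : _ \o _ = (EFin \o z i) \+ (EFin \o cst (mean P i ord0))).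
    exact: integrableD.
  by apply/funext => y /=; rewrite -EFinD /z subrK.
have Ez i : (\int[P]_y (z i y)%:E = 0)%E.
  rewrite -EFin_Rintegral//; congr EFin.
  rewrite RintegralB//; last exact: ic.
  rewrite Rintegral_cst// [X in fine X]probability_setT mulr1 /mean mxE /Rintegral.
  by rewrite unlock subrr.
have tr i y : tproj i (recenter (mean P) s y) = z i y / s by rewrite tproj_recenter.
have mtp i (g : R -> R) : measurable_fun setT g ->
    measurable_fun setT (fun y : n.-tuple R => (g (tproj i y))%:E).
  by move=> mg; apply/measurable_EFinP; exact: measurable_tproj_comp.
exists s, Q; split=> //.
  split.
  - move=> J B mB; rewrite PQ; last exact: measurable_rect.
    have mg i : measurable_fun [set: R] (fun x => (x - mean P i ord0) / s).
      by apply: measurable_funM => //; exact: measurable_funB.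
    have -> : recenter (mean P) s @^-1` (\bigcap_(i in [set` J]) tproj i @^-1` B i) =
        \bigcap_(i in [set` J]) tproj i @^-1` ((fun x => (x - mean P i ord0) / s) @^-1` B i).
      by apply/seteqP; split=> y yB i iJ; have := yB i iJ; rewrite /= tproj_recenter.
    rewrite indP; last by move=> i; rewrite -[X in measurable X]setTI; exact: mg.
    apply: eq_bigr => i _; rewrite PQ; last exact: measurable_tproj_preimage.
    by congr (P _); apply/seteqP; split=> y /=; rewrite tproj_recenter.
  - move=> i; rewrite (integral_law mr PQ); last exact: (mtp i id).
    under eq_integral do rewrite tr mulrC EFinM.
    rewrite integralZl//; last exact: (iz i).
    by rewrite [X in (_ * X)%E](Ez i) mule0.
  - move=> i; rewrite (integral_law mr PQ); last exact: (mtp i (fun x => x ^+ 2)).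
    under eq_integral do rewrite tr mulrC exprMn EFinM.
    rewrite ge0_integralZl//; last 3 first.
    + by apply/measurable_EFinP/measurable_funX; exact: mz.
    + by move=> y _; rewrite lee_fin sqr_ge0.
    + by rewrite lee_fin sqr_ge0.
    by rewrite [X in (_ * X)%E](Ez2 i) -EFinM exprVn ss mulVf// gt_eqF.
move=> B i B0.
rewrite (integral_law mr PQ); last exact: (mtp i _ (measurable_tail B)).
have mp : measurable_fun setT (fun y => `|z i y| `^ (2 + delta)).
  apply: (measurableT_comp (measurable_powR (2 + delta))).
  by apply: measurableT_comp => //; exact: mz.
have tau0 : 0 <= tau by lra.
have mom : (\int[P]_y (`|z i y| `^ (2 + delta))%:E <= ((tau * s2) `^ (1 + delta / 2))%:E)%E.
  apply: (moment_le d0 tau0 s20).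
    by apply: integral_ge0 => y _; rewrite lee_fin powR_ge0.
  by have := momP i; rewrite unlock.
have sd : 0 < s `^ (2 + delta) by rewrite powR_gt0.
apply: (@le_trans _ _ (((B `^ delta)^-1 / s `^ (2 + delta))%:E * \int[P]_y (`|z i y| `^ (2 + delta))%:E)%E).
  rewrite -ge0_integralZl//; last 2 first.
  - exact/measurable_EFinP.
  - by rewrite lee_fin divr_ge0 ?invr_ge0 ?powR_ge0.
  apply: ge0_le_integral => //.
  - by move=> y _; rewrite lee_fin tail_ge0.
  - apply/measurable_EFinP; apply: (measurableT_comp (measurable_tail B)).
    by under eq_fun do rewrite tr; exact: measurable_funM.
  - by apply/measurable_EFinP; exact: measurable_funM.
  move=> y _; rewrite -EFinM lee_fin tr (le_trans (tail_le_powR _ B0 d0))//.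
  rewrite normrM normfV (gtr0_norm s0) powRM ?invr_ge0 ?(ltW s0)//.
  rewrite [s^-1 `^ _](_ : _ = (s `^ (2 + delta))^-1); last first.
    by rewrite -[s^-1]powR_inv1 ?(ltW s0)// -powRrM mulN1r powRN.
  by rewrite le_eqVlt; apply/orP; left; apply/eqP; ring.
apply: (le_trans (lee_wpmul2l _ mom)).
  by rewrite lee_fin divr_ge0 ?invr_ge0 ?powR_ge0.
rewrite -EFinM lee_fin powRM ?(ltW s20)//.
have -> : s2 `^ (1 + delta / 2) = s `^ (2 + delta).
  by rewrite -ss -[s ^+ 2]powR_mulrn ?(ltW s0)// -powRrM; congr (_ `^ _); field.
by rewrite le_eqVlt; apply/orP; left; apply/eqP; field; rewrite !gt_eqF ?powR_gt0.
Qed.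

End normalization.

(** * Least-squares coefficients of submodels *)

(** Lagrange's identity: the defect is half of the displayed double sum of squares. *)
Lemma sum_CauchySchwarz (R : realType) (I : finType) (a b : I -> R) :
  (\sum_i a i * b i) ^+ 2 <= (\sum_i a i ^+ 2) * (\sum_i b i ^+ 2).
Proof.
have : 0 <= \sum_i \sum_j (a i * b j - a j * b i) ^+ 2.
  by apply: sumr_ge0 => i _; apply: sumr_ge0 => j _; exact: sqr_ge0.
have -> : \sum_i \sum_j (a i * b j - a j * b i) ^+ 2 =
    2 * ((\sum_i a i ^+ 2) * (\sum_i b i ^+ 2)) - 2 * (\sum_i a i * b i) ^+ 2.
  transitivity (\sum_i \sum_j (a i ^+ 2 * b j ^+ 2) + \sum_i \sum_j (b i ^+ 2 * a j ^+ 2)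
     - 2 * \sum_i \sum_j (a i * b i) * (a j * b j)).
    rewrite mulr_sumr -big_split -sumrB; apply: eq_bigr => i _ /=.
    rewrite mulr_sumr -big_split -sumrB; apply: eq_bigr => j _ /=; ring.
  rewrite -!big_distrlr/= [X in _ + X - _]mulrC expr2; ring.
lra.
Qed.

Section submodels.
Context {R : realType} {n p : nat}.
Variable X : 'M[R]_(n, p).
Hypothesis rankX : \rank X = p.
Implicit Types M : {set 'I_p}.

Lemma submodel_inj M (v : 'cV[R]_#|M|) : submodel X M *m v = 0 -> v = 0.
Proof.
move=> Xv; pose S : 'M[R]_(p, #|M|) := colsub (fun j : 'I_#|M| => enum_val j) 1%:M.
have XS : submodel X M = X *m S by rewrite /S mulmx_colsub mulmx1.
have Sv : S *m v = 0.
  have XTfree : row_free X^T by rewrite /row_free mxrank_tr rankX.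
  apply: trmx_inj; apply: (row_free_inj XTfree).
  by rewrite trmx0 mul0mx -trmx_mul mulmxA -XS Xv trmx0.
apply/colP => j; have /colP/(_ (enum_val j)) := Sv.
rewrite !mxE (bigD1 j)//= big1 => [|i ij]; last first.
  rewrite !mxE; case: eqP => [/enum_val_inj ji|]; last by rewrite mul0r.
  by rewrite ji eqxx in ij.
by rewrite !mxE eqxx mul1r addr0.
Qed.

Lemma gram_unit M : (submodel X M)^T *m submodel X M \in unitmx.
Proof.
rewrite -row_free_unit -kermx_eq0; set G := _ *m _; apply/eqP/row_matrixP => i.
rewrite row0; set u := row i _.
have uG : u *m G = 0 by rewrite -row_mul mulmx_ker row0.
apply: trmx_inj; rewrite trmx0; apply: submodel_inj; apply: sqnorm_eq0.
rewrite sqnormE trmx_mul trmxK -mulmxA [(submodel X M)^T *m _]mulmxA -/G mulmxA uG.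
by rewrite mul0mx mxE.
Qed.

Definition coef_mx M : 'M[R]_(#|M|, n) := gram_inv X M *m (submodel X M)^T.

Lemma coef_mx_gram M : coef_mx M *m (coef_mx M)^T = gram_inv X M.
Proof.
rewrite /coef_mx trmx_mul trmxK trmx_gram_inv -mulmxA [_^T *m _]mulmxA.
by rewrite mulmxV ?gram_unit// mulmx1.
Qed.

Lemma coef_mx_hat M : coef_mx M *m hat_mx (submodel X M) = coef_mx M.
Proof.
rewrite /coef_mx /hat_mx -!mulmxA; congr (_ *m _); rewrite !mulmxA.
by rewrite mulmxV ?gram_unit// mul1mx.
Qed.

Lemma sum_sqr_coef_mx M j : \sum_l coef_mx M j l ^+ 2 = gram_inv X M j j.
Proof.
by rewrite -[in RHS]coef_mx_gram [RHS]mxE; apply: eq_bigr => l _; rewrite [X in _ = _ * X]mxE expr2.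
Qed.

Lemma gram_inv_gt0 M j : 0 < gram_inv X M j j.
Proof.
rewrite -sum_sqr_coef_mx lt_neqAle eq_sym; apply/andP; split; last first.
  by apply: sumr_ge0 => l _; exact: sqr_ge0.
apply/negP => /eqP h; have c0 l : coef_mx M j l = 0.
  apply/eqP; rewrite -sqrf_eq0; move/eqP: h; rewrite psumr_eq0 => [/allP/(_ l)|? _]; last exact: sqr_ge0.
  by rewrite mem_index_enum; exact.
have : (coef_mx M *m submodel X M) j j = 1.
  by rewrite /coef_mx -mulmxA mulVmx ?gram_unit// mxE eqxx.
rewrite mxE big1 => [/eqP|l _]; last by rewrite c0 mul0r.
by rewrite eq_sym oner_eq0.
Qed.

Lemma hat_mx_diag M l : hat_mx (submodel X M) l l =
  (row l (submodel X M) *m gram_inv X M *m (row l (submodel X M))^T) ord0 ord0.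
Proof.
rewrite /hat_mx -row_mul [RHS]mxE [LHS]mxE; apply: eq_bigr => j _.
by rewrite !mxE.
Qed.

Lemma hat_mx_diag_le M l : hat_mx (submodel X M) l l <= max_leverage X M.
Proof. by rewrite hat_mx_diag /max_leverage; exact: (le_bigmax _ (fun i => _)). Qed.

(** By [coef_mx_hat] the entry is the inner product of row [j] of [coef_mx M], of squared norm
    [gram_inv X M j j], with column [l] of the hat matrix, whose squared norm is its diagonal entry
    by idempotence: the leverage of observation [l]. *)
Lemma sqr_coef_mx_le M j l : coef_mx M j l ^+ 2 <= gram_inv X M j j * max_leverage X M.
Proof.
have hU := gram_unit M.
rewrite -[in X in X ^+ 2]coef_mx_hat mxE.
apply: le_trans (sum_CauchySchwarz _ _) _; rewrite sum_sqr_coef_mx.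
rewrite ler_wpM2l//; first exact/ltW/gram_inv_gt0.
apply: le_trans (hat_mx_diag_le M l).
rewrite -[in leRHS](hat_idem hU) mxE le_eqVlt; apply/orP; left; apply/eqP.
apply: eq_bigr => i _; rewrite expr2; congr (_ * _).
by rewrite -[in LHS](trmx_hat (submodel X M)) mxE.
Qed.

Variables (d : nat) (Ms : 'I_d -> {set 'I_p}).

(* The rows map the standardized noise to the errors of the coefficient
   estimators, divided by their standard deviations. *)
Definition studentized_mx : 'M[R]_(\sum_(s < d) #|Ms s|, n) :=
  \mxcol_(s < d) (\matrix_(j, l) (coef_mx (Ms s) j l / Num.sqrt (gram_inv X (Ms s) j j))).

Lemma studentized_mxE s j : exists i, forall l, studentized_mx i l =
  coef_mx (Ms s) j l / Num.sqrt (gram_inv X (Ms s) j j).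
Proof.
exists (tagnat.Rank s j) => l.
have := mxcolK (fun s => \matrix_(j, l) (coef_mx (Ms s) j l / Num.sqrt (gram_inv X (Ms s) j j))) s.
by move=> /matrixP/(_ j l); rewrite !mxE.
Qed.

Lemma studentized_mx_gram : studentized_mx *m studentized_mx^T = corr (ls_cov 1 X Ms).
Proof.
have covE (s t : 'I_d) j j' : \sum_l coef_mx (Ms s) j l * coef_mx (Ms t) j' l =
    (1 *: (gram_inv X (Ms s) *m (submodel X (Ms s))^T *m
                submodel X (Ms t) *m gram_inv X (Ms t))) j j'.
  transitivity ((coef_mx (Ms s) *m (coef_mx (Ms t))^T) j j').
    by rewrite [RHS]mxE; apply: eq_bigr => l _; rewrite [X in _ = _ * X]mxE.
  by rewrite scale1r /coef_mx [(_ *m _)^T]trmx_mul trmxK trmx_gram_inv !mulmxA.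
have diagE i : ls_cov 1 X Ms i i =
    gram_inv X (Ms (tagnat.sig1 i)) (tagnat.sig2 i) (tagnat.sig2 i).
  rewrite mxE -covE -sum_sqr_coef_mx; apply: eq_bigr => l _; by rewrite expr2.
apply/matrixP => i i'; rewrite [RHS]mxE !diagE [in RHS]mxE -covE mxE mulr_suml.
apply: eq_bigr => l _; rewrite !mxE invfM; ring.
Qed.

Lemma studentized_mx_diag i : (studentized_mx *m studentized_mx^T) i i = 1.
Proof.
rewrite mxE; set s := tagnat.sig1 i; set j := tagnat.sig2 i.
have g0 := gram_inv_gt0 (M := Ms s) j.
transitivity (\sum_l coef_mx (Ms s) j l ^+ 2 / gram_inv X (Ms s) j j).
  apply: eq_bigr => l _; rewrite !mxE -/s -/j -expr2 exprMn exprVn sqr_sqrtr//.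
  exact: ltW.
by rewrite -mulr_suml sum_sqr_coef_mx divff// gt_eqF.
Qed.

Lemma studentized_mx_le L i l : (forall s, max_leverage X (Ms s) <= L) ->
  studentized_mx i l ^+ 2 <= L.
Proof.
move=> hL; rewrite !mxE; set s := tagnat.sig1 i; set j := tagnat.sig2 i.
have g0 := gram_inv_gt0 (M := Ms s) j.
rewrite exprMn exprVn sqr_sqrtr ?(ltW g0)// ler_pdivrMr// [leRHS]mulrC.
rewrite (_ : \sum_j0 _ = coef_mx (Ms s) j l); last by rewrite mxE.
by apply: le_trans (sqr_coef_mx_le _ _) _; rewrite ler_wpM2l ?(ltW g0).
Qed.

Lemma norm1_col_studentized_le L l : 0 <= L -> (forall s, max_leverage X (Ms s) <= L) ->
  norm1 (col l studentized_mx) <= (\sum_(s < d) #|Ms s|)%:R * Num.sqrt L.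
Proof.
move=> L0 hL; rewrite /norm1 mulr_natl -[X in _ *+ X]card_ord -sumr_const.
apply: ler_sum => i _; rewrite mxE -sqrtr_sqr ler_sqrt//.
exact: studentized_mx_le.
Qed.

(** The rows are unit vectors, so the squared entries add up to their number; passing to [norm1] by
    Cauchy-Schwarz costs the same factor once more. In Lindeberg's error this sum stays bounded
    while one extra power of the column norm tends to 0. *)
Lemma sum_sqr_norm1_col_studentized :
  \sum_l norm1 (col l studentized_mx) ^+ 2 <= (\sum_(s < d) #|Ms s|)%:R ^+ 2.
Proof.
set k := (\sum_(s < d) #|Ms s|)%N.
apply: (@le_trans _ _ (\sum_l k%:R * \sum_(i < k) studentized_mx i l ^+ 2)).
  apply: ler_sum => l _.
  have := sum_CauchySchwarz (fun=> 1) (fun i : 'I_k => `|studentized_mx i l|).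
  rewrite /norm1.
  under eq_bigr do rewrite mul1r; under [X in _ <= X * _]eq_bigr do rewrite expr1n.
  under [X in _ <= _ * X]eq_bigr do rewrite real_normK ?num_real//.
  by rewrite sumr_const card_ord; under [X in _ -> X ^+ 2 <= _]eq_bigr do rewrite mxE.
rewrite -mulr_sumr exchange_big/= expr2 ler_wpM2l//.
rewrite -[leRHS]mulr1 mulr_natl -[X in _ *+ X]card_ord -sumr_const.
apply: ler_sum => i _; rewrite -(studentized_mx_diag i) mxE.
by under [leRHS]eq_bigr do rewrite [X in _ * X]mxE -expr2.
Qed.

End submodels.

(** * Coverage *)

Lemma tcol_recenter (R : realType) n (mu : 'cV[R]_n) (s : R) (y : n.-tuple R) :
  s != 0 -> tcol y = mu + s *: tcol (recenter mu s y).
Proof.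
move=> s0; apply/colP => i; rewrite !mxE.
by rewrite -[tnth (recenter _ _ _) _]/(tproj i _) tproj_recenter mulrC divfK// addrC subrK.
Qed.

Section coverage.
Context {R : realType} {n p : nat}.
Variable X : 'M[R]_(n, p).
Hypothesis rankX : \rank X = p.
Implicit Types (M : {set 'I_p}) (mu : 'cV[R]_n) (y z : n.-tuple R).

(* The part of the squared norm of the noise [z] that the fitted model and the
   direction of its bias can absorb. *)
Definition misfit M mu z : R :=
  let H := hat_mx (submodel X M) in
  sqnorm (H *m tcol z) +
  ((direction ((1%:M - H) *m mu))^T *m tcol z) ord0 ord0 ^+ 2.

Lemma misfitE M mu z : let H := hat_mx (submodel X M) in
  misfit M mu z = \sum_i linform (H i) z ^+ 2 +
    linform ((direction ((1%:M - H) *m mu))^T ord0) z ^+ 2.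
Proof.
rewrite /misfit mulmx_linform; congr (_ + _).
by apply: eq_bigr => i _; rewrite mulmx_linform.
Qed.

Lemma misfit_ge0 M mu z : 0 <= misfit M mu z.
Proof. by rewrite addr_ge0 ?sqnorm_ge0 ?sqr_ge0. Qed.

Lemma measurable_misfit M mu : measurable_fun setT (misfit M mu).
Proof.
rewrite (_ : misfit M mu = fun z => misfit M mu z)//; under eq_fun do rewrite misfitE.
apply: measurable_funD; last by apply: measurable_funX; exact: measurable_linform.
by apply: measurable_sum => i; apply: measurable_funX; exact: measurable_linform.
Qed.

Lemma integral_misfit_le (Q : probability (n.-tuple R) R) M mu : standardized Q ->
  (\int[Q]_z (misfit M mu z)%:E <= (#|M|%:R + 1)%:E)%E.
Proof.
move=> stdQ; set H := hat_mx (submodel X M).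
set b := direction ((1%:M - H) *m mu).
under eq_integral do rewrite misfitE EFinD -sumEFin.
have mlin (u : 'I_n -> R) : measurable_fun setT (fun z => (linform u z ^+ 2)%:E).
  by apply/measurable_EFinP; apply: measurable_funX; exact: measurable_linform.
rewrite ge0_integralD//=; last 3 first.
- by move=> z _; apply: sume_ge0 => i _; rewrite lee_fin sqr_ge0.
- by apply: emeasurable_sum => i; exact: mlin.
- by move=> z _; rewrite lee_fin sqr_ge0.
rewrite ge0_integral_sum//=; last by move=> i z _; rewrite lee_fin sqr_ge0.
under eq_bigr do rewrite integral_linform_sqr//.
rewrite integral_linform_sqr// sumEFin -EFinD lee_fin sum_sqr_hat ?gram_unit//.
rewrite lerD2l; apply: le_trans (sqnorm_direction ((1%:M - H) *m mu)).
by rewrite le_eqVlt; apply/orP; left; apply/eqP; apply: eq_bigr => i _; rewrite mxE.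
Qed.

Lemma sigma2_hatE M y : sigma2_hat X M y =
  (n%:R - #|M|%:R)^-1 * sqnorm ((1%:M - hat_mx (submodel X M)) *m tcol y).
Proof.
congr (_ * _); apply: eq_bigr => i _; congr (_ ^+ 2).
rewrite mulmxBl mul1mx [RHS]mxE [X in _ = X + _]mxE [X in _ = _ + X]mxE; congr (_ - _).
by rewrite /beta_hat /ls_coef /hat_mx !mulmxA -!row_mul [LHS]mxE.
Qed.

(** Dividing by [n%:R - #|M|%:R] rather than [n%:R] can only increase the estimator, so the
    correction for degrees of freedom goes in the favorable direction. *)
Lemma sigma2_hat_ge M mu (s zeta : R) y : (#|M| < n)%N -> 0 < s -> zeta <= 1 ->
  (1 - zeta) * n%:R <= sqnorm (tcol (recenter mu s y)) - misfit M mu (recenter mu s y) ->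
  s ^+ 2 * (1 - zeta) <= sigma2_hat X M y.
Proof.
move=> Mn s0 z1 hz; rewrite sigma2_hatE [leRHS]mulrC.
have Mn0 : 0 < n%:R - #|M|%:R :> R by rewrite subr_gt0 ltr_nat.
rewrite ler_pdivlMr// [in leRHS](tcol_recenter mu y (lt0r_neq0 s0)).
have hU := gram_unit rankX M.
apply: le_trans (sqnorm_residual_ge (trmx_hat _) (hat_idem hU) _ _ _) => /=.
rewrite -mulrA ler_wpM2l ?sqr_ge0//; apply: le_trans hz.
by rewrite ler_wpM2l ?subr_ge0// gerBl.
Qed.

Lemma beta_hat_error M mu (s : R) y j : s != 0 ->
  beta_hat X M y j ord0 - ls_coef X M mu j ord0 =
  s * linform (coef_mx X M j) (recenter mu s y).
Proof.
move=> s0; rewrite /beta_hat (tcol_recenter mu y s0) /ls_coef mulmxDr.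
rewrite -scalemxAr [X in X - _]mxE [X in _ + X - _]mxE addrAC subrr add0r.
by rewrite mulmx_linform.
Qed.

Lemma measurable_sigma2_hat M : measurable_fun setT (sigma2_hat X M).
Proof.
rewrite (_ : sigma2_hat X M = fun y => sigma2_hat X M y)//; under eq_fun do rewrite sigma2_hatE.
apply: measurable_funM => //; under eq_fun do rewrite /sqnorm.
apply: measurable_sum => i; apply: measurable_funX.
under eq_fun do rewrite mulmx_linform; exact: measurable_linform.
Qed.

Variables (d : nat) (Ms : 'I_d -> {set 'I_p}) (alpha : R).

Local Notation K := (normal_quantile (1 - alpha) (corr (ls_cov 1 X Ms))).

Lemma conf_intP (s : 'I_d) y (j : 'I_#|Ms s|) x : conf_int X alpha y j x <->
  `|beta_hat X (Ms s) y j ord0 - x| <=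
  Num.sqrt (sigma2_hat X (Ms s) y * gram_inv X (Ms s) j j) * K.
Proof.
rewrite /conf_int /= in_itv/= ler_norml; split=> /andP[? ?]; apply/andP; split; lra.
Qed.

Lemma measurable_conf_int (s : 'I_d) (j : 'I_#|Ms s|) x :
  measurable [set y | conf_int X alpha y j x].
Proof.
pose f y := Num.sqrt (sigma2_hat X (Ms s) y * gram_inv X (Ms s) j j) * K -
  `|beta_hat X (Ms s) y j ord0 - x|.
rewrite (_ : [set _ | _] = f @^-1` `[0, +oo[%classic); last first.
  by apply/seteqP; split=> y; rewrite /= in_itv/= andbT /f subr_ge0 => /conf_intP.
rewrite -[X in measurable X]setTI; apply: (_ : measurable_fun setT f) => //.
apply: measurable_funB.
  apply: measurable_funM => //; apply: measurableT_comp.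
    by apply: continuous_measurable_fun; exact: sqrt_continuous.
  by apply: measurable_funM => //; exact: measurable_sigma2_hat.
apply: measurableT_comp => //; apply: measurable_funB => //.
under eq_fun do rewrite /beta_hat /ls_coef mulmx_linform.
exact: measurable_linform.
Qed.

(** The range of [j] varies with [y]. On each of the finitely many events where [Mhat y] has a given
    value it is fixed, and coverage is a finite intersection. *)
Lemma measurable_coverage (Mhat : n.-tuple R -> 'I_d) (b : forall s, 'cV[R]_#|Ms s|) :
  (forall J : set 'I_d, measurable (Mhat @^-1` J)) ->
  measurable [set y | forall j : 'I_#|Ms (Mhat y)|, conf_int X alpha y j (b (Mhat y) j ord0)].
Proof.
move=> mM.
rewrite (_ : [set _ | _] = \big[setU/set0]_(s < d) (Mhat @^-1` [set s] `&`
    \big[setI/setT]_(j < #|Ms s|) [set y | conf_int X alpha y j (b s j ord0)])); last first.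
  apply/seteqP; split=> y /=.
    move=> h; rewrite -bigcup_seq; exists (Mhat y); first by rewrite /= mem_index_enum.
    by split=> //; rewrite -bigcap_seq => j _; exact: h.
  rewrite -bigcup_seq => -[s _ [/= ->]]; rewrite -bigcap_seq => h j.
  by apply: h; rewrite /= mem_index_enum.
apply: bigsetU_measurable => s _; apply: measurableI; first exact: mM.
by apply: bigsetI_measurable => j _; exact: measurable_conf_int.
Qed.

(** The factor [Num.sqrt (1 - zeta)] by which the estimated standard deviation may fall short is
    exactly the one by which the box has been shrunk. *)
Lemma conf_int_cover mu (s zeta : R) y (r : 'I_d) (j : 'I_#|Ms r|) :
  (#|Ms r| < n)%N -> 0 < s -> zeta <= 1 -> 0 <= K ->
  (1 - zeta) * n%:R <=
    sqnorm (tcol (recenter mu s y)) - misfit (Ms r) mu (recenter mu s y) ->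
  lin_box (studentized_mx X Ms) (Num.sqrt (1 - zeta) * K) (recenter mu s y) ->
  conf_int X alpha y j (ls_coef X (Ms r) mu j ord0).
Proof.
move=> rn s0 z1 K0 hres hbox; apply/conf_intP.
rewrite (beta_hat_error _ _ _ (lt0r_neq0 s0)).
have g0 := gram_inv_gt0 rankX j.
have sg0 : 0 < Num.sqrt (gram_inv X (Ms r) j j) by rewrite sqrtr_gt0.
have [i hi] := studentized_mxE X j.
have -> : linform (coef_mx X (Ms r) j) (recenter mu s y) =
    Num.sqrt (gram_inv X (Ms r) j j) * linform (studentized_mx X Ms i) (recenter mu s y).
  rewrite /linform mulr_sumr; apply: eq_bigr => l _; rewrite hi.
  by rewrite mulrA [X in _ = X * _]mulrC divfK ?gt_eqF.
rewrite !normrM (gtr0_norm s0) (gtr0_norm sg0) mulrA.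
have s2 := sigma2_hat_ge rn s0 z1 hres.
have s20 : 0 <= sigma2_hat X (Ms r) y.
  by apply: le_trans s2; rewrite mulr_ge0 ?sqr_ge0 ?subr_ge0.
apply: (@le_trans _ _ (s * Num.sqrt (gram_inv X (Ms r) j j) * (Num.sqrt (1 - zeta) * K))).
  by apply: ler_wpM2l; [rewrite mulr_ge0 ?(ltW s0) ?(ltW sg0)|exact: hbox].
rewrite mulrA ler_wpM2r// sqrtrM// [X in X <= _]mulrAC ler_wpM2r ?sqrtr_ge0//.
by rewrite -[X in X * _](gtr0_norm s0) -[X in X * _]sqrtr_sqr -sqrtrM ?sqr_ge0// ler_sqrt.
Qed.

End coverage.

Lemma sqrtr_ge_id (R : realType) (x : R) : 0 <= x <= 1 -> x <= Num.sqrt x.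
Proof.
move=> /andP[x0 x1]; rewrite -[leLHS]ger0_norm// -sqrtr_sqr ler_sqrt//.
by rewrite expr2 ler_piMl.
Qed.

(** * An explicit coverage bound at fixed sample size *)

Section fixed_sample_size.
Context {R : realType} {n p d : nat}.
Variables (X : 'M[R]_(n, p)) (Ms : 'I_d -> {set 'I_p}) (alpha delta tau : R).
Hypotheses (rankX : \rank X = p) (pn : (p < n)%N).
Hypotheses (alpha01 : 0 < alpha < 1) (delta_gt0 : 0 < delta) (tau_ge1 : 1 <= tau).
(** [eta] is the slack of the quantile, [e] the steepness of the soft box, [zeta] the relative
    shortfall allowed to the variance estimators, [B] the truncation level, [m3] a bound on the
    third absolute normal moment and [L] a bound on the leverages. *)
Variables (eta e zeta B m3 L : R).
Hypotheses (eta_gt0 : 0 < eta) (e_gt0 : 0 < e) (zeta01 : 0 < zeta <= 1) (B_gt0 : 0 < B).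
Hypotheses (m3P : (\int[stdN]_x (`|x| ^+ 3)%:E <= m3%:E)%E).
Hypotheses (L_ge0 : 0 <= L) (leverage : forall s, max_leverage X (Ms s) <= L).

Let k := (\sum_(s < d) #|Ms s|)%N.
Let kappa := tau `^ (1 + delta / 2) / B `^ delta.
Hypothesis kappa_zeta : kappa <= zeta / 4.

Let A := studentized_mx X Ms.
Let K := normal_quantile (1 - alpha) (corr (ls_cov 1 X Ms)).

Lemma quantile_bounds : 0 <= K /\ K <= Num.sqrt (k.+1%:R / alpha).
Proof.
have a01 : 0 < 1 - alpha < 1 by move: alpha01; lra.
have [m [A' [S [_ _ K0 Kle _]]]] := normal_quantileP a01 (centered_normal_ls_cov X Ms)
  (fun j => etrans (congr1 (fun G : 'M[R]_k => G j j) (esym (studentized_mx_gram rankX Ms)))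
    (studentized_mx_diag rankX j)).
by split=> //; apply: le_trans Kle _; rewrite opprB addrC subrK.
Qed.

Lemma studentized_lin_box_ge (Q : probability (n.-tuple R) R) : standardized Q ->
  (forall i, (\int[Q]_y (tail B (tproj i y))%:E <= kappa%:E)%E) ->
  ((1 - alpha - k%:R * (4 * (zeta * Num.sqrt (k.+1%:R / alpha) + eta + 3 / e)) -
    2 * @soft_box_cst R k e * k%:R ^+ 2 *
      (kappa + m3 / B + 2 * (k%:R * Num.sqrt L * B)))%:E <=
   Q (lin_box A (Num.sqrt (1 - zeta) * K)))%E.
Proof.
move=> stdQ hQ; have [K0 KM] := quantile_bounds.
have a01 : 0 < 1 - alpha < 1 by move: alpha01; lra.
have z1 : 0 <= 1 - zeta <= 1 by move: zeta01; lra.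
have sz1 : Num.sqrt (1 - zeta) <= 1 by rewrite -[leRHS]sqrtr1 ler_sqrt//; move: zeta01; lra.
have KE : K = normal_quantile (1 - alpha) (A *m A^T) by rewrite studentized_mx_gram.
have tK : Num.sqrt (1 - zeta) * K <= normal_quantile (1 - alpha) (A *m A^T).
  by rewrite -KE ler_piMl.
have := lin_box_ge stdQ (studentized_mx_diag rankX (Ms := Ms)) a01 eta_gt0 e_gt0 B_gt0 tK hQ m3P.
apply: le_trans; rewrite lee_fin -/k -/A -KE.
have kappa0 : 0 <= kappa by rewrite divr_ge0 ?powR_ge0.
have m30 : 0 <= m3.
  by rewrite -lee_fin; apply: le_trans m3P; apply: integral_ge0 => x _; rewrite lee_fin.
have C0 : 0 <= @soft_box_cst R k e := soft_box_cst_ge0 (ltW e_gt0).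
apply: lerB.
  rewrite lerD2l lerN2 ler_wpM2l// ler_wpM2l// lerD2r.
  (* Shrinking the box removes [K - Num.sqrt (1 - zeta) * K <= zeta * K] from its half-side; the
     uniform bound on [K] makes this at most a multiple of [zeta] independent of n. *)
  have := sqrtr_ge_id z1; move: KM K0; set M := Num.sqrt (k.+1%:R / alpha).
  by set q := Num.sqrt (1 - zeta); nra.
set T := kappa + m3 / B + 2 * (k%:R * Num.sqrt L * B).
apply: (@le_trans _ _ (\sum_i 2 * @soft_box_cst R k e * norm1 (col i A) ^+ 2 * T)).
  apply: ler_sum => i _; apply: ler_wpM2l; first by apply: mulr_ge0; [exact: mulr_ge0|exact: sqr_ge0].
  rewrite lerD2l ler_wpM2l//.
  by rewrite ler_wpM2r ?(ltW B_gt0)//; exact: norm1_col_studentized_le.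
have B0 := ltW B_gt0; rewrite -mulr_suml -mulr_sumr; apply: ler_wpM2r.
  apply: addr_ge0; first by apply: addr_ge0 => //; exact: divr_ge0.
  by do 3 apply: mulr_ge0 => //.
by apply: ler_wpM2l; [exact: mulr_ge0|exact: sum_sqr_norm1_col_studentized].
Qed.

Lemma coverage_ge (Mhat : n.-tuple R -> 'I_d) (P : probability (n.-tuple R) R) :
  (forall J : set 'I_d, measurable (Mhat @^-1` J)) -> lm_class delta tau P ->
  ((1 - alpha - k%:R * (4 * (zeta * Num.sqrt (k.+1%:R / alpha) + eta + 3 / e)) -
    2 * @soft_box_cst R k e * k%:R ^+ 2 *
      (kappa + m3 / B + 2 * (k%:R * Num.sqrt L * B)) -
    d%:R * (16 * B ^+ 4 / (zeta ^+ 2 * n%:R) + 2 * (p%:R + 1) / (zeta * n%:R)))%:E <=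
   P [set y | forall j : 'I_#|Ms (Mhat y)|,
     conf_int X alpha y j (beta_star X (Ms (Mhat y)) P j ord0)])%E.
Proof.
move=> mMhat hP; have [s [Q [s0 PQ stdQ tailQ]]] := lm_class_recenter delta_gt0 tau_ge1 hP.
set E := [set y | _]; set mu := mean P in PQ.
have [K0 _] := quantile_bounds.
have [z0 z1] : 0 < zeta /\ zeta <= 1 by move: zeta01; lra.
have n0 : (0 < n)%N by case: (n) pn.
have tailB i : (\int[Q]_y (tail B (tproj i y))%:E <= kappa%:E)%E by exact: tailQ.
have mE : measurable E.
  exact: (measurable_coverage X alpha (fun s => ls_coef X (Ms s) mu) mMhat).
pose box := lin_box A (Num.sqrt (1 - zeta) * K).
pose bad r := [set z : n.-tuple R |
  \sum_i tproj i z ^+ 2 - misfit X (Ms r) mu z < (1 - zeta) * n%:R].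
have mpre (F : set (n.-tuple R)) : measurable F -> measurable (recenter mu s @^-1` F).
  by move=> mF; rewrite -[X in measurable X]setTI; exact: measurable_recenter.
have mbox : measurable box by exact: measurable_lin_box.
have mbad r : measurable (bad r).
  rewrite (_ : bad r = (fun z => \sum_i tproj i z ^+ 2 - misfit X (Ms r) mu z) @^-1`
     `]-oo, (1 - zeta) * n%:R[%classic); last by apply/seteqP; split=> z; rewrite /= in_itv.
  rewrite -[X in measurable X]setTI; apply: (_ : measurable_fun setT _) => //.
  apply: measurable_funB; last exact: measurable_misfit.
  by apply: measurable_sum => i; apply: measurable_funX; exact: measurable_tproj.
have Qbad r : (Q (bad r) <=
    (16 * B ^+ 4 / (zeta ^+ 2 * n%:R) + 2 * (p%:R + 1) / (zeta * n%:R))%:E)%E.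
  apply: (sum_sqr_lower stdQ B_gt0 z0 n0 tailB kappa_zeta).
  - exact: measurable_misfit.
  - by move=> z; exact: misfit_ge0.
  - apply: le_trans (integral_misfit_le rankX (Ms r) mu stdQ) _.
    by rewrite lee_fin lerD2r ler_nat -[leqRHS]card_ord max_card.
(* At a given [y] only the variance estimator of the selected model matters, but the selection is
   arbitrary, so all the events [bad r] are summed. *)
have cover : (P (recenter mu s @^-1` box `\` E) <= \sum_r P (recenter mu s @^-1` bad r))%E.
  apply: probability_le_sum; [exact: measurableD (mpre _ mbox) mE|by move=> r; exact: mpre|].
  move=> y [hbox nE]; apply: contrapT => nbad; apply: nE => j.
  apply: (conf_int_cover rankX j _ s0 z1 K0 _ hbox).
    by apply: leq_ltn_trans pn; rewrite -[leqRHS]card_ord max_card.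
  rewrite leNgt; apply/negP => h; apply: nbad; exists (Mhat y).
  by rewrite /bad /= [X in X - _](_ : _ = sqnorm (tcol (recenter mu s y)))//;
    apply: eq_bigr => i _; rewrite mxE.
have := studentized_lin_box_ge stdQ tailB; rewrite PQ// -/box.
set v := (X in (X%:E <= _)%E -> _) => hv.
have -> w : (v - w)%:E = (v%:E - w%:E)%E by rewrite EFinB.
rewrite leeBlDr//; apply: le_trans hv _.
rewrite (measureDI _ (mpre _ mbox) mE) addeC; apply: leeD.
  by apply: le_measure; rewrite ?inE//; exact: measurableI (mpre _ mbox) mE.
apply: le_trans cover _.
apply: (@le_trans _ _ (\sum_(r < d) (16 * B ^+ 4 / (zeta ^+ 2 * n%:R) +
    2 * (p%:R + 1) / (zeta * n%:R))%:E)%E).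
  by apply: lee_sum => r _; rewrite -PQ.
by rewrite sumEFin lee_fin sumr_const card_ord [leRHS]mulr_natl.
Qed.

End fixed_sample_size.

(** * Choice of the parameters and passage to the limit *)

Lemma limn_einf_ge (R : realType) (l : \bar R) (u : (\bar R)^nat) :
  (\forall n \near \oo, (l <= u n)%E) -> (l <= limn_einf u)%E.
Proof.
move=> [N _ lu]; rewrite limn_einf_lim; apply: lime_ge; first exact: is_cvg_einfs.
exists N => // n /= Nn; apply: le_ereal_inf_tmp => _ [q /= nq] <-.
by apply: lu; exact: leq_trans nq.
Qed.

Lemma truncation_level (R : realType) (T delta m3 x : R) :
  0 <= T -> 0 < delta -> 0 <= m3 -> 0 < x ->
  exists B, [/\ 0 < B, T / B `^ delta <= x & m3 / B <= x].
Proof.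
move=> T0 d0 m30 x0; set B := 1 + m3 / x + (T / x) `^ delta^-1.
have mx0 : 0 <= m3 / x by rewrite divr_ge0// ltW.
have Tx0 : 0 <= T / x by rewrite divr_ge0// ltW.
have P0 := powR_ge0 (T / x) delta^-1.
have B0 : 0 < B by rewrite /B; lra.
exists B; split=> //.
  rewrite ler_pdivrMr ?powR_gt0// mulrC -ler_pdivrMr//.
  rewrite -[leLHS]powRr1// -(mulVf (lt0r_neq0 d0)) powRrM.
  by apply: ge0_ler_powR; rewrite ?nnegrE ?(ltW B0) ?(ltW d0)// /B; lra.
rewrite ler_pdivrMr// mulrC -ler_pdivrMr//; rewrite /B; lra.
Qed.

Theorem theorem3p2 (R : realType) (p d : nat)
  (Ms : 'I_d -> {set 'I_p})
  (d_gt0 : (0 < d)%N)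
  (Ms_inj : injective Ms)
  (Ms_neq0 : forall s, Ms s != finset.set0)
  (X : forall n, 'M[R]_(n, p))
  (alpha delta tau : R)
  (alpha01 : 0 < alpha < 1)
  (delta_gt0 : 0 < delta)
  (tau_ge1 : 1 <= tau)
  (rankX : \forall n \near \oo, \rank (X n) = p)
  (leverage0 : forall s, max_leverage (X n) (Ms s) @[n --> \oo] --> (0 : R))
  (Mhat : forall n, n.-tuple R -> 'I_d)
  (Mhat_measurable : forall n (J : set 'I_d), measurable (Mhat n @^-1` J)) :
  ((1 - alpha)%:E <=
   limn_einf (fun n : nat =>
     ereal_inf
       [set P [set y | let s := Mhat n y in
                       forall j : 'I_#|Ms s|,
                         conf_int (X n) alpha y j
                           (beta_star (X n) (Ms s) P j ord0)]
       | P in lm_class delta tau]))%E.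
Proof.
apply/lee_addgt0Pr => eps eps0; rewrite -leeBlDr// -EFinB; apply: limn_einf_ge.
have [m3 m3P] := @stdN_abs3_lty R.
have m30 : 0 <= m3.
  by rewrite -lee_fin; apply: le_trans m3P; apply: integral_ge0 => x _; rewrite lee_fin.
pose k := (\sum_(s < d) #|Ms s|)%N; pose M := Num.sqrt (k.+1%:R / alpha).
have k1 : 0 < k%:R + 1 :> R by rewrite addrC ltr_pwDl.
have M0 : 0 <= M := sqrtr_ge0 _.
(* The loss [eps] is budgeted as a quarter for the box ([E1]), a half for Lindeberg's error ([E2])
   and a quarter for the variance estimators ([E3]). In [E1] the terms [zeta * M], [eta = c] and
   [3 / e = c] are at most [c] each, for a total of [12 * (k%:R + 1) * c]. The added 1 in
   denominators guards against vanishing constants. *)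
pose c := eps / (48 * (k%:R + 1)).
have c0 : 0 < c by rewrite divr_gt0// mulr_gt0.
pose zeta := Num.min 1 (c / (M + 1)).
have zeta0 : 0 < zeta by rewrite lt_min ltr01 divr_gt0// ltr_wpDl.
have zeta01 : 0 < zeta <= 1 by rewrite zeta0 ge_min lexx.
have zetaM : zeta * M <= c.
  apply: (@le_trans _ _ (c / (M + 1) * M)).
    by rewrite ler_wpM2r// ge_min lexx orbT.
  by rewrite -mulrA ger_pMr// mulrC ler_pdivrMr ?ltr_wpDl// mul1r lerDl.
pose D := 2 * @soft_box_cst R k (3 / c) * k%:R ^+ 2.
have e0 : 0 < 3 / c by rewrite divr_gt0.
have D0 : 0 <= D.
  apply: mulr_ge0; last exact: sqr_ge0.
  by apply: mulr_ge0 => //; apply: soft_box_cst_ge0; exact: ltW.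
(* The first bound is the condition on [kappa] for truncated squares; the second makes the two tail
   terms of [E2] worth at most a quarter of [eps]. The smoothing constant [D] is fixed before
   [B]. *)
pose x := Num.min (zeta / 4) (eps / (8 * (D + 1))).
have x0 : 0 < x by rewrite lt_min !divr_gt0// mulr_gt0// ltr_wpDl.
have [B [B0 kappa_le m3B]] := truncation_level (powR_ge0 tau (1 + delta / 2)) delta_gt0 m30 x0.
(* [q ^+ 2] is the target for the leverages: the term of [E2] that grows with [B] then costs the
   remaining quarter of [eps]. It is chosen after [B], and only n comes later. *)
pose q := eps / (8 * (D + 1) * (k%:R + 1) * B).
have D1 : 0 < D + 1 by rewrite ltr_wpDl.
have q0 : 0 < q by rewrite divr_gt0// !mulr_gt0.
pose V := d%:R * (16 * B ^+ 4 / zeta ^+ 2 + 2 * (p%:R + 1) / zeta).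
have levL : \forall n \near \oo, forall s, max_leverage (X n) (Ms s) <= q ^+ 2.
  by apply: filter_forall => s; apply: (cvgr_le _ (leverage0 s)); rewrite exprn_gt0.
near=> n.
apply: le_ereal_inf_tmp => _ [P hP <-].
have rX : \rank (X n) = p by near: n.
have pn : (p < n)%N by near: n; exact: nbhs_infty_gt.
have nV : 4 * V / eps <= n%:R by near: n; exact: nbhs_infty_ger.
have lev : forall s, max_leverage (X n) (Ms s) <= q ^+ 2 by near: n.
have kz : tau `^ (1 + delta / 2) / B `^ delta <= zeta / 4.
  by apply: le_trans kappa_le _; rewrite ge_min lexx.
have := coverage_ge rX pn alpha01 delta_gt0 tau_ge1 c0 e0 zeta01 B0 m3P (sqr_ge0 q) lev kz
  (Mhat_measurable n) hP.
apply: le_trans; rewrite lee_fin -/k -/M -/D.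
have n0 : 0 < n%:R :> R by rewrite ltr0n; apply: leq_ltn_trans pn.
have -> : 3 / (3 / c) = c by rewrite invf_div mulrCA divff// mulr1.
rewrite sqrtr_sqr (gtr0_norm q0).
have E1 : k%:R * (4 * (zeta * M + c + c)) <= eps / 4.
  apply: (@le_trans _ _ ((k%:R + 1) * (12 * c))).
    apply: ler_pM => //; last lra.
      by rewrite mulr_ge0// !addr_ge0 ?(ltW c0)// mulr_ge0// ltW.
    by rewrite lerDl.
  by rewrite le_eqVlt; apply/orP; left; apply/eqP; rewrite /c; field; rewrite lt0r_neq0.
have E2 : D * (tau `^ (1 + delta / 2) / B `^ delta + m3 / B + 2 * (k%:R * q * B)) <= eps / 2.
  apply: (@le_trans _ _ ((D + 1) * (x + x + 2 * ((k%:R + 1) * q * B)))).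
    apply: ler_pM => //.
    - apply: addr_ge0; first by apply: addr_ge0; rewrite divr_ge0 ?powR_ge0 ?(ltW B0).
      by apply: mulr_ge0 => //; apply: mulr_ge0; [apply: mulr_ge0 => //|]; exact: ltW.
    - by rewrite lerDl.
    - apply: lerD; first exact: lerD.
      by rewrite ler_wpM2l// ler_wpM2r ?(ltW B0)// ler_wpM2r ?(ltW q0)// lerDl.
  have : x <= eps / (8 * (D + 1)) by rewrite ge_min lexx orbT.
  rewrite ler_pdivlMr ?mulr_gt0// => hx.
  have -> : 2 * ((k%:R + 1) * q * B) = eps / (4 * (D + 1)).
    by rewrite /q; field; rewrite !lt0r_neq0.
  have : (D + 1) * (eps / (4 * (D + 1))) = eps / 4 by field; rewrite lt0r_neq0.
  move: hx; set y := eps / (4 * _); nra.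
have E3 : d%:R * (16 * B ^+ 4 / (zeta ^+ 2 * n%:R) + 2 * (p%:R + 1) / (zeta * n%:R)) <= eps / 4.
  have -> : d%:R * (16 * B ^+ 4 / (zeta ^+ 2 * n%:R) + 2 * (p%:R + 1) / (zeta * n%:R)) = V / n%:R.
    by rewrite /V; field; rewrite !lt0r_neq0.
  move: nV; rewrite ler_pdivrMr// => nV; rewrite ler_pdivrMr//; lra.
lra.
Unshelve. all: by end_near.
Qed.
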